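(* Assume the max-arm structure with identifying scores, the standing model conditions, and the max-arm perturbation conditions. Fix $P\in\mathcal P$. Suppose $g(x,a,u)=g_a'(x)u+\rho(x,a)$ for all $u\in\mathbb R$ with $g_a'(x)\ne0$, and that for $P_X$-a.e. $x$, $\pi_a^P(x)>0$ and $\sigma_a^2(x;P)<\infty$ for every arm $a$, and $\sigma_a^2(x;P)>0$ for $a$ in the active set $\mathcal A^*(x)=\mathcal A^*(x;P)$. Then $$V^{\min}(x;P)\ \ge\ \Big(\sum_{a\in\mathcal A^*(x)}\frac{\pi_a^P(x)}{(g_a'(x))^2\sigma_a^2(x;P)}\Big)^{-1}\qquad P_X\text{-a.e.}$$ If moreover oracle realization holds at $P$, then $$V^{\min}(x;P)=\Big(\sum_{a\in\mathcal A^*(x)}\frac{\pi_a^P(x)}{(g_a'(x))^2\sigma_a^2(x;P)}\Big)^{-1}\qquad P_X\text{-a.e.},$$ and the integral of this function with respect to $P_X$, plus $\mathrm{Var}_{P_X}[\psi(X,u_P(X))]$, is attained as the variance under $P$ of the truth evaluation of the map in the oracle realization condition.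
   Context: General framework. $\mathcal X,\mathcal W$ are Polish spaces and $\mathcal P$ is a fixed class of Borel probability measures on $\mathcal X\times\mathcal W$. For $P\in\mathcal P$, $P_X$ is the marginal on $\mathcal X$ and $Q_x^P$ the regular conditional law of $W$ given $X=x$. The target is $\Psi(P)=E_{P_X}[\psi(X,u_P(X))]$ with $\psi$, $u_P$ measurable, $\psi(\cdot,u_P(\cdot))\in L^1(P_X)$, and $u_P(x)=u_{\mathrm{loc}}(x,Q_x^P)$ for one rule $u_{\mathrm{loc}}$. A nuisance declaration consists of measurable maps $\eta_j(P):\mathcal X\to\mathcal N_{0,j}$ ($j\le d$; $\mathcal N_0=\prod_j\mathcal N_{0,j}$), $\kappa(P):\mathcal X\to\mathcal K_0$ with $\kappa(P)(x)=\kappa_\flat(x,\eta(P)(x))$ for a measurable $\kappa_\flat$, and a Polish space $\mathcal W_{\mathrm{aux}}$, together with a measurable $\bar\psi$ such that $\psi(x,u_P(x))=\bar\psi(x,\eta(P)(x),\kappa(P)(x))$ $P_X$-a.s. The class $\mathcal F_{\mathrm B}$ consists of all measurable $f:\mathcal X\times\mathcal W\times\mathcal N_0\times\mathcal K_0\times\mathcal W_{\mathrm{aux}}\to\mathbb R$ such that for all $P,P'\in\mathcal P$ and measurable $w:\mathcal X\to\mathcal W_{\mathrm{aux}}$: if for some $j$, $\eta_l(P')=\eta_l(P)$ $P_X$-a.s. for all $l\ne j$, then $f(X,W,\eta(P')(X),\kappa(P)(X),w(X))\in L^1(P)$ with $P$-expectation $\Psi(P)$. Write $f_w^P(x,W)=f(x,W,\eta(P)(x),\kappa(P)(x),w(x))$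 (the truth evaluation). $V^{\min}(\cdot;P)$ is the essential infimum in $L^0(P_X)$ of $x\mapsto\mathrm{Var}_{Q_x^P}[f_w^P(x,\cdot)]$ over $f\in\mathcal F_{\mathrm B}$ with $\mathrm{Var}_P[f_w^P]<\infty$ ($+\infty$ if there is none); it does not depend on the measurable $w$. Standing model conditions. Fix a Borel graph $\{(x,Q):Q\in\mathfrak K_x\}$ of admissible conditional laws with Borel maps $\eta_{\mathrm{loc}}(x,Q),\kappa_{\mathrm{loc}}(x,Q)$ on it. (a) For $P\in\mathcal P$ and $P_X(A)>0$, the law with marginal $P_X(\cdot\cap A)/P_X(A)$ and the kernel of $P$ is in $\mathcal P$, with the same $\eta,\kappa$ values as $P$ on $A$. (b) There is a finite Borel cost $C(x,Q)\ge1$ on the graph with $|\psi(x,u_{\mathrm{loc}}(x,Q))|\le C(x,Q)$ (the integrand being Borel), also controlling the moments required by the model; each $P\in\mathcal P$ has $Q_x^P\in\mathfrak K_x$ a.s. and $\int C(x,Q_x^P)dP_X<\infty$; each universally measurable selection $R_x\in\mathfrak K_x$ with $\int C(x,R_x)dP_X<\infty$ defines, with marginal $P_X$, a law in $\mathcal P$. (c) $\eta(P)(x)=\eta_{\mathrm{loc}}(x,Q_x^P)$ and $\kappa(P)(x)=\kappa_{\mathrm{loc}}(x,Q_x^P)$ for $P_X$-a.e. $x$, and likewise for the integrand. Selections of non-integrable cost are localized: they are used on $\{C\le m\}$ and replaced by the baseline kernel elsewhere. Max-arm structure. $\mathcal A$ is a finite set, $\mathcal W=\mathcal A\times\widetilde{\mathcal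 W}$, $W=(A,\widetilde W)$, $Q_x^P(da,d\widetilde w)=\pi_a^P(x)Q_{x,a}^P(d\widetilde w)$ with all $\pi_a^P(x)>0$; $u_P(x)=(u_{P,a}(x))_{a\in\mathcal A}$ with $u_{P,a}(x)\in\mathcal U_0\subseteq\mathbb R$; $\psi(x,u)=\max_{a}g(x,a,u_a)$ with $g$ measurable and smooth in $u_a$. Declaration: $d=2$, $\eta_1(P)=(u_{P,a})_a$, $\eta_2(P)=\pi^P$ (in the open simplex), $\kappa(P)(x)=\mathcal A^*(x;P)=\arg\max_a g(x,a,u_{P,a}(x))$, $\mathcal K_0$ the nonempty subsets of $\mathcal A$. Identifying scores are measurable $h_a$ with $u_{P,a}(x)=E_{Q_{x,a}^P}[h_a(\widetilde W)]$ for all $P,x,a$; $\sigma_a^2(x;P)=\mathrm{Var}_{Q_{x,a}^P}[h_a]$. Max-arm perturbation conditions. For every $P\in\mathcal P$ and $P_X$-a.e. $x$: (X1) For every $a$, holding $\pi^P(x)$ and the other arm laws fixed, for every $\epsilon\in(0,1)$ and every finitely supported probability $\nu$ on $\mathrm{supp}\,Q_{x,a}^P$ with $E_\nu[h_a]=u_{P,a}(x)$, the admissible arm-$a$ laws contain $(1-\epsilon)Q_{x,a}^P+\epsilon\nu$. The resulting correspondence has Borel graph and finite cost $C$; selections with integrable cost glue to a law in $\mathcal P$ with the same $P_X,\eta,\kappa$ (others are cost-localized). (X2) There are a Borel-graph correspondence $x\mapsto D_x\subseteq\mathbb R^{|\mathcal A|}$ with $0\in D_x$ and a measurable correspondence $\mathcal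 R_P(x)\subseteq\mathcal A\setminus\mathcal A^*(x;P)$ such that for $a\in\mathcal R_P(x)$, $t e_a\in D_x$ for all sufficiently small $t$ that leave $a$ inactive. Moreover $D_x$ contains a jointly measurable path $r_x(t)$, $|t|<\epsilon_P(x)$, with $\epsilon_P:\mathcal X\to(0,\infty)$ measurable, whose inactive coordinates are zero and which satisfies $g(x,a,u_{P,a}(x)+r_{x,a}(t))=g(x,a,u_{P,a}(x))+t$ for $a\in\mathcal A^*(x;P)$. (X3) For every $\delta\in D_x$ there is a law $Q_{x,\delta}\ll Q_x^P$ on $\mathcal A\times\widetilde{\mathcal W}$ with arm probabilities $\pi^P(x)$ and arm score means $u_P(x)+\delta$, with $Q_{x,0}=Q_x^P$. The perturbation changes only $\eta_1$ and preserves $\eta_2$ and $\kappa$. The correspondence of these laws has Borel graph and finite cost $C$; every universally measurable selection $x\mapsto Q_{x,\delta(x)}$ with integrable cost glues to a law in $\mathcal P$ with marginal $P_X$ (direction $0$ is used outside each cost-localized set). Oracle realization at $P$. Let $\lambda_a^*(x)=\dfrac{\pi_a^P(x)/[(g_a'(x))^2\sigma_a^2(x;P)]}{\sum_{b\in\mathcal A^*(x)}\pi_b^P(x)/[(g_b'(x))^2\sigma_b^2(x;P)]}$ for $a\in\mathcal A^*(x)$ and $0$ otherwise, and $$\phi_P^{\lambda^*}(x,(a,\widetilde w))=\psi(x,u_P(x))+\mathbf 1\{a\in\mathcal A^*(x)\}\frac{g_a'(x)\lambda_a^*(x)}{\pi_a^P(x)}\{h_a(\widetilde w)-u_{P,a}(x)\}.$$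 The condition: there exist $f_P^*\in\mathcal F_{\mathrm B}$ and a measurable $w_P^*$ with $(f_P^* )^P_{w_P^*}=\phi_P^{\lambda^*}$ $P$-a.s. and $\mathrm{Var}_P[\phi_P^{\lambda^*}]<\infty$. *)

(* Defs.v *)
From HB Require Import structures.
From mathcomp Require Import all_boot all_order all_algebra.
From mathcomp Require Import all_classical all_reals all_analysis measurable_realfun.

Set Implicit Arguments.
Unset Strict Implicit.
Unset Printing Implicit Defensive.

Import Order.TTheory GRing.Theory Num.Theory.
Import numFieldNormedType.Exports.

Local Open Scope classical_set_scope.
Local Open Scope ring_scope.

(* A Polish space carries one of its complete separable metrics
   ([completePseudoMetricType] together with the Hausdorff property). *)
Definition polish (R : realType) (T : completePseudoMetricType R) : Prop :=
  hausdorff_space T /\ @second_countable T.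

Notation borel T := (g_sigma_algebraType (@open T)).
Notation discrete T := (g_sigma_algebraType [set: set T]).

(* The finite arm set, inhabited because the sigma-algebras of the library live
   on pointed types. *)
#[short(type="armType")]
HB.structure Definition Arm := {A of Finite A & isPointed A}.

HB.instance Definition _ (A : finType) := isPointed.Build {set A} finset.set0.

(* R^A with its product sigma-algebra. *)
Definition cylinder (R : realType) (A : Type) : set (set (A -> R)) :=
  [set E | exists a : A, exists2 B : set R,
     measurable B & E = [set v | B (v a)]].

Notation armvec R A := (g_sigma_algebraType (@cylinder R A)).

HB.instance Definition _ d d' (T : measurableType d) (T' : measurableType d') :=
  isMeasurableFun.Build _ _ (T * T')%type T fst (@measurable_fst _ _ T T').

Section universally_measurable.
Context (R : realType) d d' (T : measurableType d) (T' : measurableType d').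

Definition univ_measurable (U : set T) : Prop :=
  forall mu : probability T R, exists L B : set T,
    [/\ measurable L, measurable B, L `<=` U, U `<=` B & mu (B `\` L) = 0%E].

Definition univ_measurable_fun (f : T -> T') : Prop :=
  forall B, measurable B -> univ_measurable (f @^-1` B).

End universally_measurable.
Arguments univ_measurable_fun R {d d' T T'} f.

Section essential_infimum.
Local Open Scope ereal_scope.
Context d (T : measurableType d) (R : realType) (mu : probability T R).

Definition ae_lower_bound (F : set (T -> \bar R)) (V : T -> \bar R) : Prop :=
  measurable_fun setT V /\
  forall s, F s -> {ae mu, forall x, V x <= s x}.

(* The greatest lower bound of [F] in L^0(mu); it is +oo when [F] is empty. *)
Definition is_ess_inf_family (F : set (T -> \bar R)) (V : T -> \bar R) : Prop :=
  ae_lower_bound F V /\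
  forall U, ae_lower_bound F U -> {ae mu, forall x, U x <= V x}.

Definition ess_inf_family (F : set (T -> \bar R)) : T -> \bar R :=
  xget (cst +oo) [set V | is_ess_inf_family F V].

Lemma ess_inf_familyP (F : set (T -> \bar R)) :
  is_ess_inf_family F (ess_inf_family F).
Proof.
suff [V HV] : exists V, is_ess_inf_family F V by exact: (xgetI _ HV).
pose G := [set U | ae_lower_bound F U].
pose above (q : rat) (U : T -> \bar R) : set T := [set x | (ratr q)%:E < U x].
have mabove q U : measurable_fun setT U -> measurable (above q U).
  by move=> mU; rewrite -[above _ _]setTI; exact: emeasurable_fun_o_infty.
pose al q := ereal_sup [set mu (above q U) | U in G].
have G0 : G (cst -oo).
  by split; [exact: measurable_cst|move=> s _; apply: aeW => x /=; rewrite leNye].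
have al_ub q U : G U -> mu (above q U) <= al q.
  by move=> GU; apply: ereal_sup_ubound; exists U.
have al_fin q : al q \is a fin_num.
  rewrite ge0_fin_numE; last exact: le_trans (measure_ge0 _ _) (al_ub q _ G0).
  apply: (@le_lt_trans _ _ 1); last exact: ltry.
  apply: ge_ereal_sup => _ [U [mU _] <-]; exact/probability_le1/mabove.
have ex (i : rat * nat) : exists U, G U /\ al i.1 - (i.2.+1%:R^-1)%:E < mu (above i.1 U).
  have e0 : (0 < i.2.+1%:R^-1 :> R)%R by rewrite invr_gt0.
  by have [_ [U GU <-] ?] := ub_ereal_sup_adherent e0 (al_fin i.1); exists U.
have [U_ HU] := choice ex.
pose W k := if unpickle k is Some i then U_ i else cst -oo.
have GW k : G (W k).
  by rewrite /W; case: (unpickle k) => [i|]; [have [] := HU i|].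
pose V x := esups (W ^~ x) 0%N.
have WV k x : W k x <= V x by apply: ereal_sup_ubound; exists k.
have mV : measurable_fun setT V.
  by apply: measurable_fun_esups => k; have [] := GW k.
have GV : G V.
  split=> // s Fs.
  have : {ae mu, forall x k, W k x <= s x}.
    by apply: ae_foralln => k; have [_ /(_ _ Fs)] := GW k.
  apply: filterS => x H; apply: ge_ereal_sup => _ [k _ <-]; exact: H.
exists V; split=> // U GU.
have [mU HUF] := GU.
have GM : G (fun x => maxe (U x) (V x)).
  split; first exact: measurable_maxe.
  move=> s Fs; have [_ /(_ _ Fs) HV] := GV.
  by move: (HUF _ Fs) HV; apply: filterS2 => x h1 h2; rewrite ge_max h1.
have alV q : al q <= mu (above q V).
  apply/lee_addgt0Pr => e e0.
  have [n ne] : exists n : nat, (n.+1%:R^-1 < e)%R.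
    by have [n _ Hn] := near_infty_natSinv_lt (PosNum e0); exists n; exact: Hn (leqnn n).
  have [GUi lt] := HU (q, n).
  rewrite -leeBlDr// ltW// (@le_lt_trans _ _ (al q - n.+1%:R^-1%:E))//.
    by rewrite leeB// lee_fin ltW.
  apply: (lt_le_trans lt); apply: le_measure; rewrite ?inE.
  - by apply: mabove; have [] := GUi.
  - exact: mabove.
  - move=> x /= h; apply: lt_le_trans h _.
    by have := WV (pickle (q, n)) x; rewrite /W pickleK.
pose N q := above q U `\` above q V.
have mN q : measurable (N q) by apply: measurableD; exact: mabove.
have N0 q : mu (N q) = 0.
  have e1 : above q (fun x => maxe (U x) (V x)) = above q V `|` N q.
    apply/seteqP; split=> x; rewrite /above /N /= lt_max.
      case/orP => h; last by left.
      by case: (boolP ((ratr q)%:E < V x)) => h'; [left|right; split=> //; apply/negP].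
    by case=> [->|[->]] //; rewrite orbT.
  have := al_ub q _ GM; rewrite e1 measureU//; first last.
  - by apply/seteqP; split=> // x [h [_]]; apply.
  - exact: mabove.
  move=> h; apply/eqP; rewrite eq_le measure_ge0 andbT.
  have : al q + mu (N q) <= al q by apply: le_trans h; exact: leeD.
  by rewrite -leeBrDl// subee.
have : mu (\bigcup_k (if unpickle k is Some q then N q else set0)) = 0.
  apply/eqP; rewrite eq_le measure_ge0 andbT.
  have mk k : measurable (if unpickle k is Some q then N q else set0).
    by case: (unpickle k).
  apply: (le_trans (measure_sigma_subadditive _ _ _ (@subset_refl _ _))) => //.
    exact: bigcupT_measurable.
  rewrite eseries0// => k _ _; by case: (unpickle k).
move=> mu0; exists (\bigcup_k (if unpickle k is Some q then N q else set0)).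
split=> //.
  by apply: bigcupT_measurable => k; case: (unpickle k).
move=> x /= /negP; rewrite -ltNge => VU.
have [q /andP[q1 q2]] : exists q : rat, V x <= (ratr q)%:E < U x.
  have [r /andP[r1 r2]] : exists r : R, V x <= r%:E < U x.
    move: VU; case: (V x) => [a| |]; case: (U x) => [b| |] //=.
    - by rewrite lte_fin => ab; exists a; rewrite lexx lte_fin.
    - by move=> _; exists a; rewrite lexx ltry.
    - by move=> _; exists (b - 1)%R; rewrite leNye lte_fin ltrBlDr ltrDl ltr01.
    - by move=> _; exists 0%R; rewrite leNye ltry.
  have [r' /andP[r1' r2']] : exists r' : R, (r < r')%R && (r'%:E < U x).
    move: r2; case: (U x) => [b| |] //.
      rewrite lte_fin => rb; exists ((r + b) / 2)%R.
      by rewrite lte_fin midf_lt ?midf_lt//; have [-> ->] := midf_lt rb.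
    by move=> _; exists (r + 1)%R; rewrite ltry ltrDl ltr01.
  have [q] := rat_in_itvoo r1'; rewrite in_itv/= => /andP[h1 h2].
  exists q; rewrite (le_trans r1) ?lee_fin ?ltW//=.
  by apply: lt_trans r2'; rewrite lte_fin.
exists (pickle q); first exact: Logic.I.
rewrite pickleK; split=> [|h]; first exact: q2.
by move: (le_lt_trans q1 h); rewrite ltxx.
Qed.

End essential_infimum.

Section laws.
Context (R : realType) (X Wt : completePseudoMetricType R) (A : armType).

Local Notation W := (discrete A * borel Wt)%type.

(* Marginal law on X. *)
Definition marg (P : probability (borel X * W)%type R) :
  probability (borel X) R := distribution P fst.

(* [P] is the law with marginal [mu] and conditional laws [k]. *)
Definition law_of (mu : probability (borel X) R)
    (k : borel X -> probability W R)
    (P : probability (borel X * W)%type R) : Prop :=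
  forall E, measurable E -> P E = (\int[mu]_x k x (xsection E x))%E.

(* Arm probabilities and conditional laws given the arm of a law q on
   W = A * Wt, so that q({a} * B) = arm_prob q a * arm_law q a B. *)
Section arm_mass.
Variables (q : probability W R) (a : A).

Definition arm_mass (B : set (borel Wt)) : \bar R := q ([set a] `*` B).

Let measurable_arm (B : set (borel Wt)) : measurable B ->
  measurable ([set a] `*` B : set W).
Proof. by move=> mB; apply: measurableX => //; exact: sub_sigma_algebra. Qed.

Let arm_mass0 : arm_mass set0 = 0%E.
Proof. by rewrite /arm_mass setX0 measure0. Qed.

Let arm_mass_ge0 B : (0 <= arm_mass B)%E.
Proof. exact: measure_ge0. Qed.

Let arm_mass_sigma_additive : semi_sigma_additive arm_mass.
Proof.
move=> F mF tF mUF; rewrite /arm_mass.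
have -> : [set a] `*` \bigcup_n F n = \bigcup_n ([set a] `*` F n).
  apply/seteqP; split=> [[b w] [/= -> [n _ Fw]]|[b w] [n _ [/= -> Fw]]].
    by exists n.
  by split=> //; exists n.
apply: measure_semi_sigma_additive.
- by move=> n; exact: measurable_arm.
- apply/trivIsetP => i j _ _ ij; apply/seteqP; split=> // -[b w] [[_ /= Fi]] [_ /= Fj].
  by move/trivIsetP : tF => /(_ i j Logic.I Logic.I ij)/seteqP[/(_ w) + _]; apply.
- by apply: bigcupT_measurable => n; exact: measurable_arm.
Qed.

HB.instance Definition _ := isMeasure.Build _ _ _ arm_mass
  arm_mass0 arm_mass_ge0 arm_mass_sigma_additive.

Definition arm_prob : R := fine (arm_mass setT).

Definition arm_law : probability (borel Wt) R :=
  mnormalize arm_mass (dirac point).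

End arm_mass.

Definition supp (mu : probability (borel Wt) R) : set Wt :=
  [set w | forall U : set Wt, open U -> U w -> (0 < mu U)%E].

End laws.

(* The data of a max-arm problem. [cond P x] is the chosen version of the
   conditional law Q_x^P. The last five fields are the graph of admissible
   conditional laws, the local rules eta_loc = (eta1loc, eta2loc) and kappa_loc,
   and the cost. *)
Record model (R : realType) (X Wt : completePseudoMetricType R) (A : armType) :=
  Model {
  laws : set (probability (borel X * (discrete A * borel Wt))%type R) ;
  cond : probability (borel X * (discrete A * borel Wt))%type R ->
         X -> probability (discrete A * borel Wt)%type R ;
  score : A -> Wt -> R ;
  gain : X -> A -> R -> R ;
  range0 : set R ;
  uloc : X -> probability (discrete A * borel Wt)%type R -> A -> R ;
  adm : set (borel X * pprobability (discrete A * borel Wt)%type R) ;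
  eta1loc : X -> probability (discrete A * borel Wt)%type R -> A -> R ;
  eta2loc : X -> probability (discrete A * borel Wt)%type R -> A -> R ;
  kaploc : X -> probability (discrete A * borel Wt)%type R -> {set A} ;
  cost : X -> probability (discrete A * borel Wt)%type R -> R
}.

Section max_arm.
Context (R : realType) (X Wt : completePseudoMetricType R) (A : armType).
Variable M : model X Wt A.

Local Notation W := (discrete A * borel Wt)%type.
Local Notation Z := (borel X * W)%type.

Implicit Types (P : probability Z R) (x : X) (a : A).

Definition psi x (u : A -> R) : R :=
  \big[Num.max/gain M x point (u point)]_a gain M x a (u a).

Definition argmax x (u : A -> R) : {set A} :=
  [set a | [forall b, gain M x b (u b) <= gain M x a (u a)]]%SET.

Definition u_ P x : A -> R := uloc M x (cond M P x).

Definition pi_ P x : A -> R := arm_prob (cond M P x).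

Definition Qarm P x a : probability (borel Wt) R := arm_law (cond M P x) a.

Definition sigma2 P x a : \bar R := ('V_(Qarm P x a)[score M a])%E.

Definition psiP P x : R := psi x (u_ P x).

Definition Psi P : \bar R := ('E_(marg P)[psiP P])%E.

Definition eta1 P x : A -> R := u_ P x.
Definition eta2 P x : A -> R := pi_ P x.
Definition kappa P x : {set A} := argmax x (u_ P x).

Record max_arm_structure : Prop := MaxArmStructure {
  cond_measurable : forall P, laws M P ->
    measurable_fun setT (cond M P : borel X -> pprobability W R) ;
  cond_law : forall P, laws M P -> law_of (marg P) (cond M P) P ;
  score_measurable : forall a,
    measurable_fun setT (score M a : borel Wt -> R) ;
  gain_measurable : forall a,
    measurable_fun setT (fun z : borel X * R => gain M z.1 a z.2) ;
  gain_smooth : forall x a n t, derivable (derive1n n (gain M x a)) t 1 ;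
  u_measurable : forall P, laws M P ->
    measurable_fun setT (u_ P : borel X -> armvec R A) ;
  u_range : forall P, laws M P -> forall x a, range0 M (u_ P x a) ;
  psi_integrable : forall P, laws M P ->
    (marg P).-integrable setT (fun x => (psiP P x)%:E) ;
  pi_gt0 : forall P, laws M P -> forall x a, 0 < pi_ P x a ;
  score_integrable : forall P, laws M P -> forall x a,
    (Qarm P x a).-integrable setT (fun w => (score M a w)%:E) ;
  score_identifies : forall P, laws M P -> forall x a,
    ('E_(Qarm P x a)[score M a] = (u_ P x a)%:E)%E
}.

Definition glues P (k : X -> probability W R) (E : probability Z R -> Prop) :=
  exists P', [/\ laws M P', law_of (marg P) k P' & E P'].

Definition integrable_cost P (k : X -> probability W R) : Prop :=
  (\int[marg P]_x (cost M x (k x))%:E < +oo)%E.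

Definition localized P (m : R) (k : X -> probability W R) x :
    probability W R :=
  if cost M x (k x) <= m then k x else cond M P x.

(* Gluing of a selection of arbitrary cost: as it stands when its cost is
   integrable, and after localization in every case. *)
Definition glues_localized P (k : X -> probability W R)
    (E : probability Z R -> Prop) : Prop :=
  (integrable_cost P k -> glues P k E) /\
  forall m, glues P (localized P m k) E.

Record standing_conditions : Prop := StandingConditions {
  adm_measurable : measurable (adm M) ;
  eta1loc_measurable : measurable_fun (adm M)
    (fun z => eta1loc M z.1 z.2 : armvec R A) ;
  eta2loc_measurable : measurable_fun (adm M)
    (fun z => eta2loc M z.1 z.2 : armvec R A) ;
  kaploc_measurable : measurable_fun (adm M)
    (fun z => kaploc M z.1 z.2 : discrete {set A}) ;
  restriction : forall P, laws M P -> forall B : set (borel X),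
    measurable B -> (0 < marg P B)%E ->
    exists P', [/\ laws M P',
      law_of (marg P') (cond M P) P',
      forall D, measurable D ->
        marg P' D = (fine (marg P (D `&` B)) / fine (marg P B))%:E &
      {ae marg P, forall x, B x ->
        [/\ eta1 P' x = eta1 P x, eta2 P' x = eta2 P x
          & kappa P' x = kappa P x]}] ;
  cost_measurable : measurable_fun (adm M) (fun z => cost M z.1 z.2) ;
  cost_ge1 : forall x q, adm M (x, q) -> 1 <= cost M x q ;
  integrand_measurable : measurable_fun (adm M)
    (fun z => psi z.1 (uloc M z.1 z.2)) ;
  integrand_le_cost : forall x q, adm M (x, q) ->
    `|psi x (uloc M x q)| <= cost M x q ;
  cond_adm : forall P, laws M P ->
    {ae marg P, forall x, adm M (x, cond M P x)} ;
  cond_cost : forall P, laws M P -> integrable_cost P (cond M P) ;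
  selections_glue : forall P, laws M P ->
    forall k : borel X -> pprobability W R, univ_measurable_fun R k ->
    {ae marg P, forall x, adm M (x, k x)} ->
    integrable_cost P k -> glues P k (fun=> True) ;
  (* The integrand at P is psi x (uloc M x (cond M P x)) by definition, so only
     eta and kappa need a local representation. *)
  eta1_local : forall P, laws M P ->
    {ae marg P, forall x, eta1 P x = eta1loc M x (cond M P x)} ;
  eta2_local : forall P, laws M P ->
    {ae marg P, forall x, eta2 P x = eta2loc M x (cond M P x)} ;
  kappa_local : forall P, laws M P ->
    {ae marg P, forall x, kappa P x = kaploc M x (cond M P x)}
}.

(* [q] is the conditional law [p] with its arm-a law replaced by [r]. *)
Definition replace_arm (p : probability W R) a (r : set (borel Wt) -> \bar R)
    (q : probability W R) : Prop :=
  forall b (B : set (borel Wt)), measurable B ->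
    q ([set b] `*` B) =
    ((arm_prob p b)%:E * (if b == a then r B else arm_law p b B))%E.

(* [adm_a] is the correspondence of the conditional laws obtained from the
   admissible arm-a laws. *)
Definition arm_mixtures P : Prop := forall a,
  exists adm_a : set (borel X * pprobability W R),
  [/\ measurable adm_a,
    adm_a `<=` adm M,
    (forall x q, adm_a (x, q) ->
       exists r : probability (borel Wt) R,
         replace_arm (cond M P x) a r q),
    {ae marg P, forall x, forall (e : R) (nu : probability (borel Wt) R)
       (F : set Wt),
       0 < e < 1 -> finite_set F -> F `<=` supp (Qarm P x a) ->
       nu F = 1%E -> ('E_nu[score M a] = (u_ P x a)%:E)%E ->
       forall q, replace_arm (cond M P x) a
         (fun B => (1 - e)%:E * Qarm P x a B + e%:E * nu B)%E q ->
       adm_a (x, q)} &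
    forall k : borel X -> pprobability W R, univ_measurable_fun R k ->
      {ae marg P, forall x, adm_a (x, k x)} ->
      glues_localized P k (fun P' => {ae marg P, forall x,
        [/\ eta1 P' x = eta1 P x, eta2 P' x = eta2 P x
          & kappa P' x = kappa P x]})].

Definition zerov : A -> R := fun=> 0.
Definition unitv a (t : R) : A -> R := fun b => if b == a then t else 0.
Definition addv (u v : A -> R) : A -> R := fun a => u a + v a.

Definition direction_set P (D : set (borel X * armvec R A)) : Prop :=
  [/\ measurable D,
    {ae marg P, forall x, D (x, zerov)},
    (exists RP : X -> {set A},
       [/\ forall a, measurable ([set x | a \in RP x] : set (borel X)),
         {ae marg P, forall x, RP x \subset ~: kappa P x} &
         {ae marg P, forall x, forall a, a \in RP x ->
            exists2 e : R, 0 < e & forall t, `|t| < e ->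
              a \notin argmax x (addv (u_ P x) (unitv a t)) ->
              D (x, unitv a t)}]) &
    exists (eps : X -> R) (r : X -> R -> A -> R),
      [/\ measurable_fun setT (eps : borel X -> R),
        forall x, 0 < eps x,
        measurable_fun [set z : borel X * R | `|z.2| < eps z.1]
          (fun z => r z.1 z.2 : armvec R A) &
        {ae marg P, forall x, forall t, `|t| < eps x ->
          [/\ D (x, r x t),
            forall a, a \notin kappa P x -> r x t a = 0 &
            forall a, a \in kappa P x ->
              gain M x a (u_ P x a + r x t a) =
              gain M x a (u_ P x a) + t]}]].

(* Two [probability]s with the same values on measurable sets need not be equal,
   so graphs of correspondences of laws are closed under [eq_law]. *)
Definition eq_law (q q' : probability W R) : Prop :=
  forall E, measurable E -> q E = q' E.

(* [Q x dl] is the law with score means shifted by [dl]; a selection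
   x |-> Q x (dl x) is given by a universally measurable selection [dl] of D. *)
Definition direction_laws P (D : set (borel X * armvec R A)) : Prop :=
  exists Q : X -> (A -> R) -> probability W R,
  [/\ {ae marg P, forall x, eq_law (Q x zerov) (cond M P x)},
    {ae marg P, forall x, forall dl, D (x, dl) ->
      [/\ Q x dl `<< cond M P x,
        arm_prob (Q x dl) = pi_ P x,
        forall a,
          (arm_law (Q x dl) a).-integrable setT (fun w => (score M a w)%:E) /\
          ('E_(arm_law (Q x dl) a)[score M a] = (u_ P x a + dl a)%:E)%E,
        eta2loc M x (Q x dl) = eta2loc M x (cond M P x) /\
        kaploc M x (Q x dl) = kaploc M x (cond M P x) &
        adm M (x, Q x dl)]},
    measurable [set z : borel X * armvec R A * pprobability W R |
      D z.1 /\ eq_law z.2 (Q z.1.1 z.1.2)] &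
    forall dl : borel X -> armvec R A, univ_measurable_fun R dl ->
      {ae marg P, forall x, D (x, dl x)} ->
      glues_localized P (fun x => Q x (dl x)) (fun=> True)].

Definition perturbation_conditions : Prop := forall P, laws M P ->
  arm_mixtures P /\ exists D, direction_set P D /\ direction_laws P D.

Section influence.
Variables (gp : X -> A -> R) (P : probability Z R).

(* The inverse variance of the efficient combination of the active arms. *)
Definition active_info x : R :=
  \sum_(a in kappa P x) pi_ P x a / (gp x a ^+ 2 * fine (sigma2 P x a)).

Definition active_bound x : R := (active_info x)^-1.

Definition lambda_star x a : R :=
  if a \in kappa P x then
    (pi_ P x a / (gp x a ^+ 2 * fine (sigma2 P x a))) / active_info x
  else 0.

Definition phi_star (z : Z) : R :=
  psiP P z.1 +
  if z.2.1 \in kappa P z.1 then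
    gp z.1 z.2.1 * lambda_star z.1 z.2.1 / pi_ P z.1 z.2.1 *
    (score M z.2.1 z.2.2 - u_ P z.1 z.2.1)
  else 0.

End influence.

Section estimating_maps.
Variable Waux : completePseudoMetricType R.

(* Points (x, w, (eta1, eta2), kappa, v). The nuisance values range over the
   ambient spaces R^A, R^A and {set A}: a real measurable function on
   U_0^A, the open simplex and the nonempty subsets extends to a measurable
   function there, and only its values on them are used. *)
Local Notation Y :=
  (Z * (armvec R A * armvec R A) * discrete {set A} * borel Waux)%type.

(* With two nuisances, "eta_l(P') = eta_l(P) for all l <> j" reads
   eta2(P') = eta2(P) for j = 1 and eta1(P') = eta1(P) for j = 2. *)
Definition FB (f : Y -> R) : Prop :=
  measurable_fun setT f /\
  forall P P', laws M P -> laws M P' ->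
  forall v : borel X -> borel Waux, measurable_fun setT v ->
    {ae marg P, forall x, eta2 P' x = eta2 P x} \/
    {ae marg P, forall x, eta1 P' x = eta1 P x} ->
    let F (z : Z) := f (z, (eta1 P' z.1, eta2 P' z.1), kappa P z.1, v z.1) in
    P.-integrable setT (fun z => (F z)%:E) /\ ('E_P[F] = Psi P)%E.

Definition truth (f : Y -> R) P (v : X -> Waux) (z : Z) : R :=
  f (z, (eta1 P z.1, eta2 P z.1), kappa P z.1, v z.1).

Definition cond_variances P (v : X -> Waux) : set (X -> \bar R) :=
  [set s | exists f, [/\ FB f, ('V_P[truth f P v] < +oo)%E &
     s = (fun x => 'V_(cond M P x)[fun w => truth f P v (x, w)])%E]].

Definition Vmin P (v : X -> Waux) : X -> \bar R :=
  ess_inf_family (marg P) (cond_variances P v).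

Definition oracle_realization (gp : X -> A -> R) P (f : Y -> R)
    (v : X -> Waux) : Prop :=
  [/\ FB f, measurable_fun setT (v : borel X -> borel Waux),
    {ae P, forall z, truth f P v z = phi_star gp P z} &
    ('V_P[phi_star gp P] < +oo)%E].

End estimating_maps.

End max_arm.

(* Main.v *)
Require Import Defs.
From HB Require Import structures.
From mathcomp Require Import all_boot all_order all_algebra.
From mathcomp Require Import all_classical all_reals all_analysis measurable_realfun.
From mathcomp Require Import ring lra.

Set Implicit Arguments.
Unset Strict Implicit.
Unset Printing Implicit Defensive.

Import Order.TTheory GRing.Theory Num.Theory.
Import numFieldNormedType.Exports.

Local Open Scope classical_set_scope.
Local Open Scope ring_scope.

(* Fix an unbiased map f and let F be its truth evaluation at P. Gluing a
   perturbed law on an arbitrary measurable set of covariates localizes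
   unbiasedness: for almost every x, the mean of F(x, .) under an admissible
   perturbation of Q_x changes exactly as psi does.

   Perturbing one arm towards a two-point law with the same score mean changes
   neither eta nor kappa, so F(x, (a, .)) has the same mean under all these laws;
   hence it is affine in the score on the support of the arm, with a slope b_a.
   To test pairs of points for almost every x one needs measurable selections
   x |-> (w1, w2); they only have to be drawn from sets of positive conditional
   mass, which successive refinement by small open sets provides.

   Moving the scores along a path that raises all active gains by t leaves
   kappa unchanged and raises psi by t, so that the slopes satisfy
   sum over active a of pi_a b_a / g_a' = 1. The conditional variance is at least
   the sum over active a of pi_a b_a^2 sigma_a^2, and Cauchy-Schwarz gives the
   bound. The oracle's slopes are those of the equality case. *)

(** * Kernels and disintegrations *)

(** Unbiasedness is one integral identity per glued law, the conclusion is pointwise in x, and each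
    law has its own null set. Three obstacles lie in between. A glued kernel comes without
    measurability, so that it agrees with the version [cond M P'] fixed by the model only through a
    uniqueness theorem for disintegrations, proved with lower integrals. Costs need not be
    integrable, so each comparison is made where the cost is at most n, and only then are the
    countably many n collected. Finally, pairs of test points form an uncountable family: a single
    measurable selection therefore looks for pairs that violate the equation wherever these carry
    mass, and since the equation holds along every selection, almost no x has such pairs.

    The slopes b_a are only ever used at a fixed x, so they are not chosen measurably. They are
    transferred to the perturbed law through the absolute continuity in (X3): the affine form holds
    almost surely for the unperturbed arm, hence also for the perturbed one, whose score mean is
    known. *)

Lemma integral_prob_cst d (T : measurableType d) (R : realType) (Q : probability T R) (r : R) :
  (\int[Q]_x (EFin \o cst r) x = r%:E)%E.
Proof.
apply: (etrans (integral_cst _ measurableT r%:E)).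
by rewrite [X in (_ * X)%E](_ : _ = 1%E) ?mule1//; exact: probability_setT.
Qed.

Lemma measurable_fun_mem d (T : measurableType d) (E : set T) : measurable E ->
  measurable_fun setT (fun x => x \in E).
Proof.
move=> mE; apply: (@measurable_fun_bool _ _ _ _ true); rewrite setTI.
by rewrite (_ : _ @^-1` _ = E)//; apply/seteqP; split=> x; [move/set_mem|move/mem_set].
Qed.

Section kernels.
Local Open Scope ereal_scope.
Context d d' (T : measurableType d) (Y : measurableType d') (R : realType).
Implicit Types (k : T -> pprobability Y R) (f : T * Y -> \bar R).

Lemma measurable_pprobabilityP (k : T -> pprobability Y R) :
  measurable_fun setT k <->
  forall B, measurable B -> measurable_fun setT (fun x => (k x : probability Y R) B).
Proof.
split=> [mk B mB|mk].
  exact: (@measurable_kernel _ _ _ _ _ (kprobability mk)).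
apply: (measurability (@pset _ _ _ : set (set (pprobability Y R)))) => //.
move=> _ -[_ [r r01] [B mB <-]] <-; rewrite setTI.
have -> : k @^-1` mset B r = [set x | (k x : probability Y R) B < r%:E] by [].
by rewrite -[X in measurable X]setTI; apply: emeasurable_fun_infty_o => //; exact: mk.
Qed.

Lemma ge0_measurable_kint k f : measurable_fun setT k ->
  measurable_fun setT f -> (forall z, 0 <= f z) ->
  measurable_fun setT (fun x => \int[(k x : probability Y R)]_y f (x, y)).
Proof.
move=> mk mf f0.
exact: (measurable_fun_integral_finite_kernel f (kprobability mk) f0 mf).
Qed.

(** Positive and negative parts are integrated separately; their difference is measurable in the
    extended reals, where oo - oo has a value too. *)
Lemma measurable_kint k f : measurable_fun setT k -> measurable_fun setT f ->
  measurable_fun setT (fun x => \int[(k x : probability Y R)]_y f (x, y)).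
Proof.
move=> mk mf.
have -> : (fun x => \int[(k x : probability Y R)]_y f (x, y)) =
    (fun x => \int[(k x : probability Y R)]_y f^\+ (x, y)) \-
    (fun x => \int[(k x : probability Y R)]_y f^\- (x, y)).
  apply/funext => x; rewrite integralE; congr (_ - _).
    by apply: eq_integral => y _; rewrite !funeposE.
  by apply: eq_integral => y _; rewrite !funenegE.
apply: emeasurable_funB.
- exact: (ge0_measurable_kint mk (measurable_funepos mf)).
- exact: (ge0_measurable_kint mk (measurable_funeneg mf)).
Qed.

Lemma measurable_kxsection k (E : set (T * Y)) : measurable_fun setT k ->
  measurable E ->
  measurable_fun setT (fun x => (k x : probability Y R) (xsection E x)).
Proof.
move=> mk mE.
by apply: (@measurable_fun_xsection_finite_kernel _ _ _ _ _ (kprobability mk)); rewrite inE.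
Qed.

End kernels.

Section disintegration.
Local Open Scope ereal_scope.
Context d d' (T : measurableType d) (Y : measurableType d') (R : realType).
Variables (mu : probability T R) (k : T -> pprobability Y R).
Hypothesis mk : measurable_fun setT k.

HB.instance Definition _ (x : T) := isMeasurableFun.Build _ _ _ _ (pair x : Y -> T * Y)
  (@pair1_measurable _ _ T Y x).

(** The measure mu(dx) k(x, dy) is built by composing two kernels, the constant one on [unit] and x
    |-> image of [k x] under y |-> (x, y); its measure structure and Fubini's formula are then those
    of kernel composition. *)
Let k1 (u : unit) : pprobability T R := mu.
Let k2 (u : unit * T) : pprobability (T * Y)%type R :=
  distribution (k u.2 : probability Y R) (pair u.2).

Let mk1 : measurable_fun setT k1.
Proof. exact: measurable_cst. Qed.

Let mk2 : measurable_fun setT k2.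
Proof.
apply/measurable_pprobabilityP => B mB.
have := measurableT_comp (measurable_kxsection mk mB) (@measurable_snd _ _ unit T).
by congr measurable_fun; apply/funext => u; rewrite /= xsectionE.
Qed.

Definition semidirect : set (T * Y) -> \bar R :=
  mkcomp (kprobability mk1) (kprobability mk2) tt.

HB.instance Definition _ := Measure.on semidirect.

Lemma semidirectE E : semidirect E = \int[mu]_x (k x : probability Y R) (xsection E x).
Proof.
apply: eq_integral => x _.
by rewrite /kprobability /k2 /= /pushforward /= xsectionE.
Qed.

Let semidirect_setT : semidirect setT = 1.
Proof.
rewrite semidirectE (eq_integral (cst 1)); last first.
  move=> x _; rewrite (_ : xsection _ _ = setT); first exact: probability_setT.
  by apply/seteqP; split=> // y _; rewrite /xsection /= inE.
by rewrite integral_cst// mul1e; exact: probability_setT.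
Qed.

HB.instance Definition _ := Measure_isProbability.Build _ _ _ semidirect semidirect_setT.

Variable P : probability (T * Y)%type R.
Hypothesis PE : forall E, measurable E ->
  P E = \int[mu]_x (k x : probability Y R) (xsection E x).

Lemma ge0_integral_disintegration (f : T * Y -> \bar R) :
  measurable_fun setT f -> (forall z, 0 <= f z) ->
  \int[P]_z f z = \int[mu]_x \int[(k x : probability Y R)]_y f (x, y).
Proof.
move=> mf f0.
have := @integral_kcomp _ _ _ _ _ _ _ (kprobability mk1) (kprobability mk2) tt f f0 mf.
have -> : \int[kcomp (kprobability mk1) (kprobability mk2) tt]_z f z = \int[P]_z f z.
  by apply: eq_measure_integral => E mE _; apply: etrans (esym (PE mE)); exact: semidirectE.
move=> ->; apply: eq_integral => x _ /=.
by rewrite /kprobability /k2 /= ge0_integral_pushforward.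
Qed.

Lemma integrable_disintegration (f : T * Y -> \bar R) : P.-integrable setT f ->
  [/\ {ae mu, forall x, (k x : probability Y R).-integrable setT (fun y => f (x, y))},
      mu.-integrable setT (fun x => \int[(k x : probability Y R)]_y f (x, y)) &
      \int[P]_z f z = \int[mu]_x \int[(k x : probability Y R)]_y f (x, y)].
Proof.
move=> intf; have mf : measurable_fun setT f by exact: measurable_int intf.
have key (g : T * Y -> \bar R) : measurable_fun setT g -> (forall z, 0 <= g z) ->
    P.-integrable setT g ->
    mu.-integrable setT (fun x => \int[(k x : probability Y R)]_y g (x, y)).
  move=> mg g0 /integrableP[_]; under eq_integral do rewrite gee0_abs//.
  rewrite ge0_integral_disintegration// => goo; apply/integrableP; split.
    exact: ge0_measurable_kint.
  under eq_integral => x _ do rewrite gee0_abs ?integral_ge0//.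
  exact: goo.
have [mp mn] : measurable_fun setT f^\+ /\ measurable_fun setT f^\-.
  by split; [exact: measurable_funepos|exact: measurable_funeneg].
have kE x : \int[(k x : probability Y R)]_y f (x, y) =
    \int[(k x : probability Y R)]_y f^\+ (x, y) -
    \int[(k x : probability Y R)]_y f^\- (x, y).
  rewrite integralE; congr (_ - _).
    by apply: eq_integral => y _; rewrite !funeposE.
  by apply: eq_integral => y _; rewrite !funenegE.
have ip := key _ mp (funepos_ge0 f) (integrable_funepos measurableT intf).
have iN := key _ mn (funeneg_ge0 f) (integrable_funeneg measurableT intf).
split.
- have /integrable_ae : mu.-integrable setT
      (fun x => \int[(k x : probability Y R)]_y `|f (x, y)|).
    apply: (key (fun z => `|f z|)) => //; first exact: measurableT_comp.
    exact: integrable_abse.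
  move=> /(_ measurableT); apply: filterS => x /(_ Logic.I) fx.
  apply/integrableP; split; first exact: measurableT_comp.
  by rewrite ltey_eq fx.
- have -> : (fun x => \int[(k x : probability Y R)]_y f (x, y)) =
    (fun x => \int[(k x : probability Y R)]_y f^\+ (x, y)) \-
    (fun x => \int[(k x : probability Y R)]_y f^\- (x, y)) by apply/funext.
  exact: integrableB.
- under [RHS]eq_integral do rewrite kE.
  rewrite integralB// [LHS]integralE; congr (_ - _).
    by rewrite ge0_integral_disintegration.
  by rewrite ge0_integral_disintegration.
Qed.

Lemma ae_disintegration (Q : T * Y -> Prop) : {ae P, forall z, Q z} ->
  {ae mu, forall x, {ae (k x : probability Y R), forall y, Q (x, y)}}.
Proof.
move=> [N [mN N0 QN]].
have : {ae mu, forall x, (k x : probability Y R) (xsection N x) = 0}.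
  have mN' := measurable_kxsection mk mN.
  have /(ae_eq_integral_abs mu measurableT mN') :
      \int[mu]_x `|(k x : probability Y R) (xsection N x)| = 0.
    by under eq_integral do rewrite gee0_abs//; rewrite -PE.
  by apply: filterS => x /(_ Logic.I).
apply: filterS => x Nx; exists (xsection N x); split => //.
  exact: measurable_xsection.
by move=> y Qy; rewrite /xsection/= inE; apply: QN.
Qed.

Lemma disintegration_setX (C : set T) (B : set Y) : measurable C -> measurable B ->
  P (C `*` B) = \int[mu]_(x in C) (k x : probability Y R) B.
Proof.
move=> mC mB; rewrite PE; last exact: measurableX.
rewrite [RHS]integral_mkcond; apply: eq_integral => x _.
rewrite /patch; case: ifPn => xC; first by rewrite in_xsectionX.
by rewrite notin_xsectionX// measure0.
Qed.

End disintegration.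

Section disintegration_unique.
Local Open Scope ereal_scope.
Context d d' (T : measurableType d) (Y : measurableType d') (R : realType).

Import HBNNSimple.

(** The integral of a nonnegative function is a supremum over the simple functions below it, so for
    a nonmeasurable function it is a lower integral. The pointwise supremum of a maximizing sequence
    attains it. *)
Lemma measurable_minorant (mu : probability T R) (f : T -> \bar R) :
  (forall x, 0 <= f x) -> \int[mu]_x f x \is a fin_num ->
  exists g, [/\ measurable_fun setT g, forall x, 0 <= g x <= f x &
    \int[mu]_x g x = \int[mu]_x f x].
Proof.
move=> f0 ffin.
have ex (n : nat) : exists h : {nnsfun T >-> R}, (forall x, (h x)%:E <= f x) /\
    \int[mu]_x f x - (n.+1%:R^-1)%:E < \int[mu]_x (h x)%:E.
  have e0 : (0 < n.+1%:R^-1 :> R)%R by rewrite invr_gt0.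
  move: ffin; rewrite ge0_integralTE// => ffin.
  have [_ [h hf <-] lt] := ub_ereal_sup_adherent e0 ffin.
  by exists h; split => //; rewrite integral_nnsfun// patch_setT.
have [h Hh] := choice ex.
pose g x := esups (fun n => (h n x)%:E) 0%N.
have hg n x : (h n x)%:E <= g x by apply: ereal_sup_ubound; exists n.
have g0 x : 0 <= g x by apply: le_trans (hg 0%N x); rewrite lee_fin fun_ge0.
have gf x : g x <= f x by apply: ge_ereal_sup => _ [n _ <-]; exact: (Hh n).1.
have mg : measurable_fun setT g.
  by apply: measurable_fun_esups => n; exact/measurable_EFinP.
exists g; split => //; first by move=> x; rewrite g0 gf.
apply/eqP; rewrite eq_le; apply/andP; split.
  rewrite !ge0_integralTE//; apply: ereal_sup_le => _ [h' h'g <-].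
  by exists h' => // x; exact: le_trans (h'g x) (gf x).
apply/lee_addgt0Pr => e e0.
have [n ne] : exists n : nat, (n.+1%:R^-1 < e)%R.
  by have [n _ Hn] := near_infty_natSinv_lt (PosNum e0); exists n; exact: Hn (leqnn n).
have [_ lt] := Hh n.
rewrite -leeBlDr// ltW// (@le_lt_trans _ _ (\int[mu]_x f x - n.+1%:R^-1%:E))//.
  by rewrite leeB// lee_fin ltW.
apply: (lt_le_trans lt); apply: ge0_le_integral => //.
- by move=> x _; rewrite lee_fin fun_ge0.
- exact/measurable_EFinP.
Qed.

Variables (mu : probability T R) (k : T -> probability Y R).
Variables (k' : T -> pprobability Y R) (P : probability (T * Y)%type R).
Hypothesis mk' : measurable_fun setT k'.
Hypothesis PE : forall E, measurable E -> P E = \int[mu]_x k x (xsection E x).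
Hypothesis PE' : forall E, measurable E ->
  P E = \int[mu]_x (k' x : probability Y R) (xsection E x).

(** A measurable minorant [g] of x |-> [k x B] with the same integral has at most the mass of C x B
    over every C, and exactly the right mass over the whole space. Hence no C can fall short, and
    [g] is almost everywhere [k' x B]. *)
Let disintegration_le B : measurable B ->
  {ae mu, forall x, (k' x : probability Y R) B <= k x B}.
Proof.
move=> mB.
have kPE : \int[mu]_x k x B = P (setT `*` B).
  rewrite PE; last exact: measurableX.
  by apply: eq_integral => x _; rewrite in_xsectionX// inE.
have [||g [mg gf intg]] := @measurable_minorant mu (fun x => k x B).
- by move=> x; exact: measure_ge0.
- by rewrite kPE; apply: fin_num_measure; exact: measurableX.
have g0 x : 0 <= g x by have /andP[] := gf x.
have gle x : g x <= k x B by have /andP[] := gf x.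
have leC C : measurable C -> \int[mu]_(x in C) g x <= P (C `*` B).
  move=> mC; rewrite PE; last exact: measurableX.
  rewrite integral_mkcond !ge0_integralTE//; first last.
    by move=> x; rewrite /patch; case: ifP.
  apply: ereal_sup_le => _ [h' h'g <-]; exists h' => // x.
  apply: le_trans (h'g x) _; rewrite /patch; case: ifPn => xC.
    by rewrite in_xsectionX.
  exact: measure_ge0.
have intgmu : mu.-integrable setT g.
  apply/integrableP; split => //; under eq_integral do rewrite gee0_abs//.
  by rewrite intg kPE ltey_eq fin_num_measure//; exact: measurableX.
have eqC : forall E : set T, measurable E -> \int[mu]_(x in E) g x = P (E `*` B).
  move=> C mC; apply/eqP; rewrite eq_le leC//=.
  have mC' := measurableC mC.
  have finP D : measurable D -> P (D `*` B) \is a fin_num.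
    by move=> mD; apply: fin_num_measure; exact: measurableX.
  have : \int[mu]_(x in C) g x + \int[mu]_(x in ~` C) g x =
         P (C `*` B) + P (~` C `*` B).
    rewrite -ge0_integral_setU ?setvU//; first last.
    - by apply/disj_setPS => x [].
    - by rewrite setUC setvU.
    rewrite setUC setvU intg kPE -measureU//; first last.
    - by apply/seteqP; split => // -[x y] [[/= ? _] [/= ? _]].
    - exact: measurableX.
    - exact: measurableX.
    congr (P _); apply/seteqP; split=> [[x y] [_ /= By]|[x y] [] [//=]].
    by have [Cx|Cx] := pselect (C x); [left|right].
  move=> /eqP; rewrite eq_sym => /eqP h.
  rewrite -(@leeD2rE _ (P (~` C `*` B)))// ?finP// h leeD2l// leC//.
have : ae_eq mu setT g (fun x => (k' x : probability Y R) B).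
  apply: integral_ae_eq => //.
    by have /measurable_pprobabilityP := mk'; exact.
  move=> C _ mC; rewrite eqC//.
  exact: (disintegration_setX PE').
by apply: filterS => x /(_ Logic.I) <-.
Qed.

(* No measurability of [k] is assumed: its lower integrals already determine it. *)
Lemma disintegration_unique B : measurable B ->
  {ae mu, forall x, k x B = (k' x : probability Y R) B}.
Proof.
move=> mB.
(* For probabilities, the inequality on the complement is the reverse inequality on [B]. *)
move: (disintegration_le mB) (disintegration_le (measurableC mB)).
apply: filterS2 => x; rewrite !probability_setC// => h1 h2.
apply/eqP; rewrite eq_le h1 andbT.
by move: h2; rewrite leeD2lE// leeN2.
Qed.

End disintegration_unique.

(** * Measurable selections *)

Section countable_gluing.
Context d d' (T : measurableType d) (Y : measurableType d').

Lemma measurable_fun_countable_cases (idx : T -> nat) (s : nat -> T -> Y) :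
  (forall n, measurable (idx @^-1` [set n])) ->
  (forall n, measurable_fun setT (s n)) ->
  measurable_fun setT (fun x => s (idx x) x).
Proof.
move=> midx ms _ B mB; rewrite setTI.
have -> : (fun x => s (idx x) x) @^-1` B =
    \bigcup_n (idx @^-1` [set n] `&` (s n @^-1` B)).
  by apply/seteqP; split=> [x Bx|x [n _ [/= <-]]//]; exists (idx x).
apply: bigcupT_measurable => n; apply: measurableI; first exact: midx.
by rewrite -[X in measurable X]setTI; exact: ms.
Qed.

Lemma exists_first_index (A : nat -> set T) : (forall n, measurable (A n)) ->
  exists idx : T -> nat, (forall n, measurable (idx @^-1` [set n])) /\
    forall x, (exists n, A n x) -> A (idx x) x.
Proof.
move=> mA; pose D := seqDU A.
have mD n : measurable (D n).
  by apply: measurableD => //; apply: bigsetU_measurable.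
have tD := trivIset_seqDU A.
pose idx x := xget 0%N [set n | D n x].
have idxP x n : D n x -> idx x = n.
  move=> Dn; have Di : D (idx x) x by rewrite /idx; case: xgetP => [m _ //|/(_ n)].
  by apply: (tD _ _ Logic.I Logic.I); exists x.
exists idx; split=> [n|x [n An]].
  (* Points outside every [A n] receive the default index 0, whence the extra piece when n is 0. *)
  have -> : idx @^-1` [set n] =
      D n `|` (if n == 0%N then ~` \bigcup_k D k else set0).
    apply/seteqP; split=> [x /= xn|x /= [/idxP//|]].
      have [[k Dk]|ND] := pselect (exists k, D k x).
        by left; rewrite -xn (idxP _ _ Dk).
      right; move: xn; rewrite /idx; case: xgetP => [m _ Dm|_ <-].
        by case: ND; exists m.
      by rewrite eqxx => -[k _ Dk]; apply: ND; exists k.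
    case: ifP => [/eqP -> ND|//]; rewrite /idx; case: xgetP => // m _ Dm.
    by case: ND; exists m.
  apply: measurableU => //; case: ifP => // _; apply: measurableC.
  exact: bigcupT_measurable.
have : (\bigcup_k D k) x by rewrite -seqDU_bigcup_eq; exists n.
by move=> [m _ Dm]; rewrite (idxP _ _ Dm); case: Dm.
Qed.

End countable_gluing.

Lemma second_countable_enum (T : topologicalType) : @second_countable T ->
  exists U : nat -> set T, (forall n, open (U n)) /\
    forall x A, nbhs x A -> exists2 n, U n x & U n `<=` A.
Proof.
move=> [B /countable_injP[f finj] [Bop Bnb]].
(* Indices that code no basic set receive the empty set, which is open and harmless. *)
exists (fun n => xget set0 [set V | B V /\ f V = n]); split=> [n|x A /Bnb].
  case: xgetP => [V _ [BV _]|_]; [exact: Bop|exact: open0].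
move=> -[V /= [BV Vx] VA]; exists (f V); case: xgetP => [V' _ [BV' fV']|/(_ V)].
- by rewrite (finj _ _ _ _ fV') ?inE.
- by move=> h; case: h.
- by rewrite (finj _ _ _ _ fV') ?inE.
- by move=> h; case: h.
Qed.

Section pseudometric.
Context (R : realType) (Y : pseudoMetricType R).

(** The n-th closed set keeps the points that stay about 1/(n+1) away from the complement of [U].
    Interiors are taken because balls of a pseudometric type need not be open. *)
Lemma open_closed_exhaustion (U : set Y) : open U ->
  exists F : nat -> set Y, [/\ forall n, closed (F n), forall n, F n `<=` U &
    forall y, U y -> exists n, nbhs y (F n)].
Proof.
move=> oU; exists (fun n => ~` \bigcup_(z in ~` U) (ball z n.+1%:R^-1)°); split.
- move=> n; apply: open_closedC; apply: bigcup_open => z _; exact: open_interior.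
- move=> n y /= NF; apply: contrapT => NU; apply: NF; exists y => //.
  apply: nbhsx_ballx; by rewrite invr_gt0.
- move=> y Uy; have /nbhs_ballP[e /= e0 eU] : nbhs y U by exact: open_nbhs_nbhs.
  have e20 : 0 < e / 2 by rewrite divr_gt0.
  have [n ne] : exists n : nat, n.+1%:R^-1 < e / 2.
    by have [n _ Hn] := near_infty_natSinv_lt (PosNum e20); exists n; exact: Hn (leqnn n).
  exists n; apply/nbhs_ballP; exists (e / 2) => //= y' yy' [z NUz /interior_subset zy'].
  apply: NUz; apply: eU; rewrite [e]splitr; apply: (ball_triangle yy').
  by apply: ball_sym; apply: le_ball zy'; exact: ltW.
Qed.

End pseudometric.

Section polish_selection.
Context (R : realType) (Y : completePseudoMetricType R).

(** Exhaust an open [U] by closed sets such that each point of [U] is interior to one of them. The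
    limit lies in [U] exactly when one of these closed sets eventually contains the sequence, which
    is a countable condition. *)
Lemma measurable_fun_limit d (T : measurableType d)
    (s : nat -> T -> borel Y) (l : T -> borel Y) :
  (forall n, measurable_fun setT (s n)) ->
  (forall x, (fun n => s n x : Y) @ \oo --> (l x : Y)) -> measurable_fun setT l.
Proof.
move=> ms sl; apply: (measurability (@open Y : set (set (borel Y)))) => //.
move=> _ [U oU <-]; rewrite setTI.
have [F [cF FU UF]] := open_closed_exhaustion oU.
have -> : l @^-1` U = \bigcup_k \bigcup_N \bigcap_(n in [set n | (N <= n)%N]) (s n @^-1` F k).
  apply/seteqP; split=> [x /UF[k /sl [N _ HN]]|x [k _ [N _ HN]]].
    by exists k => //; exists N => // n /HN.
  apply: (FU k).
  have FKn : \forall n \near \oo, F k (s n x) by exists N => // n Nn; exact: HN.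
  exact: (closed_cvg _ (cF k) FKn _ (sl x)).
apply: bigcupT_measurable => k; apply: bigcupT_measurable => N.
apply: bigcap_measurable; first by exists N => /=.
move=> n _; rewrite -[X in measurable X]setTI; apply: ms => //.
rewrite -(setCK (F k)); apply: measurableC; apply: sub_sigma_algebra.
by rewrite /= openC.
Qed.

Section closed_section_approx.
Context d (T : measurableType d).
Variable M : probability (T * borel Y)%type R.

Let inner_approx (E : set (T * borel Y)) := forall e : R, 0 < e ->
  exists K : set (T * borel Y), [/\ measurable K, forall x, @closed Y (xsection K x), K `<=` E &
    (M (E `\` K) < e%:E)%E].

Let inner_approx_self (E : set (T * borel Y)) : measurable E ->
  (forall x, @closed Y (xsection E x)) -> inner_approx E.
Proof. by move=> mE cE e e0; exists E; split=> //; rewrite setDv measure0 lte_fin. Qed.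

(** The errors e / 2 / 2^(n+1) add up to e / 2; the other half makes the final inequality strict. *)
Let sub_series (E K : nat -> set (T * borel Y)) (X : set (T * borel Y)) (e : R) :
  0 < e -> measurable X -> (forall n, measurable (E n)) -> (forall n, measurable (K n)) ->
  X `<=` \bigcup_n (E n `\` K n) ->
  (forall n, (M (E n `\` K n) < (e / 2 / (2 ^ n.+1)%:R)%:E)%E) -> (M X < e%:E)%E.
Proof.
move=> e0 mX mE mK XEK HK; apply: (@le_lt_trans _ _ (e / 2)%:E); last first.
  by rewrite lte_fin ltr_pdivrMr// ltr_pMr// ltr1n.
have mEK n : measurable (E n `\` K n) by exact: measurableD.
apply: (le_trans (measure_sigma_subadditive M mEK mX XEK)).
have e20 : 0 <= e / 2 by rewrite divr_ge0// ltW.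
apply: le_trans (epsilon_trick0 xpredT e20).
by apply: lee_nneseries => // n _; exact: ltW (HK n).
Qed.

(** Only finite unions of closed sections are sure to be closed, so the union of the approximations
    is cut at some N, found by continuity of the measure from above. *)
Let inner_approx_bigcup (E : nat -> set (T * borel Y)) :
  (forall n, measurable (E n)) -> (forall n, inner_approx (E n)) ->
  inner_approx (\bigcup_n E n).
Proof.
move=> mE aE e e0.
have /choice[K HK] n : exists K : set (T * borel Y), [/\ measurable K, forall x, @closed Y (xsection K x),
    K `<=` E n & (M (E n `\` K) < (e / 2 / (2 ^ n.+1)%:R)%:E)%E].
  by apply: aE; rewrite divr_gt0// ?ltr0n ?expn_gt0// divr_gt0.
have mK n : measurable (K n) by have [] := HK n.
have mUE : measurable (\bigcup_n E n) by exact: bigcupT_measurable.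
pose B N := \bigcup_n E n `\` \bigcup_(n in [set n | (n < N)%N]) K n.
have mB N : measurable (B N).
  by apply: measurableD => //; exact: bigcup_measurable.
have capB : \bigcap_N B N = \bigcup_n E n `\` \bigcup_n K n.
  apply/seteqP; split=> [z Bz|z [Ez NK] N _].
    split; first by have [] := Bz 0%N Logic.I.
    by move=> [n _ Kn]; have [_] := Bz n.+1 Logic.I; apply; exists n => /=.
  by split=> // -[n _ Kn]; apply: NK; exists n.
have Be : (M (\bigcap_N B N) < e%:E)%E.
  apply: (@sub_series E K) => //; first exact: bigcapT_measurable.
    rewrite capB => z [[n _ En] NK]; exists n => //; split=> // Kn.
    by apply: NK; exists n.
  by move=> n; have [] := HK n.
have cvB : M \o B @ \oo --> M (\bigcap_N B N).
  apply: nonincreasing_cvg_mu => //.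
  - by rewrite ltey_eq fin_num_measure.
  - exact: bigcapT_measurable.
  - apply/nonincreasing_seqP => n; apply/subsetPset; apply: setDS.
    by move=> z [m /= mn Kz]; exists m => //=; rewrite (ltn_trans mn).
have [N HN] : exists N, (M (B N) < e%:E)%E.
  have /cvB[N _ HN] : nbhs (M (\bigcap_N B N)) [set y | (y < e%:E)%E].
    by apply: open_nbhs_nbhs; split => //; exact: open_ereal_lt_ereal.
  by exists N; exact: (HN N (leqnn N)).
exists (\bigcup_(n in [set n | (n < N)%N]) K n); split => //.
- exact: bigcup_measurable.
- move=> x; have -> : xsection (\bigcup_(n in [set n | (n < N)%N]) K n) x =
      \bigcup_(n in [set n | (n < N)%N]) xsection (K n) x.
    apply/seteqP; split=> y; rewrite /xsection /= inE => -[n nN Kn].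
      by exists n => //=; rewrite inE.
    by exists n => //; move: Kn; rewrite /= inE.
  apply: closed_bigcup; first exact: finite_II.
  by move=> n _; have [_ + _ _] := HK n; exact.
- by move=> z [n _ Kz]; exists n => //; have [_ _ + _] := HK n; exact.
Qed.

Let inner_approx_bigcap (E : nat -> set (T * borel Y)) :
  (forall n, measurable (E n)) -> (forall n, inner_approx (E n)) ->
  inner_approx (\bigcap_n E n).
Proof.
move=> mE aE e e0.
have /choice[K HK] n : exists K : set (T * borel Y), [/\ measurable K, forall x, @closed Y (xsection K x),
    K `<=` E n & (M (E n `\` K) < (e / 2 / (2 ^ n.+1)%:R)%:E)%E].
  by apply: aE; rewrite divr_gt0// ?ltr0n ?expn_gt0// divr_gt0.
have mK n : measurable (K n) by have [] := HK n.
exists (\bigcap_n K n); split.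
- exact: bigcapT_measurable.
- move=> x; have -> : xsection (\bigcap_n K n) x = \bigcap_n xsection (K n) x.
    apply/seteqP; split=> y; rewrite /xsection /= inE => h.
      by move=> n _ /=; rewrite inE; exact: h.
    by move=> n _; have := h n Logic.I; rewrite /= inE.
  by apply: closed_bigI => n _; have [_ + _ _] := HK n; exact.
- by move=> z Kz n _; have [_ _ + _] := HK n; apply; exact: Kz.
- apply: (@sub_series E K) => //.
  + by apply: measurableD; exact: bigcapT_measurable.
  + move=> z [Ez NK]; apply: contrapT => h; apply: NK => n _.
    by apply: contrapT => NKn; apply: h; exists n => //; split=> //; exact: Ez.
  + by move=> n; have [] := HK n.
Qed.

(** The classical inner regularity argument, with closedness demanded in the second coordinate only.
    Approximating the complement as well makes the class stable under complements; a union then uses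
    both closure properties above, the intersection for its complement. *)
Let good : set (set (T * borel Y)) :=
  [set E | [/\ measurable E, inner_approx E & inner_approx (~` E)]].

Let good_sigma : sigma_algebra setT good.
Proof.
have set0E : good set0.
  split=> //.
  - by apply: inner_approx_self => // x; rewrite xsection0; exact: closed0.
  - rewrite setC0; apply: inner_approx_self => // x; rewrite (_ : xsection _ _ = setT).
      exact: closedT.
    by apply/seteqP; split=> // y _; rewrite /xsection /= inE.
split => //.
- move=> E [mE aE aE']; rewrite setTD; split=> //; first exact: measurableC.
  by rewrite setCK.
- move=> E gE; split.
  + by apply: bigcupT_measurable => n; have [] := gE n.
  + by apply: inner_approx_bigcup => n; have [] := gE n.
  + rewrite setC_bigcup; apply: inner_approx_bigcap => n; last by have [] := gE n.
    by apply: measurableC; have [] := gE n.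
Qed.

Let goodI A B : good A -> good B -> good (A `&` B).
Proof.
move=> gA gB; have [g0 gC gU] := good_sigma.
have gC' E : good E -> good (~` E) by move=> /gC; rewrite setTD.
rewrite -[A `&` B]setCK setCI -bigcup2E; apply: (gC' _); apply: gU => n.
by rewrite /bigcup2; case: n => [|[|n]] //=; exact: (gC' _).
Qed.

(** A rectangle is the intersection of two cylinders. Over a set of [T], the sections are empty or
    everything; over an open set of [Y], the cylinder is a countable union of closed ones and its
    complement has closed sections. *)
Let measurable_good : measurable `<=` good.
Proof.
have [g0 gC gU] := good_sigma.
rewrite measurable_prod_measurableType; apply: smallest_sub; first exact: good_sigma.
move=> _ [A mA [B mB <-]].
have -> : A `*` B = (A `*` setT) `&` (setT `*` B).
  by apply/seteqP; split=> [[x y] [] //|[x y] [[/= ? _] [_ /= ?]]].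
apply: goodI.
  have mAT : measurable (A `*` setT : set (T * borel Y)) by exact: measurableX.
  have cAT (A' : set T) x : @closed Y (xsection (A' `*` setT : set (T * borel Y)) x).
    have [xA|xA] := boolP (x \in A').
      by rewrite in_xsectionX//; exact: closedT.
    by rewrite notin_xsectionX//; exact: closed0.
  split => //; first exact: inner_approx_self.
  have -> : ~` (A `*` setT : set (T * borel Y)) = ~` A `*` setT.
    apply/seteqP; split=> [[x y] /= h|[x y] [/= h _] [//]].
    by split=> // Ax; apply: h.
  by apply: inner_approx_self => //; apply: measurableX => //; exact: measurableC.
suff : measurable `<=` [set B : set (borel Y) | good (setT `*` B)] by apply.
apply: smallest_sub.
  split=> [|E /= gE|E /= gE].
  - by rewrite /= setX0.
  - have := gC _ gE; congr good; apply/seteqP; split=> [[x y] [_ /= h]|[x y] [_ [_ /= h]]].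
      by split=> //; split=> // Ey; apply: h.
    by split=> // -[].
  - have := gU _ gE; congr good; apply/seteqP; split=> [[x y] [n _ [_ /= h]]|[x y] [_ [n _ /= h]]].
      by split=> //; exists n.
    by exists n.
move=> U oU /=.
have mU (V : set Y) : open V -> measurable (V : set (borel Y)) by exact: sub_sigma_algebra.
have mX V : measurable (V : set (borel Y)) -> measurable (setT `*` V : set (T * borel Y)).
  by move=> mV; exact: measurableX.
have xX V x : xsection (setT `*` V : set (T * borel Y)) x = V.
  by rewrite in_xsectionX// inE.
split; first by apply: mX; exact: mU.
- have [F [cF FU UF]] := open_closed_exhaustion oU.
  have mF n : measurable (F n : set (borel Y)).
    by rewrite -(setCK (F n)); apply: measurableC; apply: mU; rewrite openC.
  have -> : setT `*` U = \bigcup_n (setT `*` F n) :> set (T * borel Y).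
    apply/seteqP; split=> [[x y] [_ /= /UF[n /nbhs_singleton Fy]]|[x y] [n _ [_ /= Fy]]].
      by exists n.
    by split=> //; exact: (FU n).
  apply: inner_approx_bigcup => n; first exact: mX.
  by apply: inner_approx_self => [|x]; [exact: mX|rewrite xX].
- have -> : ~` (setT `*` U : set (T * borel Y)) = setT `*` ~` U.
    apply/seteqP; split=> [[x y] /= h|[x y] [_ /= h] [_ //]].
    by split=> // Uy; apply: h.
  apply: inner_approx_self => [|x]; first by apply: mX; apply: measurableC; exact: mU.
  by rewrite xX; exact: open_closedC.
Qed.

(** Closed sections are what allows a selection to be obtained as a limit of approximating points
    without leaving the set. *)
Lemma closed_section_approx (E : set (T * borel Y)) (e : R) : measurable E -> 0 < e ->
  exists K : set (T * borel Y), [/\ measurable K, forall x, @closed Y (xsection K x), K `<=` E &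
    (M (E `\` K) < e%:E)%E].
Proof. by move=> /measurable_good[_ + _]; exact. Qed.

End closed_section_approx.

Section measurable_selection.
Context d (T : measurableType d).
Variable k : T -> pprobability (borel Y) R.
Hypothesis mk : measurable_fun setT k.

(** Positive mass stands in for nonemptiness of the section: it depends measurably on x, whereas the
    projection of a measurable set need not be measurable. *)
Let charged (E : set (T * borel Y)) : set T :=
  [set x | (0 < (k x : probability (borel Y) R) (xsection E x))%E].

Let measurable_charged E : measurable E -> measurable (charged E).
Proof.
move=> mE; rewrite -[charged E]setTI.
apply: emeasurable_fun_o_infty => //; exact: measurable_kxsection.
Qed.

(* Refine by a countable cover by small open sets, keeping at each stage the
   first piece that leaves positive mass. *)
Lemma closed_section_selection (K : set (T * borel Y)) : @second_countable Y ->
  measurable K -> (forall x, @closed Y (xsection K x)) ->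
  exists s : T -> borel Y, measurable_fun setT s /\
    forall x, charged K x -> K (x, s x).
Proof.
move=> /second_countable_enum[U [oU nbU]] mK cK.
(* [W (n, i)] pairs the i-th basic set with the centre of a ball of radius 1/(n+1) containing it,
   and is empty when there is no such ball. For fixed n these sets still cover [Y]. *)
have /choice[W HW] (n : nat * nat) : exists W : set Y * Y,
    [/\ open W.1, W.1 `<=` ball W.2 n.1.+1%:R^-1 &
      (exists p, U n.2 `<=` ball p n.1.+1%:R^-1) -> W.1 = U n.2].
  have [[p Up]|Np] := pselect (exists p, U n.2 `<=` ball p n.1.+1%:R^-1).
    by exists (U n.2, p); split=> //; exact: oU.
  by exists (set0, point); split; [exact: open0|move=> y []|move=> /Np].
have mW n : measurable ((W n).1 : set (borel Y)).
  by apply: sub_sigma_algebra; have [] := HW n.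
have Wcover n y : exists i, (W (n, i)).1 y.
  have n0 : 0 < n.+1%:R^-1 :> R by rewrite invr_gt0.
  have [i Uy Ui] := nbU y _ (nbhsx_ballx y _ n0).
  by exists i; have [_ _ ->//] := HW (n, i); exists y.
have mcyl (V : set (borel Y)) : measurable V -> measurable (setT `*` V : set (T * borel Y)).
  by move=> mV; exact: measurableX.
(* A piece that leaves positive mass exists, since countably many null pieces would make the whole
   section null. Nonmeasurable sets get the dummy index 0. *)
have /choice[idx Hidx] (a : nat * set (T * borel Y)) : exists idx : T -> nat,
    measurable a.2 -> (forall i, measurable (idx @^-1` [set i])) /\
    forall x, charged a.2 x -> charged (a.2 `&` (setT `*` (W (a.1, idx x)).1)) x.
  have [ma|?] := pselect (measurable a.2); last by exists (fun=> 0%N).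
  have [i|i [mi Hi]] := @exists_first_index _ T
      (fun i => charged (a.2 `&` (setT `*` (W (a.1, i)).1))).
    by apply: measurable_charged; apply: measurableI => //; exact: mcyl.
  exists i => _; split=> // x cx; apply: (Hi x).
  apply: contrapT => NW; move: cx; rewrite /charged /=.
  have mx j : measurable (xsection (a.2 `&` (setT `*` (W (a.1, j)).1)) x).
    by apply: measurable_xsection; apply: measurableI => //; exact: mcyl.
  have sub : xsection a.2 x `<=`
      \bigcup_j xsection (a.2 `&` (setT `*` (W (a.1, j)).1)) x.
    move=> y; rewrite /xsection /= inE => ay.
    by have [j Wy] := Wcover a.1 y; exists j => //=; rewrite inE.
  move/lt_geF/negP; apply; apply: le_trans (measure_sigma_subadditive
    (k x : probability (borel Y) R) mx (measurable_xsection x ma) sub) _.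
  rewrite eseries0// => j _ _; apply/eqP; rewrite eq_le measure_ge0 andbT leNgt.
  by apply/negP => h; apply: NW; exists j.
pose fix E n := if n is m.+1 then
    E m `&` [set z | (W (m, idx (m, E m) z.1)).1 z.2] else K.
have mE n : measurable (E n).
  elim: n => //= n IH; apply: measurableI => //.
  have -> : [set z | (W (n, idx (n, E n) z.1)).1 z.2] =
      \bigcup_i ((idx (n, E n) @^-1` [set i]) `*` (W (n, i)).1) :> set (T * borel Y).
    by apply/seteqP; split=> [[x y] /= h|[x y] [i _ [/= <-]]//]; eexists.
  apply: bigcupT_measurable => i; apply: measurableX => //.
  by have [+ _] := Hidx (n, E n) IH; exact.
pose p n x : borel Y := (W (n, idx (n, E n) x)).2.
have mp n : measurable_fun setT (p n).
  apply: (@measurable_fun_countable_cases _ _ _ _ (idx (n, E n))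
    (fun i _ => (W (n, i)).2 : borel Y)).
    by have [+ _] := Hidx (n, E n) (mE n).
  by move=> i; exact: measurable_cst.
have cE n x : charged K x -> charged (E n) x.
  move=> cx; elim: n => //= n IH; have [_ /(_ x IH)] := Hidx (n, E n) (mE n).
  congr (_ < (k x : probability (borel Y) R) _)%E.
  apply/seteqP; split=> y; rewrite /xsection /= !inE.
    by move=> [? [_ ?]].
  by move=> [? ?].
have decr n m : (n <= m)%N -> E m `<=` E n.
  move=> /subnK <-; elim: (m - n)%N => // i IH; rewrite addSn => z /= [Ez _].
  exact: IH.
have exz x : charged K x -> forall n, exists y, E n.+1 (x, y).
  move=> cx n; apply: contrapT => h; have := cE n.+1 x cx.
  rewrite /charged /= (_ : xsection _ _ = set0) ?measure0 ?ltxx//.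
  by apply/seteqP; split=> // y; rewrite /xsection /= inE => Ey; apply: h; exists y.
have near_p x n m y : (n <= m)%N -> E m.+1 (x, y) -> ball (p n x : Y) n.+1%:R^-1 y.
  move=> nm Ey; have : E n.+1 (x, y) by exact: decr Ey.
  move=> [_ /= Wy].
  by have [_ + _] := HW (n, idx (n, E n) x); exact.
have small e : 0 < e -> exists n : nat, forall m, (n <= m)%N -> m.+1%:R^-1 < e / 2 :> R.
  move=> e0; have e20 : 0 < e / 2 by rewrite divr_gt0.
  by have [n _ Hn] := near_infty_natSinv_lt (PosNum e20); exists n => m /Hn.
have cauchy_p x : charged K x -> cauchy ((fun n => p n x : Y) @ \oo).
  move=> cx; apply: cauchy_exP => e e0; have [n Hn] := small e e0.
  exists (p n x : Y); exists n => // m /= nm; have [y Ey] := exz x cx m.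
  rewrite [e]splitr; apply: (ball_triangle (y := y)).
    by apply: le_ball (near_p _ _ _ _ nm Ey); exact/ltW/Hn.
  by apply: ball_sym; apply: le_ball (near_p _ _ _ _ (leqnn m) Ey); exact/ltW/Hn.
(* Where the section is not charged the centres need not converge; a constant sequence there makes
   the limit exist for every x. *)
pose q n x : borel Y := if x \in charged K then p n x else point.
have mq n : measurable_fun setT (q n).
  apply: measurable_fun_ifT; [|exact: mp|exact: measurable_cst].
  by apply: measurable_fun_mem; exact: measurable_charged.
have cvq x : cvg ((fun n => q n x : Y) @ \oo).
  have [xK|/negbTE xK] := boolP (x \in charged K).
    rewrite (_ : (fun n => q n x) = p ^~ x); last by apply/funext => n; rewrite /q xK.
    by apply: cauchy_cvg; apply: cauchy_p; exact: set_mem.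
  rewrite (_ : (fun n => q n x) = fun=> point); last by apply/funext => n; rewrite /q xK.
  exact: is_cvg_cst.
exists (fun x => lim ((fun n => q n x : Y) @ \oo)); split.
  exact: (measurable_fun_limit mq).
move=> x cx; set l := lim _.
have pl : (fun n => p n x : Y) @ \oo --> l.
  have := cvq x; rewrite /l (_ : (fun n => q n x) = p ^~ x)//.
  by apply/funext => n; rewrite /q mem_set.
suff : xsection K x l by rewrite /xsection /= inE.
apply: (cK x) => B /nbhs_ballP[e /= e0 eB].
have [n Hn] := small e e0.
have e20 : 0 < e / 2 by rewrite divr_gt0.
have [N _ HN] := pl _ (nbhsx_ballx l (e / 2) e20).
(* This point of the section is within e / 2 of the centre of its stage, which is itself within e /
   2 of [l]; closedness of the section then puts [l] in it. *)
have [y Ey] := exz x cx (maxn n N).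
exists y; split.
  by rewrite /xsection /= inE; exact: (decr 0%N (maxn n N).+1).
apply: eB; rewrite [e]splitr; apply: (ball_triangle (HN (maxn n N) (leq_maxr _ _))).
by apply: le_ball (near_p _ _ _ _ (leqnn _) Ey); apply/ltW/Hn; exact: leq_maxl.
Qed.

(** Approximate [C] from inside by sets [K n] with closed sections, up to mass 1/(n+1) for the joint
    measure. What their union misses is null, so for almost every x a charged section of [C] has a
    charged section of some [K n]; the selection of the first such n is used. *)
Lemma charged_selection (mu : probability T R) (C : set (T * borel Y)) :
  @second_countable Y -> measurable C ->
  exists s : T -> borel Y, measurable_fun setT s /\
    {ae mu, forall x, (0 < (k x : probability (borel Y) R) (xsection C x))%E -> C (x, s x)}.
Proof.
move=> scY mC.
have /choice[K HK] n : exists K : set (T * borel Y), [/\ measurable K,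
    forall x, @closed Y (xsection K x), K `<=` C &
    (semidirect mu mk (C `\` K) < n.+1%:R^-1%:E)%E].
  by apply: closed_section_approx => //; rewrite invr_gt0.
have mK n : measurable (K n) by have [] := HK n.
have /choice[s Hs] n : exists s : T -> borel Y, measurable_fun setT s /\
    forall x, charged (K n) x -> K n (x, s x).
  by have [mKn cKn _ _] := HK n; exact: closed_section_selection.
have [i [mi Hi]] := exists_first_index (fun n => measurable_charged (mK n)).
exists (fun x => s (i x) x); split.
  by apply: measurable_fun_countable_cases => // n; have [] := Hs n.
pose N := C `\` \bigcup_n K n.
have mN : measurable N by apply: measurableD => //; exact: bigcupT_measurable.
have N0 : semidirect mu mk N = 0%E.
  apply/eqP; rewrite eq_le measure_ge0 andbT; apply/lee_addgt0Pr => e e0.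
  have [n _ Hn] := near_infty_natSinv_lt (PosNum e0); rewrite add0e.
  have [_ _ _ /ltW lt] := HK n.
  apply: (@le_trans _ _ (n.+1%:R^-1)%:E); last by rewrite lee_fin ltW// (Hn n (leqnn n)).
  apply: le_trans lt; apply: le_measure; rewrite ?inE//; first exact: measurableD.
  by move=> z [Cz NK]; split=> // Kz; apply: NK; exists n.
have : {ae mu, forall x, {ae (k x : probability (borel Y) R), forall y, ~ N (x, y)}}.
  have aeN : {ae semidirect mu mk, forall z, ~ N z}.
    by exists N; split=> // z /=; rewrite not_notE.
  exact: (ae_disintegration mk (fun E _ => semidirectE mu mk E) aeN).
apply: filterS => x Nx Cx.
have [_ _ KC _] := HK (i x); apply: KC; have [_] := Hs (i x); apply; apply: (Hi x).
apply: contrapT => h; move: Cx; rewrite lt_neqAle => /andP[+ _] => /negP; apply.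
have k0 n : (k x : probability (borel Y) R) (xsection (K n) x) = 0%E.
  apply/eqP; rewrite eq_le measure_ge0 andbT leNgt; apply/negP => hn; apply: h.
  by exists n.
rewrite eq_sym eq_le measure_ge0 andbT.
have mx n : measurable (xsection (K n) x) by exact: measurable_xsection.
have mxU : measurable (\bigcup_n xsection (K n) x) by exact: bigcupT_measurable.
have mxN : measurable (xsection N x) by exact: measurable_xsection.
have sub : xsection C x `<=` xsection N x `|` \bigcup_n xsection (K n) x.
  move=> y /xsectionP Cy.
  have [[n _ Kn]|NK] := pselect ((\bigcup_n K n) (x, y)).
    by right; exists n => //; apply/xsectionP.
  by left; apply/xsectionP.
have leC : ((k x : probability (borel Y) R) (xsection C x) <=
    (k x : probability (borel Y) R) (xsection N x `|` \bigcup_n xsection (K n) x))%E.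
  by apply: le_measure sub; apply/mem_set; [exact: measurable_xsection|exact: measurableU].
apply: (le_trans leC); apply: (le_trans (measureU2 _ mxN mxU)).
rewrite [X in (X + _)%E](_ : _ = 0%E); last first.
  apply/negligibleP => //; apply: negligibleS Nx => y.
  by rewrite /xsection /= inE not_notE.
rewrite add0e; apply: le_trans (measure_sigma_subadditive _ mx mxU (@subset_refl _ _)) _.
by rewrite eseries0// => n _ _; exact: k0.
Qed.

End measurable_selection.

End polish_selection.

(** * Decomposition over the arms *)

Section arm_decomposition.
Context (R : realType) (Wt : completePseudoMetricType R) (A : armType).
Local Notation W := (discrete A * borel Wt)%type.
Local Open Scope ereal_scope.
Implicit Types (q : probability W R) (a : A).

Lemma measurable_armX a (B : set (borel Wt)) : measurable B ->
  measurable ([set a] `*` B : set W).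
Proof. by move=> mB; apply: measurableX => //; exact: sub_sigma_algebra. Qed.

Lemma measurable_discrete (T : pointedType) d (Y : measurableType d) (f : discrete T -> Y) :
  measurable_fun setT f.
Proof. by move=> _ B mB; exact: sub_sigma_algebra. Qed.

Lemma arm_mass_fin_num q a B : measurable B -> arm_mass q a B \is a fin_num.
Proof. by move=> mB; apply: fin_num_measure; exact: measurable_armX. Qed.

(** For an arm of probability zero [arm_law] is a default Dirac law, and both sides vanish. *)
Lemma arm_massE q a (B : set (borel Wt)) : measurable B ->
  arm_mass q a B = (arm_prob q a)%:E * arm_law q a B.
Proof.
move=> mB; rewrite /arm_law /= /mnormalize /arm_prob.
have fT := arm_mass_fin_num q a measurableT.
have [m0|m0] := eqVneq (arm_mass q a setT) 0.
  rewrite m0 mul0e; apply/eqP; rewrite eq_le measure_ge0 andbT -m0.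
  by apply: le_measure; rewrite ?inE.
have -> : (arm_mass q a setT == +oo) = false by apply/negbTE; rewrite -ltey ltey_eq fT.
rewrite /= muleC -muleA -EFinM mulVf ?mule1// fine_eq0//.
Qed.

Lemma arm_prob_ge0 q a : (0 <= arm_prob q a)%R.
Proof. exact/fine_ge0/measure_ge0. Qed.

Lemma sum_arm_mass q (E : set W) : measurable E ->
  q E = \sum_a arm_mass q a (xsection E a).
Proof.
move=> mE.
have mEa a : measurable ([set a] `*` xsection E a : set W).
  by apply: measurable_armX; exact: measurable_xsection.
rewrite [in LHS](_ : E = \bigcup_(a in [set: A]) ([set a] `*` xsection E a)); last first.
  apply/seteqP; split=> [[a w] Eaw|[a w] [b _ [/= ->]]].
    by exists a => //; split => //=; apply/xsectionP.
  by move=> /xsectionP.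
rewrite measure_fin_bigcup//.
- rewrite (@fsbigE _ _ _ _ _ (index_enum A)) ?index_enum_uniq//=; last first.
    by move=> a _; rewrite mem_index_enum.
  by apply: eq_big => [a|//]; have := @mem_set _ [set: A] a Logic.I.
- exact: finite_finset.
- apply/trivIsetP => a b _ _ ab; apply/seteqP; split=> // -[c w].
  by move=> [[/= -> _] [/= ab' _]]; rewrite ab' eqxx in ab.
Qed.

Lemma measurable_fun_arm d (Y : measurableType d) (F : W -> Y) a :
  measurable_fun setT F -> measurable_fun setT (fun w => F (a, w)).
Proof.
move=> mF.
by have := measurableT_comp mF (@pair1_measurable _ _ _ _ (a : discrete A)).
Qed.

(** On measurable sets [q] is the finite sum of the arm laws, carried to their arms and scaled by
    the arm probabilities, so integration reduces to a sum of measures. *)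
Lemma ge0_integral_arm q (F : W -> \bar R) : measurable_fun setT F ->
  (forall w, 0 <= F w) ->
  \int[q]_w F w = \sum_a (arm_prob q a)%:E * \int[arm_law q a]_y F (a, y).
Proof.
move=> mF F0.
pose r a : {nonneg R} := NngNum (arm_prob_ge0 q a).
pose m (n : nat) : {measure set W -> \bar R} :=
  let a := nth point (index_enum A) n in
  mscale (r a) (distribution (arm_law q a) (@pair (discrete A) (borel Wt) a)).
have sumE (g : A -> \bar R) :
    \sum_(n < size (index_enum A)) g (nth point (index_enum A) n) = \sum_a g a.
  by rewrite [RHS](big_nth point) big_mkord.
have -> : \int[q]_w F w = \int[msum m (size (index_enum A))]_w F w.
  apply: eq_measure_integral => E mE _; apply: (etrans (sum_arm_mass q mE)).
  rewrite -sumE; apply: eq_bigr => i _.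
  rewrite /m /= arm_massE; last exact: measurable_xsection.
  by rewrite xsectionE.
rewrite ge0_integral_measure_sum// -sumE; apply: eq_bigr => i _.
by rewrite /m /= ge0_integral_mscale//= ge0_integral_pushforward.
Qed.

Lemma integrable_arm q (F : W -> \bar R) : (forall a, (0 < arm_prob q a)%R) ->
  q.-integrable setT F -> forall a, (arm_law q a).-integrable setT (fun y => F (a, y)).
Proof.
move=> q0 /integrableP[mF Foo] a; apply/integrableP; split; first exact: measurable_fun_arm.
move: Foo; rewrite ge0_integral_arm//; last exact: measurableT_comp.
rewrite (bigD1 a)//= => Foo.
have : (arm_prob q a)%:E * \int[arm_law q a]_y `|F (a, y)| < +oo.
  apply: le_lt_trans Foo; rewrite leeDl// sume_ge0// => b _.
  by rewrite mule_ge0 ?integral_ge0// lee_fin ltW.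
rewrite ltey => h; rewrite ltey; apply: contraNneq h => ->.
by rewrite gt0_muley// lte_fin.
Qed.

Lemma integral_arm q (F : W -> \bar R) : (forall a, (0 < arm_prob q a)%R) ->
  q.-integrable setT F ->
  \int[q]_w F w = \sum_a (arm_prob q a)%:E * \int[arm_law q a]_y F (a, y).
Proof.
move=> q0 iF; have mF := measurable_int _ iF.
have iFa := integrable_arm q0 iF.
rewrite integralE !ge0_integral_arm//;
  [|exact: measurable_funeneg|exact: measurable_funepos].
have pE a : \int[arm_law q a]_y F^\+ (a, y) = \int[arm_law q a]_y (fun z => F (a, z))^\+ y.
  by apply: eq_integral => y _; rewrite !funeposE.
have nE a : \int[arm_law q a]_y F^\- (a, y) = \int[arm_law q a]_y (fun z => F (a, z))^\- y.
  by apply: eq_integral => y _; rewrite !funenegE.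
have fp a : \int[arm_law q a]_y (fun z => F (a, z))^\+ y \is a fin_num.
  exact: (integrable_fin_num measurableT (integrable_funepos measurableT (iFa a))).
have fN a : \int[arm_law q a]_y (fun z => F (a, z))^\- y \is a fin_num.
  exact: (integrable_fin_num measurableT (integrable_funeneg measurableT (iFa a))).
rewrite -sumeN => [|a b _ _]; last first.
  by rewrite nE; apply: fin_num_adde_defr; rewrite fin_numM//; exact: fN.
rewrite -big_split; apply: eq_bigr => a _ /=; rewrite pE nE -muleBr//; last first.
  by apply: fin_num_adde_defl; rewrite fin_numN.
by rewrite [in RHS]integralE.
Qed.

Lemma eq_law_arm q q' : eq_law q q' -> forall a,
  arm_prob q a = arm_prob q' a /\ forall B, measurable B -> arm_law q a B = arm_law q' a B.
Proof.
move=> qq' a.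
have mE B : measurable B -> arm_mass q a B = arm_mass q' a B.
  by move=> mB; apply: qq'; exact: measurable_armX.
have pE : arm_prob q a = arm_prob q' a by rewrite /arm_prob mE.
have lawE p B : arm_law p a B =
    (if (arm_mass p a setT == 0) || (arm_mass p a setT == +oo) then \d_point B
     else arm_mass p a B * (fine (arm_mass p a setT))^-1%:E).
  by rewrite /arm_law /= /mnormalize; case: ifP.
by split => // B mB; rewrite !lawE !mE.
Qed.

Lemma eq_law_armP q q' :
  (forall a B, measurable B -> q ([set a] `*` B) = q' ([set a] `*` B)) -> eq_law q q'.
Proof.
move=> h E mE; rewrite !sum_arm_mass//; apply: eq_bigr => a _.
by apply: h; exact: measurable_xsection.
Qed.

End arm_decomposition.

(** * Countable determination of Borel measures, and supports *)

Section borel_determination.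
Context (R : realType) (Y : completePseudoMetricType R).
Hypothesis scY : @second_countable Y.

(** Finite intersections of basic open sets form a countable pi-system generating the Borel sets.
    Countability lets an almost everywhere equality on each set become, off one null set, an
    equality of laws. *)
Lemma countable_determination : exists V : nat -> set (borel Y),
  (forall n, measurable (V n)) /\
  forall m1 m2 : {measure set (borel Y) -> \bar R},
    (m1 setT < +oo)%E -> (forall n, m1 (V n) = m2 (V n)) ->
    forall B, measurable B -> m1 B = m2 B.
Proof.
have [U [oU nbU]] := second_countable_enum scY.
pose I (s : seq nat) : set (borel Y) := \big[setI/setT]_(i <- s) U i.
pose V n := if unpickle n is Some s then I s else setT.
have IE s : V (pickle s) = I s by rewrite /V pickleK.
have mU n : measurable (U n : set (borel Y)) by apply: sub_sigma_algebra; exact: oU.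
have mI s : measurable (I s) by rewrite /I; elim/big_ind : _ => // *; exact: measurableI.
have mV n : measurable (V n) by rewrite /V; case: unpickle.
exists V; split => // m1 m2 m1oo m12 B mB.
pose G := range I.
apply: (@g_sigma_algebra_measure_unique _ _ _ G _ (fun=> setT)) => //.
- by move=> _ [s _ <-].
- by move=> _; exists [::]; rewrite // /I big_nil.
- by rewrite bigcup_const.
- by move=> _ _ [s _ <-] [t _ <-]; exists (s ++ t); rewrite // /I big_cat.
- by move=> _ [s _ <-]; rewrite -IE.
- suff : measurable `<=` <<s G >> by apply.
  apply: smallest_sub; first exact: smallest_sigma_algebra.
  move=> O oO; have -> : O = \bigcup_(n in [set n | U n `<=` O]) U n.
    apply/seteqP; split=> [y Oy|y [n /= UO Uy]]; last exact: UO.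
    by have [n Uy UO] := nbU y O (open_nbhs_nbhs (conj oO Oy)); exists n.
  rewrite bigcup_mkcond.
  have gU n : <<s G >> (if n \in [set n | U n `<=` O] then U n else set0).
    case: ifP => _; last exact: sigma_algebra0.
    by apply: sub_gen_smallest; exists [:: n] => //; rewrite /I big_seq1.
  by have [_ _ h] := smallest_sigma_algebra setT G; exact: h.
Qed.

Context d (T : measurableType d).
Variable k : T -> pprobability (borel Y) R.
Hypothesis mk : measurable_fun setT k.

(** The complement of the support is the union of the null basic sets. This countable description
    yields both joint measurability in x and the fact that the support has full mass. *)
Let suppE (mu : probability (borel Y) R) (U : nat -> set Y) :
  (forall n, open (U n)) -> (forall x A, nbhs x A -> exists2 n, U n x & U n `<=` A) ->
  supp mu = ~` \bigcup_n (if (0 < mu (U n))%E then set0 else U n).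
Proof.
move=> oU nbU; apply/seteqP; split=> y.
  by move=> sy [n _]; case: ifPn => // /negP + Uy; apply; apply: sy.
move=> /= Ny V oV Vy; have [n Uy UV] := nbU y V (open_nbhs_nbhs (conj oV Vy)).
have [Un|Un] := boolP (0 < mu (U n))%E.
  apply: (lt_le_trans Un); apply: le_measure => //; rewrite inE;
  by apply: sub_sigma_algebra => //; exact: oU.
by case: Ny; exists n => //; rewrite (negbTE Un).
Qed.

Lemma measurable_supp :
  measurable [set z : T * borel Y | supp (k z.1) z.2].
Proof.
have [U [oU nbU]] := second_countable_enum scY.
have mU n : measurable (U n : set (borel Y)) by apply: sub_sigma_algebra; exact: oU.
have -> : [set z : T * borel Y | supp (k z.1) z.2] =
    ~` \bigcup_n ([set x | ~~ (0 < (k x : probability (borel Y) R) (U n))%E] `*` U n).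
  apply/seteqP; split=> [[x y]|[x y]] /=; rewrite (suppE (k x) oU nbU).
    move=> h [n _ [/= h1 h2]]; apply: h; exists n => //.
    by rewrite (negbTE h1).
  by move=> h [n _]; case: ifPn => // h1 Uy; apply: h; exists n.
apply: measurableC; apply: bigcupT_measurable => n; apply: measurableX => //.
have -> : [set x | ~~ (0 < (k x : probability (borel Y) R) (U n))%E] =
    ~` [set x | (0 < (k x : probability (borel Y) R) (U n))%E].
  by apply/seteqP; split=> x /= /negP.
apply: measurableC; rewrite -[X in measurable X]setTI.
apply: emeasurable_fun_o_infty => //.
by move/measurable_pprobabilityP : mk; exact.
Qed.

Lemma supp_full (mu : probability (borel Y) R) : {ae mu, forall y, supp mu y}.
Proof.
have [U [oU nbU]] := second_countable_enum scY.
have mU n : measurable (U n : set (borel Y)) by apply: sub_sigma_algebra; exact: oU.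
have mN n : measurable ((if (0 < mu (U n))%E then set0 else U n) : set (borel Y)).
  by case: ifP.
exists (\bigcup_n (if (0 < mu (U n))%E then set0 else U n)); split.
- exact: bigcupT_measurable.
- apply/eqP; rewrite eq_le measure_ge0 andbT.
  apply: le_trans (measure_sigma_subadditive mu mN (bigcupT_measurable _ mN) (@subset_refl _ _)) _.
  rewrite eseries0// => n _ _; case: ifPn; first by rewrite measure0.
  by rewrite -leNgt => h; apply/eqP; rewrite eq_le measure_ge0 h.
- by move=> y /=; rewrite (suppE mu oU nbU) /= not_notE.
Qed.

End borel_determination.

(** * Tests by two-point laws *)

Section two_point_tests.
Context d (Y : measurableType d) (R : realType) (Q : probability Y R).
Implicit Types (H F : Y -> R).

Lemma ae_ex (P : Y -> Prop) (B : set Y) : measurable B -> {ae Q, forall y, P y} ->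
  (0 < Q B)%E -> exists y, B y /\ P y.
Proof.
move=> mB [N [mN N0 PN]] QB; apply: contrapT => h.
have BN : B `<=` N by move=> y By; apply: PN => /= Py; apply: h; exists y.
by move: QB; apply/negP; rewrite -leNgt -N0; apply: le_measure; rewrite ?inE.
Qed.

Lemma ae_not_null (P : Y -> Prop) (B : set Y) : measurable B -> Q B = 0%E ->
  {ae Q, forall y, ~ B y -> P y} -> {ae Q, forall y, P y}.
Proof.
move=> mB B0 BP.
have : {ae Q, forall y, ~ B y} by exists B; split=> // y /=; rewrite not_notE.
by move: BP; apply: filterS2 => y; exact.
Qed.

Lemma ae_sub_gt0 (B C : set Y) : measurable B -> measurable C ->
  {ae Q, forall y, B y -> C y} -> (0 < Q B)%E -> (0 < Q C)%E.
Proof.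
move=> mB mC BC QB; rewrite lt0e measure_ge0 andbT; apply/negP => /eqP QC.
have NC : {ae Q, forall y, ~ C y} by exists C; split=> // y /=; rewrite not_notE.
have : {ae Q, forall y, ~ B y} by move: BC NC; apply: filterS2 => y BCy NCy /BCy.
by move=> /(ae_ex mB)/(_ QB)[y []].
Qed.

(* The sign pattern of two scores [h1], [h2] with mean zero under a two-point
   law, and the mass of the first point; when both vanish the division by zero
   puts all the mass on the second point. *)
Definition opposite (h1 h2 : R) : bool := (0 < h1) && (h2 < 0) || (h1 == 0) && (h2 == 0).
Definition weight (h1 h2 : R) : R := - h2 / (h1 - h2).

Lemma weight01 h1 h2 : opposite h1 h2 -> 0 <= weight h1 h2 <= 1.
Proof.
rewrite /weight; move=> /orP[/andP[h10 h20]|/andP[/eqP-> /eqP->]]; last first.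
  by rewrite oppr0 mul0r lexx ler01.
have h12 : 0 < h1 - h2 by rewrite subr_gt0 (lt_trans h20).
apply/andP; split; first by rewrite divr_ge0 ?oppr_ge0// ltW.
by rewrite ler_pdivrMr// mul1r; lra.
Qed.

Lemma weight_mean h1 h2 : opposite h1 h2 ->
  weight h1 h2 * h1 + (1 - weight h1 h2) * h2 = 0.
Proof.
rewrite /weight; move=> /orP[/andP[h10 h20]|/andP[/eqP-> /eqP->]]; last by rewrite !mulr0 addr0.
have h12 : h1 - h2 != 0 by rewrite gt_eqF// subr_gt0 (lt_trans h20).
by field.
Qed.

Variables H : Y -> R.
Hypothesis iH : Q.-integrable setT (EFin \o H).
Hypothesis H0 : (\int[Q]_y (H y)%:E = 0)%E.

Let mH : measurable_fun setT H.
Proof. by apply/measurable_EFinP; exact: measurable_int iH. Qed.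

Let measurable_gt G : measurable_fun setT G -> measurable [set y : Y | 0 < G y :> R].
Proof.
move=> mG; rewrite -[X in measurable X]setTI.
have -> : [set y | 0 < G y] = G @^-1` `]0, +oo[.
  by apply/seteqP; split=> y /=; rewrite in_itv /= andbT.
exact: mG.
Qed.

(** With no mass on positive values, [G] is almost surely minus its absolute value, whose integral
    therefore vanishes. *)
Let ge0_mean0 G : Q.-integrable setT (EFin \o G) -> (\int[Q]_y (G y)%:E = 0)%E ->
  Q [set y | 0 < G y] = 0%E -> {ae Q, forall y, G y = 0}.
Proof.
move=> iG G0 QG; have mG : measurable_fun setT (EFin \o G) := measurable_int _ iG.
have mGR : measurable_fun setT G by exact/measurable_EFinP.
have Gle : {ae Q, forall y, G y <= 0}.
  apply: (ae_not_null (measurable_gt mGR) QG); apply: aeW => y /= /negP.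
  by rewrite -leNgt.
have : (\int[Q]_y `|(G y)%:E| = 0)%E.
  rewrite (@ae_eq_integral _ _ _ Q setT (fun y => - (G y)%:E)%E)//.
  - rewrite -[RHS]oppe0 -G0; under eq_integral do rewrite -mulN1e.
    by rewrite integralZl// mulN1e.
  - exact: measurableT_comp.
  - exact: measurableT_comp.
  - by move: Gle; apply: filterS => y Gy _; rewrite -EFinN /= ler0_norm.
move/(ae_eq_integral_abs Q measurableT mG); apply: filterS => y /(_ Logic.I).
by move=> /= [].
Qed.

Let Hneg : measurable [set y | H y < 0].
Proof.
have -> : [set y | H y < 0] = [set y | 0 < - H y].
  by apply/seteqP; split=> y /=; rewrite oppr_gt0.
by apply: measurable_gt; exact: measurable_funN.
Qed.

Let Hpos : measurable [set y | 0 < H y].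
Proof. exact: measurable_gt. Qed.

Let Hzero : measurable [set y | H y = 0].
Proof. by rewrite -[X in measurable X]setTI; exact: (mH measurableT (measurable_set1 0)). Qed.

Let pos_neg : (0 < Q [set y | (0 < H y)%R])%E -> (0 < Q [set y | (H y < 0)%R])%E.
Proof.
move=> QH; rewrite lt0e measure_ge0 andbT; apply/negP => /eqP Q0.
have : {ae Q, forall y, (- H y = 0)%R}.
  apply: ge0_mean0.
  - have -> : EFin \o (fun y => - H y) = -%E \o (EFin \o H) by apply/funext.
    exact: integrableN.
  - under eq_integral do rewrite EFinN -mulN1e.
    by rewrite integralZl// H0 mule0.
  - rewrite -Q0; congr (Q _); apply/seteqP; split=> y /=; by rewrite oppr_gt0.
move=> /(ae_ex Hpos) /(_ QH)[y [/= Hy /eqP]]; rewrite oppr_eq0 => /eqP Hy0.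
by rewrite Hy0 ltxx in Hy.
Qed.

(** A mean-zero score either vanishes almost surely, and then almost all pairs are pairs of zeros,
    or charges both signs. *)
Lemma exists_opposite (good : set Y) : measurable good -> {ae Q, forall y, good y} ->
  measurable [set w1 | (0 < Q [set w2 | [/\ good w1, good w2 & opposite (H w1) (H w2)]])%E] ->
  (0 < Q [set w1 | (0 < Q [set w2 | [/\ good w1, good w2 & opposite (H w1) (H w2)]])%E])%E.
Proof.
move=> mg gg mS.
have mSw w1 : measurable [set w2 | [/\ good w1, good w2 & opposite (H w1) (H w2)]].
  have [gw1|Ng] := pselect (good w1); last first.
    by rewrite (_ : [set _ | _] = set0)//; apply/seteqP; split=> // y [].
  have -> : [set w2 | [/\ good w1, good w2 & opposite (H w1) (H w2)]] =
      good `&` ((if 0 < H w1 then [set y | H y < 0] else set0) `|`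
                (if H w1 == 0 then [set y | H y = 0] else set0)).
    apply/seteqP; split=> [y [_ gy /orP[/andP[-> h]|/andP[-> /eqP h]]]|y [gy]].
    - by split=> //; left.
    - by split=> //; right.
    - rewrite /opposite; case: ifP => h1; case: ifP => h2; move=> [] //= h;
        by split=> //; rewrite ?h ?eqxx ?orbT.
  by apply: measurableI => //; apply: measurableU; case: ifP.
have [Q0|Q0] := eqVneq (Q [set y | 0 < H y]) 0%E.
  have Hz := ge0_mean0 iH H0 Q0.
  apply: (@ae_sub_gt0 setT) => //; last by rewrite probability_setT lte01.
  move: (gg) Hz; apply: filterS2 => w1 g1 Hw1 _ /=.
  apply: (@ae_sub_gt0 setT) => //; last by rewrite probability_setT lte01.
  move: (gg) (ge0_mean0 iH H0 Q0); apply: filterS2 => w2 g2 Hw2 _.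
  by split => //; rewrite /opposite Hw1 Hw2 eqxx orbT.
have Qpos : (0 < Q [set y | (0 < H y)%R])%E by rewrite lt0e Q0 measure_ge0.
apply: (ae_sub_gt0 Hpos _ _ Qpos) => //; move: (gg); apply: filterS => w1 g1 Hw1.
apply: (ae_sub_gt0 Hneg _ _ (pos_neg Qpos)) => //; move: (gg); apply: filterS => w2 g2 Hw2.
by split => //; rewrite /opposite; apply/orP; left; apply/andP.
Qed.

(** One typical point of positive score, tested against the negative ones, fixes the slope there;
    each positive point, tested against one negative point, then receives the same slope. Points of
    score zero are tested among themselves. *)
Lemma two_point_affine F (c : R) :
  {ae Q, forall w1, {ae Q, forall w2, opposite (H w1) (H w2) ->
    weight (H w1) (H w2) * F w1 + (1 - weight (H w1) (H w2)) * F w2 = c}} ->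
  exists b, {ae Q, forall w, F w = c + b * H w}.
Proof.
move=> test.
have zero : {ae Q, forall w, H w = 0 -> F w = c}.
  have [Q0|Q0] := eqVneq (Q [set y | H y = 0]) 0%E.
    by apply: (ae_not_null Hzero Q0); apply: aeW => y /= N /N.
  have Qpos : (0 < Q [set y | (H y = 0)%R])%E by rewrite lt0e Q0 measure_ge0.
  (* Since [weight 0 0] is 0, the test of two zeros reads F w2 = c. *)
  have [w1 [/= Hw1]] := ae_ex Hzero test Qpos; apply: filterS => w2 + Hw2.
  rewrite Hw1 Hw2 /opposite /weight eqxx /= orbT oppr0 mul0r mul0r add0r subr0 mul1r.
  exact.
have solve h1 h2 f1 f2 : 0 < h1 -> h2 < 0 ->
    (opposite h1 h2 -> weight h1 h2 * f1 + (1 - weight h1 h2) * f2 = c) ->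
    h1 * (f2 - c) = h2 * (f1 - c).
  move=> h10 h20; rewrite /opposite h10 h20 /= => /(_ isT) <-; rewrite /weight.
  have h12 : h1 - h2 != 0 by rewrite gt_eqF// subr_gt0 (lt_trans h20).
  by field.
(* Without positive scores [H] vanishes almost surely and any slope would do. *)
have [Q0|Q0] := eqVneq (Q [set y | 0 < H y]) 0%E.
  exists 0; have := ge0_mean0 iH H0 Q0; move: zero.
  by apply: filterS2 => w + Hw => /(_ Hw) ->; rewrite mul0r addr0.
have Qpos : (0 < Q [set y | (0 < H y)%R])%E by rewrite lt0e Q0 measure_ge0.
have Qneg := pos_neg Qpos.
have [w1 [/= Hw1 test1]] := ae_ex Hpos test Qpos.
pose b := (F w1 - c) / H w1.
have neg : {ae Q, forall w, H w < 0 -> F w = c + b * H w}.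
  move: test1; apply: filterS => w2 test12 Hw2.
  have e := solve _ _ _ _ Hw1 Hw2 test12.
  have Hw10 : H w1 != 0 by rewrite gt_eqF.
  have bE : b * H w1 = F w1 - c by rewrite /b divfK.
  by apply: (mulfI Hw10); rewrite -bE in e; lra.
have pos : {ae Q, forall w, 0 < H w -> F w = c + b * H w}.
  move: test; apply: filterS => w testw Hw.
  have test2 : {ae Q, forall w2, (H w2 < 0 -> F w2 = c + b * H w2) /\
      (opposite (H w) (H w2) ->
      weight (H w) (H w2) * F w + (1 - weight (H w) (H w2)) * F w2 = c)}.
    by move: neg testw; apply: filterS2.
  have [w2 [/= Hw2 [/(_ Hw2) F2 test2']]] := ae_ex Hneg test2 Qneg.
  have := solve _ _ _ _ Hw Hw2 test2'; rewrite F2 => e.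
  have Hw20 : H w2 != 0 by rewrite lt_eqF.
  apply: (mulfI Hw20); lra.
exists b; move: zero neg pos; apply: filterS3 => w z n p.
have [/p//|/n//|h] := ltgtP 0 (H w).
by rewrite -h mulr0 addr0 z.
Qed.

End two_point_tests.

(** * Glued laws and the localized estimating equation *)

Section ae_lemmas.
Context d (T : measurableType d) (R : realType) (mu : {measure set T -> \bar R}).
Implicit Types Q : T -> Prop.

(* Versions of [filterS] that also apply to the points of a type whose
   sigma-algebra lives on an alias, such as [borel X]. *)
Lemma ae_imp Q1 Q : {ae mu, forall x, Q1 x} -> (forall x, Q1 x -> Q x) ->
  {ae mu, forall x, Q x}.
Proof. by move=> h1 h; move: h1; apply: filterS. Qed.

Lemma ae_imp2 Q1 Q2 Q : {ae mu, forall x, Q1 x} -> {ae mu, forall x, Q2 x} ->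
  (forall x, Q1 x -> Q2 x -> Q x) -> {ae mu, forall x, Q x}.
Proof. by move=> h1 h2 h; move: h1 h2; apply: filterS2. Qed.

Lemma ae_imp3 Q1 Q2 Q3 Q : {ae mu, forall x, Q1 x} -> {ae mu, forall x, Q2 x} ->
  {ae mu, forall x, Q3 x} -> (forall x, Q1 x -> Q2 x -> Q3 x -> Q x) ->
  {ae mu, forall x, Q x}.
Proof. by move=> h1 h2 h3 h; move: h1 h2 h3; apply: filterS3. Qed.

Lemma ae_integrable (f g : T -> \bar R) : measurable_fun setT g ->
  {ae mu, forall x, f x = g x} -> mu.-integrable setT f -> mu.-integrable setT g.
Proof.
move=> mg fg /integrableP[mf foo]; apply/integrableP; split => //.
rewrite -(@ae_eq_integral _ _ _ mu setT _ (fun x => `|f x|)%E)//.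
- exact: measurableT_comp.
- exact: measurableT_comp.
- by move: fg; apply: filterS => x -> _.
Qed.

End ae_lemmas.

Lemma measurable_funV d (T : measurableType d) (R : realType) (f : T -> R) :
  measurable_fun setT f -> measurable_fun setT (fun x => (f x)^-1).
Proof.
apply: (@measurableT_comp _ _ _ _ _ _ (@GRing.inv R)).
have -> : [set: R] = [set 0] `|` [set r | r != 0].
  by apply/seteqP; split=> // r _; have [->|r0] := eqVneq r 0; [left|right].
apply/measurable_funU => //; first exact: open_measurable.
split; first exact: measurable_fun_set1.
apply: open_continuous_measurable_fun => //; apply/in_setP => x /= x0.
exact: inv_continuous.
Qed.

Section finite_products.
Context d (T : measurableType d) (R : realType) (A : armType).

Lemma measurable_armvec (g : T -> armvec R A) :
  (forall a, measurable_fun setT (fun x => g x a)) -> measurable_fun setT g.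
Proof.
move=> mg; apply: (measurability (@cylinder R A : set (set (armvec R A)))) => //.
move=> _ [_ [a [B mB ->]] <-]; have := mg a measurableT B mB.
by rewrite !setTI.
Qed.

Lemma measurable_coord (a : A) : measurable_fun setT (fun u : armvec R A => u a).
Proof.
move=> _ B mB; rewrite setTI; apply: sub_sigma_algebra.
by exists a, B.
Qed.

Lemma measurable_armset (g : T -> discrete {set A}) :
  (forall a, measurable [set x | a \in (g x : {set A})]) -> measurable_fun setT g.
Proof.
move=> mg _ B mB; rewrite setTI.
have -> : g @^-1` B = \bigcup_(s in B) \bigcap_(a in [set: A])
    [set x | (a \in (g x : {set A})) = (a \in (s : {set A}))].
  apply/seteqP; split=> [x Bx|x [s Bs h]]; first by exists (g x).
  by rewrite /preimage /= (_ : g x = s)//; apply/setP => a; exact: h.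
apply: fin_bigcup_measurable; first by apply: (@sub_finite_set _ _ [set: {set A}]) => //; exact: finite_finset.
move=> s _; apply: fin_bigcap_measurable; first exact: finite_finset.
move=> a _; case: (a \in (s : {set A})); first exact: mg.
have -> : [set x | (a \in (g x : {set A})) = false] = ~` [set x | a \in (g x : {set A})].
  by apply/seteqP; split=> x /=; [move=> ->|move/negP/negbTE].
by apply: measurableC; exact: mg.
Qed.

End finite_products.

Section gluing.
Context (R : realType) (X Wt : completePseudoMetricType R) (A : armType).
Variable M : model X Wt A.
Hypothesis scW : @second_countable Wt.
Hypothesis str : max_arm_structure M.
Local Notation W := (discrete A * borel Wt)%type.
Local Notation Z := (borel X * W)%type.
Implicit Types (P : probability Z R).

Lemma eq_measure_ae d (T : measurableType d) (m1 m2 : {measure set T -> \bar R})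
    (Q : T -> Prop) :
  (forall E, measurable E -> m1 E = m2 E) -> {ae m1, forall x, Q x} -> {ae m2, forall x, Q x}.
Proof. by move=> m12 [N [mN N0 QN]]; exists N; split => //; rewrite -m12. Qed.

Lemma eq_measure_integrable d (T : measurableType d) (m1 m2 : {measure set T -> \bar R})
    (f : T -> \bar R) :
  (forall E, measurable E -> m1 E = m2 E) -> m1.-integrable setT f -> m2.-integrable setT f.
Proof.
move=> m12 /integrableP[mf foo]; apply/integrableP; split => //.
by rewrite -(@eq_measure_integral _ _ _ _ m2 m1)// => E mE _; exact: m12.
Qed.

Lemma law_of_marg (mu : probability (borel X) R) (k : borel X -> probability W R) P :
  law_of mu k P -> forall E, measurable E -> marg P E = mu E.
Proof.
move=> kP E mE.
have mfE : measurable (fst @^-1` E : set Z).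
  by rewrite -[X in measurable X]setTI; exact: measurable_fst.
apply: (etrans (kP _ mfE)).
transitivity (\int[mu]_x (\1_E x)%:E)%E; last by rewrite integral_indic// setIT.
apply: eq_integral => x _; rewrite indicE.
have [xE|xE] := boolP (x \in E).
  rewrite (_ : xsection _ _ = setT); first exact: probability_setT.
  by apply/seteqP; split=> // w _; apply/xsectionP; exact: set_mem.
rewrite (_ : xsection _ _ = set0) ?measure0//.
apply/seteqP; split=> // w /xsectionP /= Ex; move: xE; by rewrite mem_set.
Qed.

Lemma law_of_eq_marg (mu nu : probability (borel X) R) (k : borel X -> probability W R) P :
  (forall E, measurable E -> mu E = nu E) -> law_of mu k P -> law_of nu k P.
Proof.
move=> munu kP E mE; rewrite kP//.
by apply: eq_measure_integral => D mD _; exact: munu.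
Qed.

Lemma law_of_glued P P' (k : borel X -> probability W R) : laws M P' ->
  law_of (marg P) k P' -> law_of (marg P) (cond M P') P'.
Proof.
move=> LP' kP'; apply: law_of_eq_marg (cond_law str LP').
exact: law_of_marg kP'.
Qed.

(** Both kernels disintegrate [P'], so they agree for almost every x on each set of a countable
    family that determines the law of every arm. *)
Lemma glued_eq_law P P' (k : borel X -> probability W R) : laws M P' ->
  law_of (marg P) k P' -> {ae marg P, forall x, eq_law (k x) (cond M P' x)}.
Proof.
move=> LP' kP'; have [V [mV HV]] := @countable_determination R Wt scW.
have aeV a n : {ae marg P, forall x, k x ([set a] `*` V n) = cond M P' x ([set a] `*` V n)}.
  apply: (disintegration_unique (cond_measurable str LP') kP' (law_of_glued LP' kP')).
  exact: measurable_armX.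
have : {ae marg P, forall x, forall i : nat,
    if unpickle i is Some (a, n) then
    k x ([set (a : A)] `*` V n) = cond M P' x ([set a] `*` V n) else True}.
  apply: ae_foralln => i; case: unpickle => [[a n]|]; first exact: aeV.
  exact: aeW.
apply: filterS => x h; apply: eq_law_armP => a B mB.
apply: (HV (arm_mass (k x) a) (arm_mass (cond M P' x) a)) => //.
  by rewrite ltey_eq arm_mass_fin_num.
by move=> n; have := h (pickle (a, n)); rewrite pickleK.
Qed.

Lemma eq_law_score P x (q : probability W R) : laws M P -> eq_law q (cond M P x) ->
  forall a, [/\ arm_prob q a = pi_ M P x a,
    (arm_law q a).-integrable setT (fun w => (score M a w)%:E) &
    (\int[arm_law q a]_w (score M a w)%:E = (u_ M P x a)%:E)%E].
Proof.
move=> LP qP a; have [pE lE] := eq_law_arm qP a; split => //.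
- apply: eq_measure_integrable (score_integrable str LP x a).
  by move=> B mB; exact: (esym (lE B mB)).
- rewrite -(score_identifies str LP) unlock.
  by apply: eq_measure_integral => B mB _; exact: lE.
Qed.

Lemma measurable_arm_mass P a (B : set (borel Wt)) : laws M P -> measurable B ->
  measurable_fun setT (fun x : borel X => arm_mass (cond M P x) a B).
Proof.
move=> LP mB; have /measurable_pprobabilityP := cond_measurable str LP.
by apply; exact: measurable_armX.
Qed.

Lemma measurable_pi P a : laws M P -> measurable_fun setT (fun x : borel X => pi_ M P x a).
Proof. by move=> LP; apply: measurableT_comp => //; exact: measurable_arm_mass. Qed.

Lemma arm_lawE P x a (B : set (borel Wt)) : laws M P -> measurable B ->
  arm_law (cond M P x) a B = (arm_mass (cond M P x) a B * ((pi_ M P x a)^-1)%:E)%E.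
Proof.
move=> LP mB; rewrite arm_massE// muleC muleA -EFinM mulVf ?mul1e//.
by rewrite gt_eqF//; exact: (Defs.pi_gt0 str LP).
Qed.

Lemma measurable_Qarm P a : laws M P ->
  measurable_fun setT (fun x : borel X => Qarm M P x a : pprobability (borel Wt) R).
Proof.
move=> LP; apply/measurable_pprobabilityP => B mB.
under eq_fun do rewrite /Qarm arm_lawE//.
apply: emeasurable_funM; first exact: measurable_arm_mass.
apply/measurable_EFinP; apply: measurable_funV; last exact: measurable_pi.
Qed.

End gluing.

Section estimating_maps.
Context (R : realType) (X Wt Waux : completePseudoMetricType R) (A : armType).
Variable M : model X Wt A.
Hypothesis str : max_arm_structure M.
Local Notation W := (discrete A * borel Wt)%type.
Local Notation Z := (borel X * W)%type.
Local Notation Y :=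
  (Z * (armvec R A * armvec R A) * discrete {set A} * borel Waux)%type.
Implicit Types (P : probability Z R).

Lemma measurable_u P a : laws M P -> measurable_fun setT (fun x : borel X => u_ M P x a).
Proof.
by move=> LP; have := measurableT_comp (@measurable_coord R A a) (u_measurable str LP).
Qed.

Lemma measurable_kappaP P a : laws M P -> measurable [set x : borel X | a \in kappa M P x].
Proof.
move=> LP.
have mg b : measurable_fun setT (fun x : borel X => gain M x b (u_ M P x b)).
  exact: (measurableT_comp (gain_measurable str b)
    (measurable_fun_pair (@measurable_id _ (borel X) setT) (measurable_u b LP))).
have -> : [set x : borel X | a \in kappa M P x] = \bigcap_(b in [set: A])
    ((fun x => gain M x a (u_ M P x a) - gain M x b (u_ M P x b)) @^-1` `[0, +oo[).
  apply/seteqP; split=> x /=; rewrite inE.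
    by move=> /forallP h b _ /=; rewrite in_itv /= andbT subr_ge0.
  by move=> h; apply/forallP => b; have := h b Logic.I; rewrite /= in_itv /= andbT subr_ge0.
apply: fin_bigcap_measurable; first exact: finite_finset.
move=> b _; rewrite -[X in measurable X]setTI.
by apply: (measurable_funB (mg a) (mg b)).
Qed.

Lemma measurable_kappa P : laws M P ->
  measurable_fun setT (fun x : borel X => kappa M P x : discrete {set A}).
Proof. by move=> LP; apply: measurable_armset => a; exact: measurable_kappaP. Qed.

Lemma measurable_eta2 P : laws M P ->
  measurable_fun setT (fun x : borel X => eta2 M P x : armvec R A).
Proof. by move=> LP; apply: measurable_armvec => a; exact: measurable_pi. Qed.

Variables (f : Y -> R) (v : borel X -> borel Waux).
Hypothesis fFB : FB M f.
Hypothesis mv : measurable_fun setT v.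

Let measurable_plugin (e1 e2 : borel X -> armvec R A) (kp : borel X -> discrete {set A}) :
  measurable_fun setT e1 -> measurable_fun setT e2 -> measurable_fun setT kp ->
  measurable_fun setT (fun z : Z => f (z, (e1 z.1, e2 z.1), kp z.1, v z.1)).
Proof.
move=> m1 m2 mkp; apply: (measurableT_comp fFB.1).
have mfst := @measurable_fst _ _ (borel X) W.
apply: measurable_fun_pair; last exact: (measurableT_comp mv mfst).
apply: measurable_fun_pair; last exact: (measurableT_comp mkp mfst).
apply: measurable_fun_pair; first exact: measurable_id.
by apply: measurable_fun_pair; apply: measurableT_comp.
Qed.

Lemma measurable_truth P : laws M P -> measurable_fun setT (truth M f P v).
Proof.
move=> LP; apply: measurable_plugin; [exact: u_measurable|exact: measurable_eta2|].
exact: measurable_kappa.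
Qed.

(** Only [eta1] may differ from its value at [P]. At such a law, plugging in the nuisances of [P] is
    an error in a single nuisance, which maps in [FB] tolerate. *)
Definition compatible P P' :=
  [/\ laws M P', forall E, measurable E -> marg P' E = marg P E,
    {ae marg P, forall x, eta2 M P' x = eta2 M P x} &
    {ae marg P, forall x, kappa M P' x = kappa M P x}].

Variable P : probability Z R.
Hypothesis LP : laws M P.
Local Notation F := (truth M f P v).

Lemma compatible_law P' : compatible P P' -> law_of (marg P) (cond M P') P'.
Proof. by move=> [LP' mP' _ _]; exact: law_of_eq_marg (cond_law str LP'). Qed.

(** The defining property of [FB] is used with [P'] as the true law and [P] as the source of the
    plugged-in nuisances. *)
Lemma compatible_unbiased P' : compatible P P' ->
  P'.-integrable setT (EFin \o F) /\
  (\int[P']_z (F z)%:E = \int[marg P]_x (psiP M P' x)%:E)%E.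
Proof.
move=> cP'; have [LP' mP' e2 kp] := cP'.
have ae' (Q : borel X -> Prop) : {ae marg P, forall x, Q x} -> {ae marg P', forall x, Q x}.
  by apply: eq_measure_ae => E mE; exact: (esym (mP' E mE)).
have hyp : {ae marg P', forall x, eta2 M P x = eta2 M P' x}.
  by apply: ae'; apply: ae_imp e2 _ => x ->.
have [int1 E1] := fFB.2 P' P LP' LP v mv (or_introl hyp).
(* [FB] evaluates the map at the [kappa] of the true law [P']; it coincides almost surely with that
   of [P], which turns [G] into [F]. *)
pose G (z : Z) := f (z, (eta1 M P z.1, eta2 M P z.1), kappa M P' z.1, v z.1).
have mG : measurable_fun setT G.
  by apply: measurable_plugin; [exact: u_measurable|exact: measurable_eta2|exact: measurable_kappa].
have GF : {ae P', forall z, G z = F z}.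
  have [N [mN N0 kN]] := ae' _ kp.
  exists (fst @^-1` N); split => //.
    by rewrite -[X in measurable X]setTI; exact: measurable_fst.
  by move=> z /= Nz; apply: kN => /= kz; apply: Nz; rewrite /G /truth kz.
have mF := measurable_truth LP.
have GFae : ae_eq P' setT (EFin \o G) (EFin \o F).
  by move: GF; apply: filterS => z /= -> _.
split.
  by apply: ae_integrable int1; [exact/measurable_EFinP|apply: ae_imp GF _ => z h; exact: (congr1 EFin h)].
transitivity (\int[P']_z (G z)%:E)%E.
  by apply: ae_eq_integral => //; [exact/measurable_EFinP|exact/measurable_EFinP|
    move: GF; apply: filterS => z -> _].
have := E1; rewrite [in X in X -> _]unlock => ->.
by rewrite /Psi unlock; apply: eq_measure_integral => E mE _; exact: mP'.
Qed.

Definition cmean P' (x : borel X) : \bar R := (\int[cond M P' x]_w (F (x, w))%:E)%E.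

Lemma compatible_cmean P' : compatible P P' ->
  [/\ {ae marg P, forall x, (cond M P' x).-integrable setT (fun w => (F (x, w))%:E)},
    (marg P).-integrable setT (cmean P'),
    (marg P).-integrable setT (fun x => (psiP M P' x)%:E) &
    (\int[marg P]_x cmean P' x = \int[marg P]_x (psiP M P' x)%:E)%E].
Proof.
move=> cP'; have [iF EF] := compatible_unbiased cP'.
have [LP' mP' _ _] := cP'.
have [h1 h2 h3] := integrable_disintegration (cond_measurable str LP') (compatible_law cP') iF.
split => //; last by rewrite -EF h3.
by apply: eq_measure_integrable (psi_integrable str LP') => E mE; exact: mP'.
Qed.

(** The rule [uloc] could tell apart two laws with the same values on measurable sets;
    identification by score means excludes this. *)
Lemma eq_law_u P1 P2 x : laws M P1 -> laws M P2 ->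
  eq_law (cond M P1 x) (cond M P2 x) -> u_ M P1 x = u_ M P2 x.
Proof.
move=> L1 L2 e; apply/funext => a.
have [_ _ h1] := eq_law_score str L2 e a.
have [_ _ h2] := eq_law_score str L1 (fun E mE => erefl (cond M P1 x E)) a.
by move: h1; rewrite h2 => -[].
Qed.

(* Gluing the two laws on a set and its complement keeps the estimating
   equation, so the integrated equation localizes. *)
Lemma localized_identity P1 P0 : compatible P P1 -> compatible P P0 ->
  (forall E : set (borel X), measurable E -> exists2 P', compatible P P' &
    {ae marg P, forall x,
      (E x -> eq_law (cond M P' x) (cond M P1 x)) /\
      (~ E x -> eq_law (cond M P' x) (cond M P0 x))}) ->
  {ae marg P, forall x,
    (cmean P1 x - (psiP M P1 x)%:E = cmean P0 x - (psiP M P0 x)%:E)%E}.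
Proof.
move=> c1 c0 glue.
(* The pointwise defect of the estimating equation: its total integral vanishes for every compatible
   law. *)
pose j P' (x : borel X) := (cmean P' x - (psiP M P' x)%:E)%E.
have ij P' : compatible P P' -> (marg P).-integrable setT (j P').
  by move=> /compatible_cmean[_ h1 h2 _]; exact: integrableB.
have j0 P' : compatible P P' -> (\int[marg P]_x j P' x = 0)%E.
  move=> /compatible_cmean[_ h1 h2 h3]; rewrite /j integralB// h3 subee//.
  exact: integrable_fin_num.
have split_int P' E : compatible P P' -> measurable E ->
    (\int[marg P]_(x in E) j P' x + \int[marg P]_(x in ~` E) j P' x = 0)%E.
  move=> cP' mE; rewrite -(j0 _ cP') -[in RHS](setUv E) integral_setU//.
  - exact: measurableC.
  - by rewrite setUv; exact: measurable_int (ij _ cP').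
  - by apply/disj_setPS => x [].
have fin P' E : compatible P P' -> measurable E ->
    (\int[marg P]_(x in E) j P' x)%E \is a fin_num.
  move=> cP' mE; apply: integrable_fin_num => //.
  exact: integrableS measurableT mE (@subsetT _ _) (ij _ cP').
suff js : ae_eq (marg P) setT (j P1) (j P0) by apply: ae_imp js _ => x /(_ Logic.I).
apply: integral_ae_eq => //; [exact: ij|exact: measurable_int (ij _ c0)|].
move=> E _ mE; have mEC := measurableC mE.
have [P' cP' eP'] := glue E mE.
have jE (P2 : probability Z R) x : compatible P P2 ->
    eq_law (cond M P' x) (cond M P2 x) -> j P' x = j P2 x.
  move=> [L2 _ _ _] e; have [L' _ _ _] := cP'.
  rewrite /j /psiP (eq_law_u L' L2 e); congr (_ - _)%E.
  by apply: eq_measure_integral => B mB _; exact: e.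
have mj P2 D : compatible P P2 -> measurable_fun D (j P2).
  by move=> c2; apply: measurable_funTS; exact: measurable_int (ij _ c2).
(* The defect of [P'] is that of [P1] on [E] and that of [P0] off [E]. As the totals of [P'] and
   [P0] both vanish, cancelling the part off [E] shows that [P1] and [P0] have equal integrals over
   [E]. *)
have := split_int P' E cP' mE.
rewrite (@ae_eq_integral _ _ _ (marg P) E (j P1) (j P'))//; first last.
- by apply: ae_imp eP' _ => x [e1 _] Ex; apply: jE => //; exact: e1.
- exact: mj.
- exact: mj.
rewrite (@ae_eq_integral _ _ _ (marg P) (~` E) (j P0) (j P'))//; first last.
- by apply: ae_imp eP' _ => x [_ e2] Ex; apply: jE => //; exact: e2.
- exact: mj.
- exact: mj.
rewrite -(split_int P0 E c0 mE) => /eqP.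
by rewrite eq_le !leeD2rE// ?fin// -eq_le => /eqP.
Qed.

End estimating_maps.

(** * Perturbing one arm *)

Section convex_combination.
Context d (Y : measurableType d) (R : realType).
Implicit Types (m : probability Y R) (t : R).

(** Clipping makes [mix_law] a probability for every real proportion. This matters for a proportion
    depending on x, such as the two-point weight, which is in [0, 1] only for almost every x. *)
Definition unit_clip t : R := Num.max 0 (Num.min 1 t).

Let unit_clip_ge0 t : 0 <= unit_clip t.
Proof. by rewrite /unit_clip le_max lexx. Qed.

Let unit_clip_le1 t : 0 <= 1 - unit_clip t.
Proof. by rewrite subr_ge0 /unit_clip ge_max ler01 ge_min lexx. Qed.

Lemma unit_clip_id t : 0 <= t <= 1 -> unit_clip t = t.
Proof. by move=> /andP[t0 t1]; rewrite /unit_clip min_r// max_r. Qed.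

Definition mix_law t m1 m2 : set Y -> \bar R :=
  measure_add (mscale (NngNum (unit_clip_ge0 t)) m1) (mscale (NngNum (unit_clip_le1 t)) m2).

HB.instance Definition _ t m1 m2 := Measure.on (mix_law t m1 m2).

Lemma mix_law_clipE t m1 m2 E : mix_law t m1 m2 E =
  ((unit_clip t)%:E * m1 E + (1 - unit_clip t)%:E * m2 E)%E.
Proof. by rewrite /mix_law measure_addE /mscale. Qed.

Lemma mix_lawE t m1 m2 E : 0 <= t <= 1 ->
  mix_law t m1 m2 E = (t%:E * m1 E + (1 - t)%:E * m2 E)%E.
Proof. by move=> t01; rewrite mix_law_clipE unit_clip_id. Qed.

Let mix_law_setT t m1 m2 : mix_law t m1 m2 setT = 1%E.
Proof. by rewrite mix_law_clipE !probability_setT !mule1 -EFinD addrCA subrr addr0. Qed.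

HB.instance Definition _ t m1 m2 :=
  Measure_isProbability.Build _ _ _ (mix_law t m1 m2) (mix_law_setT t m1 m2).

Let ge0_integral_mix_law t m1 m2 (f : Y -> \bar R) : 0 <= t <= 1 ->
  measurable_fun setT f -> (forall y, 0 <= f y)%E ->
  (\int[mix_law t m1 m2]_y f y = t%:E * \int[m1]_y f y + (1 - t)%:E * \int[m2]_y f y)%E.
Proof.
move=> t01 mf f0; rewrite /mix_law ge0_integral_measure_add// !ge0_integral_mscale//=.
by rewrite unit_clip_id.
Qed.

Lemma integral_mix_law t m1 m2 (f : Y -> \bar R) : 0 <= t <= 1 ->
  m1.-integrable setT f -> m2.-integrable setT f ->
  (mix_law t m1 m2).-integrable setT f /\
  (\int[mix_law t m1 m2]_y f y = t%:E * \int[m1]_y f y + (1 - t)%:E * \int[m2]_y f y)%E.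
Proof.
move=> t01 i1 i2; have mf := measurable_int _ i1.
have mp : measurable_fun setT f^\+%E by exact: measurable_funepos.
have mn : measurable_fun setT f^\-%E by exact: measurable_funeneg.
split.
  have f1 := integrable_fin_num measurableT (integrable_abse i1).
  have f2 := integrable_fin_num measurableT (integrable_abse i2).
  apply/integrableP; split=> //; rewrite ge0_integral_mix_law//; last exact: measurableT_comp.
  by rewrite ltey_eq fin_numD !fin_numM.
have fp := integrable_fin_num measurableT (integrable_funepos measurableT i1).
have fn := integrable_fin_num measurableT (integrable_funeneg measurableT i1).
have fp' := integrable_fin_num measurableT (integrable_funepos measurableT i2).
have fn' := integrable_fin_num measurableT (integrable_funeneg measurableT i2).
rewrite integralE !ge0_integral_mix_law// [in RHS]integralE [X in (_ = _ + _ * X)%E]integralE.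
rewrite -(fineK fp) -(fineK fn) -(fineK fp') -(fineK fn').
by rewrite -!(EFinM, EFinB, EFinD); congr EFin; ring.
Qed.

Lemma integral_dirac_pt (y : Y) (f : Y -> R) : measurable_fun setT f ->
  (\d_y : probability Y R).-integrable setT (EFin \o f) /\
  (\int[(\d_y : probability Y R)]_z (f z)%:E = (f y)%:E)%E.
Proof.
move=> mf; have mf' : measurable_fun setT (EFin \o f) by exact/measurable_EFinP.
split; last by rewrite integral_dirac// diracT mul1e.
apply/integrableP; split => //; rewrite integral_dirac ?diracT ?mul1e ?ltry//.
exact: measurableT_comp.
Qed.

Lemma measurable_mix_law d' (T : measurableType d') (t : T -> R)
    (k1 k2 : T -> pprobability Y R) :
  measurable_fun setT t -> measurable_fun setT k1 -> measurable_fun setT k2 ->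
  measurable_fun setT (fun x => mix_law (t x) (k1 x) (k2 x) : pprobability Y R).
Proof.
move=> mt /measurable_pprobabilityP m1 /measurable_pprobabilityP m2.
apply/measurable_pprobabilityP => B mB.
have mc : measurable_fun setT (fun x => unit_clip (t x)).
  by apply: measurable_maxr => //; exact: measurable_minr.
rewrite (_ : (fun x => _) = fun x => ((unit_clip (t x))%:E * (k1 x : probability Y R) B +
    (1 - unit_clip (t x))%:E * (k2 x : probability Y R) B)%E); last first.
  by apply/funext => x; exact: mix_law_clipE.
apply: emeasurable_funD; apply: emeasurable_funM; try exact: m1; try exact: m2.
  exact/measurable_EFinP.
by apply/measurable_EFinP; exact: measurable_funB.
Qed.

Lemma measurable_dirac_kernel d' (T : measurableType d') (s : T -> Y) :
  measurable_fun setT s -> measurable_fun setT (fun x => \d_(s x) : pprobability Y R).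
Proof.
move=> ms; apply/measurable_pprobabilityP => B mB.
have := measurable_kernel (kdirac ms : R.-ker T ~> Y) B mB; exact.
Qed.

End convex_combination.

Section rearm.
Context (R : realType) (Wt : completePseudoMetricType R) (A : armType).
Local Notation W := (discrete A * borel Wt)%type.
Variables (q : probability W R) (a : A) (r : probability (borel Wt) R).

Let law b : probability (borel Wt) R := if b == a then r else arm_law q b.

(** An explicit law satisfying the relation [replace_arm]; the formula shows that it depends
    measurably on x. *)
Definition rearm : set W -> \bar R := msum (fun n =>
  let b := nth point (index_enum A) n in
  mscale (NngNum (arm_prob_ge0 q b)) (distribution (law b) (@pair (discrete A) (borel Wt) b)))
  (size (index_enum A)).

HB.instance Definition _ := Measure.on rearm.

Lemma rearmE (E : set W) :
  rearm E = (\sum_b (arm_prob q b)%:E * (if b == a then r else arm_law q b) (xsection E b))%E.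
Proof.
rewrite [RHS](big_nth point) big_mkord /rearm /msum; apply: eq_bigr => n _.
by rewrite xsectionE.
Qed.

Let rearm_setT : rearm setT = 1%E.
Proof.
rewrite rearmE; transitivity (q setT); last exact: probability_setT.
rewrite (sum_arm_mass q measurableT); apply: eq_bigr => b _.
have -> : xsection setT b = [set: borel Wt].
  by apply/seteqP; split=> // w _; apply/xsectionP.
by rewrite arm_massE//; case: ifP; rewrite !probability_setT.
Qed.

HB.instance Definition _ := Measure_isProbability.Build _ _ _ rearm rearm_setT.

Lemma rearm_replace_arm : replace_arm q a r rearm.
Proof.
move=> b B mB; apply: (etrans (rearmE _)); rewrite (bigD1 b)//= big1 ?adde0; last first.
  move=> c cb; rewrite notin_xsectionX ?if_same; last first.
    by apply/negP => /set_mem /= e; rewrite e eqxx in cb.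
  by case: ifP; rewrite measure0 mule0.
by rewrite in_xsectionX; [case: ifP|exact: mem_set].
Qed.

Lemma arm_rearm b : 0 < arm_prob q b -> arm_prob rearm b = arm_prob q b /\
  forall B, measurable B -> arm_law rearm b B = (if b == a then r else arm_law q b) B.
Proof.
move=> qb.
have mE B : measurable B -> arm_mass rearm b B =
    ((arm_prob q b)%:E * (if b == a then r else arm_law q b) B)%E.
  by move=> mB; apply: etrans (rearm_replace_arm b mB) _; case: ifP.
have pE : arm_prob rearm b = arm_prob q b.
  by rewrite /arm_prob mE//; case: ifP; rewrite probability_setT mule1.
split => // B mB; have := arm_massE rearm b mB; rewrite mE// pE => /eqP.
rewrite eq_sym => /eqP /(congr1 (fun y => ((arm_prob q b)^-1)%:E * y)%E).
by rewrite !muleA -EFinM mulVf ?mul1e ?gt_eqF.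
Qed.

End rearm.

Section measurable_rearm.
Context (R : realType) (X Wt : completePseudoMetricType R) (A : armType).
Variable M : model X Wt A.
Hypothesis str : max_arm_structure M.
Variables (P : probability (borel X * (discrete A * borel Wt))%type R).
Hypothesis LP : laws M P.

Lemma measurable_rearm a (r : borel X -> pprobability (borel Wt) R) :
  measurable_fun setT r ->
  measurable_fun setT (fun x : borel X =>
    rearm (cond M P x) a (r x) : pprobability (discrete A * borel Wt)%type R).
Proof.
move=> /measurable_pprobabilityP mr; apply/measurable_pprobabilityP => B mB.
rewrite (_ : (fun x => _) = fun x => (\sum_b (arm_prob (cond M P x) b)%:E *
    (if b == a then r x : probability (borel Wt) R else Qarm M P x b) (xsection B b))%E);
  last by apply/funext => x; exact: rearmE.
apply: emeasurable_sum => b; apply: emeasurable_funM.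
  by apply/measurable_EFinP; exact: (measurable_pi str b LP).
have mxB : measurable (xsection B b : set (borel Wt)) by exact: measurable_xsection.
case: (b == a); first exact: mr.
by have /measurable_pprobabilityP := measurable_Qarm str b LP; exact.
Qed.

End measurable_rearm.

Section arm_laws_are_rich.
Context (R : realType) (X Wt Waux : completePseudoMetricType R) (A : armType).
Variable M : model X Wt A.
Hypothesis scW : @second_countable Wt.
Hypothesis str : max_arm_structure M.
Local Notation W := (discrete A * borel Wt)%type.
Local Notation Z := (borel X * W)%type.
Local Notation Y :=
  (Z * (armvec R A * armvec R A) * discrete {set A} * borel Waux)%type.
Variables (f : Y -> R) (v : borel X -> borel Waux).
Hypothesis fFB : FB M f.
Hypothesis mv : measurable_fun setT v.
Variable P : probability Z R.
Hypothesis LP : laws M P.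
Local Notation F := (truth M f P v).

Lemma univ_measurable_measurable d d' (T : measurableType d) (T' : measurableType d')
    (g : T -> T') : measurable_fun setT g -> univ_measurable_fun R g.
Proof.
move=> mg B mB mu; exists (g @^-1` B), (g @^-1` B).
have mgB : measurable (g @^-1` B) by rewrite -[X in measurable X]setTI; exact: mg.
by split => //; rewrite setDv measure0.
Qed.

Lemma eq_law_sym (q q' : probability W R) : eq_law q q' -> eq_law q' q.
Proof. by move=> h E mE; rewrite h. Qed.

Lemma eq_law_trans (q1 q2 q3 : probability W R) : eq_law q1 q2 -> eq_law q2 q3 -> eq_law q1 q3.
Proof. by move=> h h' E mE; rewrite h// h'. Qed.

Lemma eq_law_integral (q q' : probability W R) (g : W -> \bar R) : eq_law q q' ->
  (\int[q]_w g w = \int[q']_w g w)%E.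
Proof. by move=> qq'; apply: eq_measure_integral => E mE _; exact: qq'. Qed.

Definition arm_mean a x : R := fine (\int[Qarm M P x a]_w (F (x, (a, w)))%:E)%E.
Definition dev a x w : R := score M a w - u_ M P x a.

Lemma measurable_F_arm a : measurable_fun setT (fun z : borel X * borel Wt => F (z.1, (a, z.2))).
Proof.
apply: (measurableT_comp (measurable_truth str fFB mv LP)).
apply: measurable_fun_pair; first exact: measurable_fst.
by apply: measurable_fun_pair; [exact: measurable_cst|exact: measurable_snd].
Qed.

Lemma measurable_arm_mean a : measurable_fun setT (arm_mean a : borel X -> R).
Proof.
apply: measurableT_comp => //.
apply: (measurable_kint (f := fun z => (F (z.1, (a, z.2)))%:E) (measurable_Qarm str a LP)).
by apply/measurable_EFinP; exact: measurable_F_arm.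
Qed.

Lemma measurable_dev a : measurable_fun setT (fun z : borel X * borel Wt => dev a z.1 z.2).
Proof.
apply: measurable_funB.
  exact: (measurableT_comp (score_measurable str a) (@measurable_snd _ _ (borel X) (borel Wt))).
exact: (measurableT_comp (measurable_u str a LP) (@measurable_fst _ _ (borel X) (borel Wt))).
Qed.

Lemma dev_integrable a x : (Qarm M P x a).-integrable setT (fun w => (dev a x w)%:E).
Proof.
have h := integrableB measurableT (score_integrable str LP x a)
  (finite_measure_integrable_cst (Qarm M P x a) (u_ M P x a) measurableT).
exact: h.
Qed.

Lemma dev_mean a x : (\int[Qarm M P x a]_w (dev a x w)%:E = 0)%E.
Proof.
have h := @integralB _ _ _ (Qarm M P x a) _ measurableT _ _ (score_integrable str LP x a)
  (finite_measure_integrable_cst (Qarm M P x a) (u_ M P x a) measurableT).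
apply: (etrans h).
rewrite integral_prob_cst.
have := score_identifies str LP x a; rewrite unlock => ->.
by rewrite subee.
Qed.

Lemma self_compatible : compatible M P P.
Proof. by split => //; exact: aeW. Qed.

Lemma F_integrable : {ae marg P, forall x,
  (cond M P x).-integrable setT (fun w => (F (x, w))%:E)}.
Proof. by have [] := compatible_cmean str fFB mv LP self_compatible. Qed.

Lemma F_arm_integrable x a : (cond M P x).-integrable setT (fun w => (F (x, w))%:E) ->
  (Qarm M P x a).-integrable setT (fun w => (F (x, (a, w)))%:E).
Proof. by move=> iF; apply: (integrable_arm (Defs.pi_gt0 str LP x) iF). Qed.

Section test_selection.
Variable a : A.
Hypothesis mix : arm_mixtures M P.
Variables s1 s2 : borel X -> borel Wt.
Hypothesis ms1 : measurable_fun setT s1.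
Hypothesis ms2 : measurable_fun setT s2.
Hypothesis sel : {ae marg P, forall x, [/\ supp (Qarm M P x a) (s1 x),
  supp (Qarm M P x a) (s2 x) & opposite (dev a x (s1 x)) (dev a x (s2 x))]}.

Let p x := weight (dev a x (s1 x)) (dev a x (s2 x)).
Let nu x : probability (borel Wt) R := mix_law (p x) \d_(s1 x) \d_(s2 x).
Let mixed (e : R) x : probability W R :=
  rearm (cond M P x) a (mix_law e (nu x) (Qarm M P x a)).

Let mp : measurable_fun setT (p : borel X -> R).
Proof.
have md (s : borel X -> borel Wt) : measurable_fun setT s ->
    measurable_fun setT (fun x : borel X => dev a x (s x)).
  move=> ms; exact: (measurableT_comp (measurable_dev a)
    (measurable_fun_pair (@measurable_id _ (borel X) setT) ms)).
apply: measurable_funM; first by apply: measurable_funN; exact: md.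
by apply: measurable_funV; apply: measurable_funB; exact: md.
Qed.

Let mnu : measurable_fun setT (nu : borel X -> pprobability (borel Wt) R).
Proof. by apply: measurable_mix_law => //; exact: measurable_dirac_kernel. Qed.

Let mmixed (e : borel X -> R) : measurable_fun setT e ->
  measurable_fun setT (fun x : borel X => mixed (e x) x : pprobability W R).
Proof.
move=> me; apply: (measurable_rearm str LP).
by apply: measurable_mix_law => //; exact: measurable_Qarm.
Qed.

Let nu_integral (g : borel Wt -> R) x : 0 <= p x <= 1 -> measurable_fun setT g ->
  (nu x).-integrable setT (EFin \o g) /\
  (\int[nu x]_w (g w)%:E = (p x * g (s1 x) + (1 - p x) * g (s2 x))%:E)%E.
Proof.
move=> px mg; have [i1 e1] := integral_dirac_pt (s1 x) mg.
have [i2 e2] := integral_dirac_pt (s2 x) mg.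
have [i3 e3] := integral_mix_law px i1 i2; split => //.
by apply: (etrans e3); rewrite e1 e2 -!EFinM -EFinD.
Qed.

Let mixed_adm (adm_a : set (borel X * pprobability W R)) :
  {ae marg P, forall x, forall (e : R) (nu : probability (borel Wt) R)
       (F : set Wt),
       0 < e < 1 -> finite_set F -> F `<=` supp (Qarm M P x a) ->
       nu F = 1%E -> ('E_nu[score M a] = (u_ M P x a)%:E)%E ->
       forall q, replace_arm (cond M P x) a
         (fun B => (1 - e)%:E * Qarm M P x a B + e%:E * nu B)%E q ->
       adm_a (x, q)} ->
  {ae marg P, forall x, forall e : R, 0 < e < 1 -> adm_a (x, mixed e x)}.
Proof.
move=> h; apply: ae_imp2 h sel _ => x h [su1 su2 opp] e e01.
have p01 := weight01 opp; have e01' : 0 <= e <= 1 by have [/ltW-> /ltW->] := andP e01.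
apply: (h e (nu x) [set s1 x; s2 x]) => //.
- by move=> w [->|->].
- apply: (etrans (mix_lawE _ _ _ p01)).
  have dE (w : borel Wt) : [set s1 x; s2 x] w ->
      (\d_w : probability (borel Wt) R) [set s1 x; s2 x] = 1%E.
    by move=> ?; rewrite /= /dirac indicE mem_set.
  apply: (etrans (congr2 (fun y z => (p x)%:E * y + (1 - p x)%:E * z)%E
    (dE (s1 x) (or_introl erefl)) (dE (s2 x) (or_intror erefl)))).
  by rewrite !mule1 -EFinD addrCA subrr addr0.
- have [_ e1] := nu_integral p01 (score_measurable str a).
  rewrite unlock e1; congr EFin.
  have := weight_mean opp; rewrite -/(p x) /dev => E.
  by apply/eqP; rewrite -subr_eq0 -E; apply/eqP; ring.
- move=> b B mB; apply: (etrans (rearm_replace_arm _ _ _ b mB)).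
  case: (b == a) => //; congr (_ * _)%E.
  by apply: (etrans (mix_lawE _ _ _ e01')); rewrite addeC.
Qed.

(** The proportion may vary with x, so that one glued law can use one proportion on a set and
    another one off it, as the localized identity demands. *)
Let glue (e : borel X -> R) (m : R) : measurable_fun setT e -> (forall x, 0 < e x < 1) ->
  exists P', [/\ compatible M P P', {ae marg P, forall x, psiP M P' x = psiP M P x} &
    {ae marg P, forall x,
      eq_law (localized M P m (fun x => mixed (e x) x) x) (cond M P' x)}].
Proof.
move=> me e01; have [adm_a [_ _ _ /mixed_adm adm_mix glues_a]] := mix a.
have [||_ /(_ m)[P' [LP' lawP' eqP']]] := glues_a (fun x => mixed (e x) x).
- by apply: univ_measurable_measurable; exact: mmixed.
- by apply: ae_imp adm_mix _ => x; apply.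
exists P'; split.
- split => //; first exact: law_of_marg lawP'.
  + by apply: ae_imp eqP' _ => x [].
  + by apply: ae_imp eqP' _ => x [].
- by apply: ae_imp eqP' _ => x [e1 _ _]; rewrite /psiP; congr psi.
- exact: glued_eq_law lawP'.
Qed.

(* Two mixing proportions of the same two-point law are compared: their
   difference isolates that law, and both mixtures are covered by (X1), which
   says nothing about [cond M P] itself. *)
Let compare (m : R) : {ae marg P, forall x,
  cost M x (mixed 2^-1 x) <= m -> cost M x (mixed 4^-1 x) <= m ->
  [/\ (mixed 2^-1 x).-integrable setT (fun w => (F (x, w))%:E),
      (mixed 4^-1 x).-integrable setT (fun w => (F (x, w))%:E) &
      (\int[mixed 2^-1 x]_w (F (x, w))%:E = \int[mixed 4^-1 x]_w (F (x, w))%:E)%E]}.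
Proof.
have h2 : 0 < (2^-1 : R) < 1 by rewrite invr_gt0 ltr0n /= invf_lt1// ltr1n.
have h4 : 0 < (4^-1 : R) < 1 by rewrite invr_gt0 ltr0n /= invf_lt1// ltr1n.
have [P1 [c1 u1 e1]] := glue m (@measurable_cst _ _ (borel X) R setT 2^-1) (fun=> h2).
have [P0 [c0 u0 e0]] := glue m (@measurable_cst _ _ (borel X) R setT 4^-1) (fun=> h4).
have ident : {ae marg P, forall x,
    (cmean M f v P P1 x - (psiP M P1 x)%:E = cmean M f v P P0 x - (psiP M P0 x)%:E)%E}.
  apply: (localized_identity str fFB mv LP c1 c0) => E mE.
  pose eE (x : borel X) : R := if x \in E then 2^-1 else 4^-1.
  have meE : measurable_fun setT eE.
    by apply: measurable_fun_ifT => //; exact: measurable_fun_mem.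
  have [|P' [cP' _ eP']] := glue m meE.
    by move=> x; rewrite /eE; case: ifP.
  exists P' => //; apply: ae_imp3 eP' e1 e0 _ => x eE1 e1x e0x; split=> Ex.
    apply: eq_law_trans (eq_law_sym eE1) _.
    by rewrite /localized /eE mem_set.
  apply: eq_law_trans (eq_law_sym eE1) _.
  by rewrite /localized /eE memNset.
have [i1 _ _ _] := compatible_cmean str fFB mv LP c1.
have [i0 _ _ _] := compatible_cmean str fFB mv LP c0.
have ee : {ae marg P, forall x,
  eq_law (localized M P m (mixed 2^-1) x) (cond M P1 x) /\
  eq_law (localized M P m (mixed 4^-1) x) (cond M P0 x)} by apply: ae_imp2 e1 e0 _.
have uu : {ae marg P, forall x, psiP M P1 x = psiP M P x /\ psiP M P0 x = psiP M P x}
  by apply: ae_imp2 u1 u0 _.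
have ii : {ae marg P, forall x, (cond M P1 x).-integrable setT (fun w => (F (x, w))%:E) /\
  (cond M P0 x).-integrable setT (fun w => (F (x, w))%:E)} by apply: ae_imp2 i1 i0 _.
have ui : {ae marg P, forall x, (psiP M P1 x = psiP M P x /\ psiP M P0 x = psiP M P x) /\
  (cmean M f v P P1 x - (psiP M P1 x)%:E = cmean M f v P P0 x - (psiP M P0 x)%:E)%E}.
  by apply: ae_imp2 uu ident _.
apply: ae_imp3 ee ii ui _ => x [l1 l0] [j1 j0] [[p1 p0] id] k1 k0.
rewrite /localized k1 in l1; rewrite /localized k0 in l0.
split.
- by apply: eq_measure_integrable j1 => E mE; exact: (esym (l1 E mE)).
- by apply: eq_measure_integrable j0 => E mE; exact: (esym (l0 E mE)).
- rewrite (eq_law_integral _ l1) (eq_law_integral _ l0).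
  move: id; rewrite p1 p0 => /eqP; rewrite eq_le !leeD2rE// -eq_le => /eqP.
  exact.
Qed.

Let mixed_integral e x : 0 < e < 1 -> 0 <= p x <= 1 ->
  (cond M P x).-integrable setT (fun w => (F (x, w))%:E) ->
  (mixed e x).-integrable setT (fun w => (F (x, w))%:E) ->
  (\int[mixed e x]_w (F (x, w))%:E =
    \sum_(b | b != a) (pi_ M P x b)%:E * \int[Qarm M P x b]_w (F (x, (b, w)))%:E +
    (pi_ M P x a * (e * (p x * F (x, (a, s1 x)) + (1 - p x) * F (x, (a, s2 x))) +
                    (1 - e) * arm_mean a x))%:E)%E.
Proof.
move=> e01 p01 iF imF; have e01' : 0 <= e <= 1 by have [/ltW-> /ltW->] := andP e01.
have rE b := arm_rearm a (mix_law e (nu x) (Qarm M P x a)) (Defs.pi_gt0 str LP x b).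
rewrite integral_arm//; last first.
  by move=> b; rewrite (rE b).1; exact: (Defs.pi_gt0 str LP).
rewrite (bigD1 a)//= addeC; congr (_ + _)%E.
  apply: eq_bigr => b ba; rewrite (rE b).1; congr (_ * _)%E.
  apply: eq_measure_integral => B mB _; apply: (etrans ((rE b).2 B mB)).
  by rewrite (negbTE ba).
rewrite (rE a).1 EFinM; congr (_ * _)%E.
transitivity (\int[mix_law e (nu x) (Qarm M P x a)]_w (F (x, (a, w)))%:E)%E.
  apply: eq_measure_integral => B mB _; apply: (etrans ((rE a).2 B mB)).
  by rewrite eqxx.
have mFa : measurable_fun setT (fun w : borel Wt => F (x, (a, w))).
  by have := measurableT_comp (measurable_F_arm a) (pair1_measurable (x : borel X)).
have [iN eN] := nu_integral p01 mFa.
have iQ := F_arm_integrable a iF.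
have [_ ->] := integral_mix_law e01' iN iQ.
have QE : (\int[Qarm M P x a]_w (F (x, (a, w)))%:E = (arm_mean a x)%:E)%E.
  by rewrite /arm_mean fineK//; exact: integrable_fin_num.
by rewrite eN QE -!EFinM -EFinD.
Qed.

(** Every x falls under some cost level n. There the mean of [F] is affine in the mixing proportion
    and takes the same value at 1/2 and 1/4, so the two-point law and the arm law give [F] the same
    mean. *)
Lemma two_point_test : {ae marg P, forall x,
  p x * F (x, (a, s1 x)) + (1 - p x) * F (x, (a, s2 x)) = arm_mean a x}.
Proof.
have cmp : {ae marg P, forall x, forall n : nat,
    cost M x (mixed 2^-1 x) <= n%:R -> cost M x (mixed 4^-1 x) <= n%:R ->
  [/\ (mixed 2^-1 x).-integrable setT (fun w => (F (x, w))%:E),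
      (mixed 4^-1 x).-integrable setT (fun w => (F (x, w))%:E) &
      (\int[mixed 2^-1 x]_w (F (x, w))%:E = \int[mixed 4^-1 x]_w (F (x, w))%:E)%E]}.
  by apply: ae_foralln => n; exact: compare.
apply: ae_imp3 cmp F_integrable sel _ => x cx iF [_ _ opp].
have h2 : 0 < (2^-1 : R) < 1 by rewrite invr_gt0 ltr0n /= invf_lt1// ltr1n.
have h4 : 0 < (4^-1 : R) < 1 by rewrite invr_gt0 ltr0n /= invf_lt1// ltr1n.
have p01 := weight01 opp.
pose K := Num.max (cost M x (mixed 2^-1 x)) (cost M x (mixed 4^-1 x)).
have [n nK] : exists n : nat, K <= n%:R.
  by exists (Num.bound `|K|); rewrite (le_trans (ler_norm _))// ltW// archi_boundP.
have [||i2 i4] := cx n.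
- by rewrite (le_trans _ nK)// le_max lexx.
- by rewrite (le_trans _ nK)// le_max lexx orbT.
rewrite !mixed_integral//.
set S := (\sum_(b | _) _)%E.
have fS : S \is a fin_num.
  rewrite /S; elim/big_ind : _ => [//|y z fy fz|b _]; first by rewrite fin_numD fy.
  by rewrite fin_numM//; apply: integrable_fin_num => //; exact: F_arm_integrable.
(* The other arms contribute the same finite sum [S] to both sides; the positive arm probability is
   cancelled next. *)
rewrite -(fineK fS) -!EFinD => -[] /addrI /(mulfI _) h.
have := h; rewrite gt_eqF; last exact: (Defs.pi_gt0 str LP).
move=> /(_ isT); lra.
Qed.

End test_selection.
End arm_laws_are_rich.

Section arm_affine.
Context (R : realType) (X Wt Waux : completePseudoMetricType R) (A : armType).
Variable M : model X Wt A.
Hypothesis scW : @second_countable Wt.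
Hypothesis str : max_arm_structure M.
Local Notation W := (discrete A * borel Wt)%type.
Local Notation Z := (borel X * W)%type.
Local Notation Y :=
  (Z * (armvec R A * armvec R A) * discrete {set A} * borel Waux)%type.
Variables (f : Y -> R) (v : borel X -> borel Waux).
Hypothesis fFB : FB M f.
Hypothesis mv : measurable_fun setT v.
Variable P : probability Z R.
Hypothesis LP : laws M P.
Variable a : A.
Hypothesis mix : arm_mixtures M P.
Local Notation F := (truth M f P v).
Local Notation XW := (borel X * borel Wt)%type.

Let measurable_bool_set d (T : measurableType d) (b : T -> bool) :
  measurable_fun setT b -> measurable [set x | b x].
Proof.
move=> mb; rewrite -[X in measurable X]setTI.
exact: (mb measurableT [set true]).
Qed.

Let k : borel X -> pprobability (borel Wt) R := fun x => Qarm M P x a.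
Let mk : measurable_fun setT k.
Proof. exact: measurable_Qarm. Qed.
Let k2 : XW -> pprobability (borel Wt) R := fun z => k z.1.
Let mk2 : measurable_fun setT k2.
Proof. exact: (measurableT_comp mk (@measurable_fst _ _ (borel X) (borel Wt))). Qed.

Let H (z : XW) := dev M P a z.1 z.2.
Let mH : measurable_fun setT H.
Proof. exact: (measurable_dev str LP). Qed.
Let G (z : XW) := F (z.1, (a, z.2)).
Let mG : measurable_fun setT G.
Proof. exact: (measurable_F_arm str fFB mv LP). Qed.

Let fst3 (z : XW * borel Wt) : XW := z.1.
Let snd3 (z : XW * borel Wt) : XW := (z.1.1, z.2).
Let mfst3 : measurable_fun setT fst3.
Proof. exact: measurable_fst. Qed.
Let msnd3 : measurable_fun setT snd3.
Proof.
apply: measurable_fun_pair; last exact: measurable_snd.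
exact: (measurableT_comp (@measurable_fst _ _ (borel X) (borel Wt)) mfst3).
Qed.

Let S3 := [set z : XW * borel Wt | [/\ supp (k z.1.1) z.1.2, supp (k z.1.1) z.2 &
  opposite (H (fst3 z)) (H (snd3 z))]].
Let D3 := S3 `&` [set z : XW * borel Wt |
  weight (H (fst3 z)) (H (snd3 z)) * G (fst3 z) +
  (1 - weight (H (fst3 z)) (H (snd3 z))) * G (snd3 z) != arm_mean M f v P a z.1.1].

Let mH1 : measurable_fun setT (fun z => H (fst3 z)).
Proof. exact: (measurableT_comp mH mfst3). Qed.
Let mH2 : measurable_fun setT (fun z => H (snd3 z)).
Proof. exact: (measurableT_comp mH msnd3). Qed.

Let mS3 : measurable S3.
Proof.
have -> : S3 = fst3 @^-1` [set z : XW | supp (k z.1) z.2] `&`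
    (snd3 @^-1` [set z : XW | supp (k z.1) z.2] `&`
     [set z | opposite (H (fst3 z)) (H (snd3 z))]).
  by apply/seteqP; split=> z; [move=> [? ? ?]; split|move=> [? [? ?]]; split].
have ms := measurable_supp scW mk.
apply: measurableI; first by rewrite -[X in measurable X]setTI; exact: mfst3.
apply: measurableI; first by rewrite -[X in measurable X]setTI; exact: msnd3.
apply: measurable_bool_set; apply: measurable_or; apply: measurable_and;
  by [apply: measurable_fun_ltr|apply: measurable_fun_eqr].
Qed.

Let mD3 : measurable D3.
Proof.
apply: measurableI => //; apply: measurable_bool_set; apply: measurable_neg.
have mw : measurable_fun setT (fun z => weight (H (fst3 z)) (H (snd3 z))).
  apply: measurable_funM; first exact: measurable_funN.
  by apply: measurable_funV; exact: measurable_funB.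
apply: measurable_fun_eqr.
  apply: measurable_funD; apply: measurable_funM => //.
  - exact: (measurableT_comp mG mfst3).
  - exact: measurable_funB.
  - exact: (measurableT_comp mG msnd3).
apply: (measurableT_comp (measurable_arm_mean str fFB mv LP a)).
exact: (measurableT_comp (@measurable_fst _ _ (borel X) (borel Wt)) mfst3).
Qed.

Let charged (E : set (XW * borel Wt)) : set XW :=
  [set z | (0 < (k2 z : probability (borel Wt) R) (xsection E z))%E].
Let mcharged E : measurable E -> measurable (charged E).
Proof.
move=> mE; rewrite -[charged E]setTI.
apply: emeasurable_fun_o_infty => //; exact: measurable_kxsection.
Qed.
(** Points x at which the violating pairs have positive mass under the square of the arm law,
    written as an iterated condition suited to selecting one point after the other. *)
Let bad : set (borel X) :=
  [set x | (0 < (k x : probability (borel Wt) R) (xsection (charged D3) x))%E].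
Let mbad : measurable bad.
Proof.
rewrite -[bad]setTI.
by apply: emeasurable_fun_o_infty => //; apply: measurable_kxsection => //; exact: mcharged.
Qed.

(* Where some pairs violate the equation select among those, elsewhere among
   all pairs of opposite sign. *)
Let C3 := (D3 `&` [set z | bad z.1.1]) `|` (S3 `&` [set z | ~ bad z.1.1]).

Let mC3 : measurable C3.
Proof.
have mf : measurable_fun setT (fun z : XW * borel Wt => z.1.1).
  exact: (measurableT_comp (@measurable_fst _ _ (borel X) (borel Wt)) mfst3).
have mb : measurable [set z : XW * borel Wt | bad z.1.1].
  by rewrite -[X in measurable X]setTI; exact: mf.
apply: measurableU; apply: measurableI => //.
by have := measurableC mb.
Qed.

(** At a bad x this is the definition of [bad]; elsewhere a score of mean zero always offers pairs
    of opposite sign. The selection thus succeeds at almost every x. *)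
Let C3_charged x : (0 < (k x : probability (borel Wt) R) (xsection (charged C3) x))%E.
Proof.
have [bx|bx] := pselect (bad x).
  suff -> : xsection (charged C3) x = xsection (charged D3) x by [].
  have e w : xsection C3 (x, w) = xsection D3 (x, w).
    apply/seteqP; split=> w2 /xsectionP h; apply/xsectionP.
      by case: h => [[]|[]].
    by left.
  by apply/seteqP; split=> w /xsectionP h; apply/xsectionP; move: h; rewrite /charged /= e.
have e w : xsection C3 (x, w) =
    [set w2 | [/\ supp (k x) w, supp (k x) w2 & opposite (H (x, w)) (H (x, w2))]].
  apply/seteqP; split=> w2 => [/xsectionP h|h]; last by apply/xsectionP; right.
  by case: h => [[_ /bx]|[]].
have e2 : xsection (charged C3) x = [set w | (0 < k x
    [set w2 | [/\ supp (k x) w, supp (k x) w2 & opposite (H (x, w)) (H (x, w2))]])%E].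
  by apply/seteqP; split=> w; [move/xsectionP|move=> h; apply/xsectionP; move: h];
    rewrite /charged /= e.
rewrite e2; apply: (exists_opposite (Q := k x) (H := fun w => H (x, w))
   (dev_integrable str LP a x) (dev_mean str LP a x) (good := supp (k x))).
- have := measurable_xsection x (measurable_supp scW mk).
  by congr measurable; apply/seteqP; split=> w => [/xsectionP|h]; last exact/xsectionP.
- exact: supp_full.
- by rewrite -e2; apply: measurable_xsection; exact: mcharged.
Qed.

Lemma arm_affine : {ae marg P, forall x, exists b : R,
  {ae Qarm M P x a, forall w, F (x, (a, w)) = arm_mean M f v P a x + b * dev M P a x w}}.
Proof.
have [s1 [ms1 s1P]] := charged_selection mk (marg P) scW (mcharged mC3).
(* The first point leaves positive mass of second points; once it is substituted, the second
   selection is again one from sets of pairs. *)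
pose C2 : set XW := [set z | C3 ((z.1, s1 z.1), z.2)].
have mC2 : measurable C2.
  rewrite -[X in measurable X]setTI.
  have mg : measurable_fun setT (fun z : XW => ((z.1, s1 z.1), z.2)).
    apply: measurable_fun_pair; last exact: measurable_snd.
    apply: measurable_fun_pair; first exact: measurable_fst.
    exact: (measurableT_comp ms1 (@measurable_fst _ _ (borel X) (borel Wt))).
  exact: mg.
have [s2 [ms2 s2P]] := charged_selection mk (marg P) scW mC2.
have C3s : {ae marg P, forall x, C3 ((x, s1 x), s2 x)}.
  apply: ae_imp2 s1P s2P _ => x h1 h2; apply: h2.
  have := h1 (C3_charged x); rewrite /charged /=.
  congr (_ < k x _)%E; apply/seteqP; split=> w /xsectionP h; exact/xsectionP.
have sel : {ae marg P, forall x, [/\ supp (Qarm M P x a) (s1 x),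
    supp (Qarm M P x a) (s2 x) & opposite (dev M P a x (s1 x)) (dev M P a x (s2 x))]}.
  by apply: ae_imp C3s _ => x [[[]]|[]].
apply: ae_imp2 C3s (two_point_test scW str fFB mv LP mix ms1 ms2 sel) _ => x Cx tx.
(* At a bad x the selected pair would violate the equation that holds along every selection. *)
have Nbad : ~ bad x.
  by move=> bx; case: Cx => [[[_ /negP]]|[]//]; rewrite /G /= tx.
have bad0 : k x (xsection (charged D3) x) = 0%E.
  by apply/eqP; rewrite eq_le measure_ge0 andbT leNgt; apply/negP.
apply: (two_point_affine (dev_integrable str LP a x) (dev_mean str LP a x)).
have mxD : measurable (xsection (charged D3) x) by apply: measurable_xsection; exact: mcharged.
have aeD : {ae Qarm M P x a, forall w, ~ xsection (charged D3) x w}.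
  by exists (xsection (charged D3) x); split=> // w /=; rewrite not_notE.
apply: ae_imp2 aeD (supp_full scW (Qarm M P x a)) _ => w1 ND s1w.
have D0 : k x (xsection D3 (x, w1)) = 0%E.
  apply/eqP; rewrite eq_le measure_ge0 andbT leNgt; apply/negP => h.
  by apply: ND; apply/xsectionP.
have aeD2 : {ae Qarm M P x a, forall w, ~ xsection D3 (x, w1) w}.
  exists (xsection D3 (x, w1)); split=> //; first exact: measurable_xsection.
  by move=> w /=; rewrite not_notE.
apply: ae_imp2 aeD2 (supp_full scW (Qarm M P x a)) _ => w2 ND2 s2w opp.
apply: contrapT => /eqP neq; apply: ND2; apply/xsectionP; split=> //.
Qed.

End arm_affine.

(** * Perturbing the active scores *)

Section active_arms.
Context (R : realType) (X Wt : completePseudoMetricType R) (A : armType).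
Variable M : model X Wt A.
Implicit Types (x : X) (u dl : A -> R) (a : A).

Lemma argmaxP x u a : reflect (forall b, gain M x b (u b) <= gain M x a (u a))
  (a \in argmax M x u).
Proof. by rewrite inE; exact: forallP. Qed.

Lemma psi_argmax x u a : a \in argmax M x u -> psi M x u = gain M x a (u a).
Proof.
move=> /argmaxP am; apply/le_anti/andP; split; first by apply: bigmax_le.
exact: le_bigmax.
Qed.

Lemma exists_argmax x u : exists a, a \in argmax M x u.
Proof.
have [a _ h] := @Order.TotalTheory.arg_maxP _ _ _ (point : A) xpredT (fun b => gain M x b (u b)) isT.
by exists a; apply/argmaxP => b; exact: h.
Qed.

(** All maximal gains rise by the same amount and the others stay put. A nonnegative shift is what
    keeps the inactive arms from overtaking. *)
Lemma argmax_shift x u dl (t : R) : 0 <= t ->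
  (forall a, a \notin argmax M x u -> dl a = 0) ->
  (forall a, a \in argmax M x u -> gain M x a (u a + dl a) = gain M x a (u a) + t) ->
  argmax M x (Defs.addv u dl) = argmax M x u /\ psi M x (Defs.addv u dl) = psi M x u + t.
Proof.
move=> t0 inact act.
have [c cu] := exists_argmax x u.
have gE b : gain M x b (Defs.addv u dl b) =
    gain M x b (u b) + (if b \in argmax M x u then t else 0).
  by rewrite /Defs.addv; case: ifPn => [/act//|/inact ->]; rewrite !addr0.
have cmax := argmaxP _ _ _ cu.
have e : argmax M x (Defs.addv u dl) = argmax M x u.
  apply/setP => a; apply/idP/idP => [/argmaxP am|au].
    apply: contrapT => /negP Na; have := am c; rewrite !gE cu (negbTE Na) addr0 => h.
    move/negP: (Na); apply; apply/argmaxP => b; apply: le_trans (cmax b) _.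
    by apply: le_trans h; rewrite lerDl.
  apply/argmaxP => b; rewrite !gE au; apply: lerD; last by case: ifP.
  exact: (argmaxP _ _ _ au).
by split=> //; rewrite (psi_argmax cu) (@psi_argmax _ _ c) ?e// gE cu.
Qed.

End active_arms.

Section active_slopes.
Context (R : realType) (X Wt Waux : completePseudoMetricType R) (A : armType).
Variable M : model X Wt A.
Hypothesis scW : @second_countable Wt.
Hypothesis str : max_arm_structure M.
Local Notation W := (discrete A * borel Wt)%type.
Local Notation Z := (borel X * W)%type.
Local Notation Y :=
  (Z * (armvec R A * armvec R A) * discrete {set A} * borel Waux)%type.
Variables (f : Y -> R) (v : borel X -> borel Waux).
Hypothesis fFB : FB M f.
Hypothesis mv : measurable_fun setT v.
Variable P : probability Z R.
Hypothesis LP : laws M P.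
Local Notation F := (truth M f P v).

Section perturbation_path.
Variables (Q : X -> (A -> R) -> probability W R) (dl : borel X -> armvec R A) (t : X -> R).
Hypothesis t0 : forall x, 0 < t x.
Hypothesis dlP : {ae marg P, forall x,
  (forall a, a \notin kappa M P x -> dl x a = 0) /\
  (forall a, a \in kappa M P x ->
    gain M x a (u_ M P x a + dl x a) = gain M x a (u_ M P x a) + t x)}.
Hypothesis Q0 : {ae marg P, forall x, eq_law (Q x (@zerov R A)) (cond M P x)}.
Hypothesis Qdl : {ae marg P, forall x, arm_prob (Q x (dl x)) = pi_ M P x /\
  forall a, ('E_(arm_law (Q x (dl x)) a)[score M a] = (u_ M P x a + dl x a)%:E)%E}.
Hypothesis Qglue : forall E : set (borel X), measurable E ->
  forall m, glues M P (localized M P m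
    (fun x => Q x (if x \in E then dl x else @zerov R A))) (fun=> True).

Let path_eq (P' : probability Z R) x : laws M P' -> 
  (forall a, a \notin kappa M P x -> dl x a = 0) ->
  (forall a, a \in kappa M P x ->
    gain M x a (u_ M P x a + dl x a) = gain M x a (u_ M P x a) + t x) ->
  arm_prob (Q x (dl x)) = pi_ M P x ->
  (forall a, ('E_(arm_law (Q x (dl x)) a)[score M a] = (u_ M P x a + dl x a)%:E)%E) ->
  eq_law (Q x (dl x)) (cond M P' x) ->
  [/\ eta2 M P' x = eta2 M P x, kappa M P' x = kappa M P x &
      psiP M P' x = psiP M P x + t x].
Proof.
move=> LP' d0 d1 qp qE qP'.
have uE : u_ M P' x = Defs.addv (u_ M P x) (dl x).
  apply/funext => a; have [_ _] := eq_law_score str LP' qP' a.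
  by have := qE a; rewrite unlock => -> [].
have [k1 p1] := argmax_shift (ltW (t0 x)) d0 d1.
split; last by rewrite /psiP uE.
- by apply/funext => a; rewrite /eta2 -qp; have [-> _ _] := eq_law_score str LP' qP' a.
- by rewrite /kappa uE.
Qed.

Let glue (E : set (borel X)) (m : R) : measurable E -> exists P', compatible M P P' /\
  {ae marg P, forall x,
    (x \in E -> cost M x (Q x (dl x)) <= m -> eq_law (Q x (dl x)) (cond M P' x) /\
       psiP M P' x = psiP M P x + t x) /\
    (~ (x \in E /\ cost M x (Q x (dl x)) <= m) -> eq_law (cond M P x) (cond M P' x))}.
Proof.
move=> mE; have [P' [LP' lawP' _]] := Qglue mE m.
exists P'.
have eqP' := glued_eq_law scW str LP' lawP'.
have key : {ae marg P, forall x,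
    ((x \in E -> cost M x (Q x (dl x)) <= m -> eq_law (Q x (dl x)) (cond M P' x) /\
       psiP M P' x = psiP M P x + t x) /\
    (~ (x \in E /\ cost M x (Q x (dl x)) <= m) -> eq_law (cond M P x) (cond M P' x))) /\
    eta2 M P' x = eta2 M P x /\ kappa M P' x = kappa M P x}.
  have dQ := ae_imp2 dlP Qdl (fun x => @conj _ _).
  apply: ae_imp3 dQ Q0 eqP' _ => x [[d0 d1] [qp qE]] q0 qP'.
  have [[xE cm]|Nc] := pselect (x \in E /\ cost M x (Q x (dl x)) <= m).
    rewrite /localized xE cm in qP'.
    have [h1 h2 h3] := path_eq LP' d0 d1 qp qE qP'.
    by split=> //; split=> // -[].
  have cP' : eq_law (cond M P x) (cond M P' x).
    (* Off [E] the selection is the zero direction, either kept or replaced by the baseline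
       according to its cost; both have the law [cond M P x]. *)
    apply: eq_law_trans qP'; rewrite /localized.
    case: (boolP (x \in E)) => xE; last by case: ifP => // _; exact: eq_law_sym.
    by case: ifP => // cm; case: Nc.
  split; first by split=> // xE cm; case: Nc.
  split; last by rewrite /kappa (eq_law_u str LP LP' cP').
  by apply/funext => a; rewrite /eta2; have [<- _ _] := eq_law_score str LP' cP' a.
split; last by apply: ae_imp key _ => x [].
split => //; first exact: law_of_marg lawP'.
- by apply: ae_imp key _ => x [_ []].
- by apply: ae_imp key _ => x [_ []].
Qed.

(** The localized identity compares the law glued along the path with one glued along the zero
    direction. Between them [psi] differs by [t x] where the cost is at most n, and every x
    satisfies this for some n. *)
Lemma path_mean : {ae marg P, forall x,
  (Q x (dl x)).-integrable setT (fun w => (F (x, w))%:E) /\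
  (\int[Q x (dl x)]_w (F (x, w))%:E = \int[cond M P x]_w (F (x, w))%:E + (t x)%:E)%E}.
Proof.
suff : {ae marg P, forall x, forall n : nat, cost M x (Q x (dl x)) <= n%:R ->
    (Q x (dl x)).-integrable setT (fun w => (F (x, w))%:E) /\
  (\int[Q x (dl x)]_w (F (x, w))%:E = \int[cond M P x]_w (F (x, w))%:E + (t x)%:E)%E}.
  move=> h; apply: ae_imp h _ => x h.
  pose K := cost M x (Q x (dl x)); apply: (h (Num.bound `|K|)).
  by rewrite (le_trans (ler_norm _))// ltW// archi_boundP.
apply: ae_foralln => n.
have [P1 [c1 e1]] := glue n%:R measurableT.
(* For the empty set the glued law has the baseline kernel almost everywhere. *)
have [P0 [c0 e0]] := glue n%:R measurable0.
have ident : {ae marg P, forall x,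
    (cmean M f v P P1 x - (psiP M P1 x)%:E = cmean M f v P P0 x - (psiP M P0 x)%:E)%E}.
  apply: (localized_identity str fFB mv LP c1 c0) => E mE.
  have [P' [c' e']] := glue n%:R mE; exists P' => //.
  apply: ae_imp3 e' e1 e0 _ => x [a' b'] [a1 b1] [_ b0]; split=> Ex.
    have [cm|cm] := pselect (cost M x (Q x (dl x)) <= n%:R).
      have [q' _] := a' (mem_set Ex) cm; have [q1 _] := a1 (mem_set Logic.I) cm.
      exact: eq_law_trans (eq_law_sym q') q1.
    by apply: eq_law_trans (eq_law_sym (b' _)) (b1 _) => -[].
  apply: eq_law_trans (eq_law_sym (b' _)) (b0 _) => -[].
    by move/set_mem.
  by rewrite in_set0.
have [i1 _ _ _] := compatible_cmean str fFB mv LP c1.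
have ie := ae_imp2 ident i1 (fun x => @conj _ _).
apply: ae_imp3 ie e1 e0 _ => x [id i1x] [a1 _] [_ b0] cm.
have [q1 p1] := a1 (mem_set Logic.I) cm.
have q0 : eq_law (cond M P x) (cond M P0 x) by apply: b0 => -[]; rewrite in_set0.
have [L0 _ _ _] := c0.
split; first by apply: eq_measure_integrable i1x => E mE; exact: (esym (q1 E mE)).
rewrite (eq_law_integral _ q1) (eq_law_integral _ q0).
have pE : psiP M P0 x = psiP M P x by rewrite /psiP (eq_law_u str LP L0 q0).
move: id; rewrite /cmean p1 pE.
have := integrable_fin_num measurableT i1x.
case: (\int[cond M P1 x]_w _)%E => // r _.
case: (\int[cond M P0 x]_w _)%E => [r0| |]//=.
by rewrite -!(EFinB, EFinD) => -[h]; congr EFin; lra.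
Qed.

End perturbation_path.
End active_slopes.

(** * Conditional variances *)

(** Completing the square: with J the sum on the left, the difference of the two sides is the sum of
    p_i s_i (b_i - 1/(g_i s_i J))^2. The minimizer 1/(g_i s_i J) is the slope of the oracle. *)
Lemma weighted_cauchy_schwarz (R : realFieldType) (I : finType) (K : {set I})
    (p b g s : I -> R) : K != finset.set0 -> (forall i, i \in K -> 0 < p i) ->
  (forall i, i \in K -> 0 < s i) -> (forall i, g i != 0) ->
  \sum_(i in K) p i * (b i / g i) = 1 ->
  (\sum_(i in K) p i / (g i ^+ 2 * s i))^-1 <= \sum_(i in K) p i * (b i ^+ 2 * s i).
Proof.
move=> K0 p0 s0 g0 E; set J := \sum_(i in K) _ / _.
have J0 : 0 < J.
  have [i iK] := set0Pn _ K0.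
  rewrite /J (bigD1 i)//= ltr_wpDr//.
    apply: sumr_ge0 => j /andP[jK _].
    apply: divr_ge0; first by rewrite ltW// p0.
    by rewrite mulr_ge0 ?sqr_ge0// ltW// s0.
  by rewrite divr_gt0 ?p0// mulr_gt0 ?s0// exprn_even_gt0 ?g0.
rewrite -subr_ge0.
have -> : \sum_(i in K) p i * (b i ^+ 2 * s i) - J^-1 =
    \sum_(i in K) p i * s i * (b i - (g i * s i * J)^-1) ^+ 2.
  have -> : \sum_(i in K) p i * s i * (b i - (g i * s i * J)^-1) ^+ 2 =
      \sum_(i in K) (p i * (b i ^+ 2 * s i) - 2 / J * (p i * (b i / g i)) +
                     J ^- 2 * (p i / (g i ^+ 2 * s i))).
    apply: eq_bigr => i iK; have := s0 i iK => si.
    by field; rewrite g0 !gt_eqF.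
  rewrite !big_split /= sumrN -!mulr_sumr E -/J.
  by field; rewrite gt_eqF.
apply: sumr_ge0 => i iK; rewrite mulr_ge0 ?sqr_ge0// mulr_ge0// ltW//.
  exact: p0.
exact: s0.
Qed.

Section affine_moments.
Context d (Y : measurableType d) (R : realType) (Q : probability Y R).
Variables (h : Y -> R).
Hypothesis ih : Q.-integrable setT (EFin \o h).

Let mh : measurable_fun setT h.
Proof. by apply/measurable_EFinP; exact: measurable_int ih. Qed.

Lemma integral_affine (g : Y -> R) (c b m : R) : measurable_fun setT g ->
  (\int[Q]_y (h y)%:E = m%:E)%E ->
  {ae Q, forall y, g y = c + b * h y} -> (\int[Q]_y (g y)%:E = (c + b * m)%:E)%E.
Proof.
move=> mg hm gE.
have ic := finite_measure_integrable_cst Q c measurableT.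
have ib : Q.-integrable setT (fun y => (b%:E * (h y)%:E)%E) by exact: integrableZl.
transitivity (\int[Q]_y ((EFin \o cst c) y + b%:E * (h y)%:E))%E.
  apply: ae_eq_integral => //.
  - exact/measurable_EFinP.
  - by apply: emeasurable_funD; [exact: measurable_int ic|exact: measurable_int ib].
  - by apply: ae_imp gE _ => y -> _ /=; rewrite EFinD EFinM.
rewrite integralD// integralZl// hm.
by rewrite integral_prob_cst EFinD EFinM.
Qed.

Lemma integral_affine_sqr (g : Y -> R) (c b s : R) : measurable_fun setT g ->
  (\int[Q]_y (h y)%:E = 0)%E -> (\int[Q]_y (h y ^+ 2)%:E = s%:E)%E ->
  {ae Q, forall y, g y = c + b * h y} ->
  (\int[Q]_y (g y ^+ 2)%:E = (c ^+ 2 + b ^+ 2 * s)%:E)%E.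
Proof.
move=> mg h0 h2 gE.
pose c2 := c ^+ 2; pose cb := 2 * c * b; pose b2 := b ^+ 2.
have mh2 : measurable_fun setT (fun y => h y ^+ 2) by exact: measurable_funX.
have ic := finite_measure_integrable_cst Q c2 measurableT.
have ib : Q.-integrable setT (fun y => (cb%:E * (h y)%:E)%E) by exact: integrableZl.
have ih2 : Q.-integrable setT (fun y => (h y ^+ 2)%:E).
  apply/integrableP; split; first exact/measurable_EFinP.
  under eq_integral do rewrite gee0_abs ?lee_fin ?sqr_ge0//.
  by rewrite h2 ltry.
have is2 : Q.-integrable setT (fun y => (b2%:E * (h y ^+ 2)%:E)%E) by exact: integrableZl.
have icb : Q.-integrable setT (fun y => ((EFin \o cst c2) y + cb%:E * (h y)%:E)%E).
  exact: integrableD.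
transitivity (\int[Q]_y (((EFin \o cst c2) y + cb%:E * (h y)%:E) + b2%:E * (h y ^+ 2)%:E))%E.
  apply: ae_eq_integral => //.
  - by apply/measurable_EFinP; exact: measurable_funX.
  - by apply: emeasurable_funD; [exact: measurable_int icb|exact: measurable_int is2].
  - apply: ae_imp gE _ => y -> _ /=; rewrite -!EFinM -!EFinD; congr EFin.
    by rewrite /c2 /cb /b2; ring.
rewrite integralD// integralD// !integralZl// h0 h2 mule0 adde0.
by rewrite integral_prob_cst -EFinM -EFinD.
Qed.

End affine_moments.

Lemma varianceEint d (Y : measurableType d) (R : realType) (Q : probability Y R) (g : Y -> R) :
  ('V_Q[g] = \int[Q]_y ((g y - fine 'E_Q[g]) ^+ 2)%:E)%E.
Proof. by rewrite /variance !unlock; apply: eq_integral => y _; rewrite expr2. Qed.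

Section conditional_variance.
Context (R : realType) (X Wt : completePseudoMetricType R) (A : armType).
Variable M : model X Wt A.
Hypothesis str : max_arm_structure M.
Local Notation W := (discrete A * borel Wt)%type.
Local Notation Z := (borel X * W)%type.
Variable P : probability Z R.
Hypothesis LP : laws M P.

Lemma ae_forall_fin d (T : measurableType d) (mu : {measure set T -> \bar R}) (I : finType)
    (Pr : I -> T -> Prop) : (forall i, {ae mu, forall x, Pr i x}) ->
  {ae mu, forall x, forall i, Pr i x}.
Proof.
move=> h.
have : {ae mu, forall x, forall n : nat, if unpickle n is Some i then Pr i x else True}.
  by apply: ae_foralln => n; case: unpickle => [i|]; [exact: h|exact: aeW].
by move=> H; apply: ae_imp H _ => x H i; have := H (pickle i); rewrite pickleK.
Qed.

Lemma sigma2E x a : sigma2 M P x a = (\int[Qarm M P x a]_w (dev M P a x w ^+ 2)%:E)%E.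
Proof.
rewrite /sigma2 varianceEint; apply: eq_integral => w _.
by rewrite (score_identifies str LP).
Qed.

(** Scores are centred within each arm, so the cross terms vanish. The centre [e] is left free: the
    conditional mean gives the conditional variance, the overall mean the total variance. *)
Lemma second_moment_affine x (g : W -> R) (c b : A -> R) (e : R) :
  measurable_fun setT g ->
  (forall a, (sigma2 M P x a < +oo)%E) ->
  (forall a, {ae Qarm M P x a, forall w, g (a, w) = c a + b a * dev M P a x w}) ->
  (\int[cond M P x]_w ((g w - e) ^+ 2)%:E = (\sum_a pi_ M P x a * ((c a - e) ^+ 2 +
      b a ^+ 2 * fine (sigma2 M P x a)))%:E)%E.
Proof.
move=> mg s2 gE.
have me : measurable_fun setT (fun w => g w - e).
  by apply: measurable_funB => //; exact: measurable_cst.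
rewrite ge0_integral_arm//; first last.
- by move=> w; rewrite lee_fin sqr_ge0.
- by apply/measurable_EFinP; exact: measurable_funX.
rewrite -sumEFin; apply: eq_bigr => a _; rewrite EFinM; congr (_ * _)%E.
apply: (integral_affine_sqr (dev_integrable str LP a x)).
- exact: (measurable_fun_arm a me).
- exact: dev_mean.
- rewrite -sigma2E fineK// ge0_fin_numE// sigma2E.
  by apply: integral_ge0 => w _; rewrite lee_fin sqr_ge0.
- by apply: ae_imp (gE a) _ => w ->; rewrite addrAC.
Qed.

End conditional_variance.

(** * The lower bound on conditional variances *)

Section lower_bound.
Context (R : realType) (X Wt Waux : completePseudoMetricType R) (A : armType).
Variable M : model X Wt A.
Hypothesis scW : @second_countable Wt.
Hypothesis str : max_arm_structure M.
Local Notation W := (discrete A * borel Wt)%type.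
Local Notation Z := (borel X * W)%type.
Local Notation Y :=
  (Z * (armvec R A * armvec R A) * discrete {set A} * borel Waux)%type.
Variable P : probability Z R.
Hypothesis LP : laws M P.
Variables (gp rho : X -> A -> R).
Hypothesis gainE : forall x a t, gain M x a t = gp x a * t + rho x a.
Hypothesis gp_neq0 : forall x a, gp x a != 0.

Lemma sum_pi x : \sum_a pi_ M P x a = 1.
Proof.
apply: EFin_inj; rewrite -sumEFin; apply: etrans (probability_setT (cond M P x)).
rewrite (sum_arm_mass (cond M P x) measurableT); apply: eq_bigr => a _.
have -> : xsection [set: W] a = [set: borel Wt].
  by apply/seteqP; split=> // w _; apply/xsectionP.
by rewrite fineK// arm_mass_fin_num.
Qed.

(** Carries almost sure identities on an arm over to the perturbed arm law. *)
Lemma arm_law_dominated (q : probability W R) x a : q `<< cond M P x -> 0 < arm_prob q a ->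
  arm_law q a `<< Qarm M P x a.
Proof.
move=> /null_content_dominatesP qP q0; apply/null_content_dominatesP => B mB QB.
have c0 : cond M P x ([set a] `*` B) = 0%E.
  by apply: (etrans (arm_massE (cond M P x) a mB)); rewrite QB mule0.
have := qP _ (measurable_armX a mB) c0.
move=> /(etrans (esym (arm_massE q a mB))) /eqP.
by rewrite mule_eq0 eqe gt_eqF//= => /eqP.
Qed.

Section slopes.
Variables (f : Y -> R) (v : borel X -> borel Waux).
Hypothesis fFB : FB M f.
Hypothesis mv : measurable_fun setT v.
Local Notation F := (truth M f P v).
Variable D : set (borel X * armvec R A).
Hypothesis mixP : arm_mixtures M P.
Hypothesis dirP : direction_set M P D.
Hypothesis lawP : direction_laws M P D.

(** For [F] affine in the scores, the path moves its mean by the sum of pi_a b_a dl_a, and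
    [path_mean] says that this shift is [t x]. On active arms dl_a is t / g_a', elsewhere it is 0;
    dividing by t gives the constraint. *)
Lemma active_slopes : {ae marg P, forall x, exists b : A -> R,
  (forall a, {ae Qarm M P x a, forall w,
     F (x, (a, w)) = arm_mean M f v P a x + b a * dev M P a x w}) /\
  \sum_(a in kappa M P x) pi_ M P x a * (b a / gp x a) = 1}.
Proof.
have [mD D0 _ [eps [r [meps eps0 mr rP]]]] := dirP.
have [Q [Q0 QP _ Qglue]] := lawP.
(* Half of [eps] is positive, measurable and strictly inside the domain of the path. *)
pose t x := eps x / 2.
have t0 x : 0 < t x by rewrite divr_gt0.
have teps x : `|t x| < eps x by rewrite gtr0_norm// ltr_pdivrMr// ltr_pMr// ltr1n.
pose dl (x : borel X) : armvec R A := r x (t x).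
have mdl : measurable_fun setT dl.
  pose B := [set z : borel X * R | `|z.2| < eps z.1].
  have mB : measurable B.
    have mb : measurable_fun setT (fun z : borel X * R => `|z.2| < eps z.1).
      apply: measurable_fun_ltr.
        by apply: measurableT_comp => //; exact: measurable_snd.
      exact: (measurableT_comp meps (@measurable_fst _ _ (borel X) R)).
    by rewrite -[X in measurable X]setTI; exact: (mb measurableT [set true]).
  have mpair : measurable_fun setT (fun x : borel X => (x, t x)).
    apply: measurable_fun_pair; first exact: measurable_id.
    by apply: measurable_funM => //; exact: measurable_cst.
  have sub : (fun x : borel X => (x, t x)) @` setT `<=` B by move=> _ [x _ <-]; exact: teps.
  exact: (measurable_comp mB sub mr mpair).
have rt : {ae marg P, forall x, [/\ D (x, dl x),
    forall a, a \notin kappa M P x -> dl x a = 0 &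
    forall a, a \in kappa M P x ->
      gain M x a (u_ M P x a + dl x a) = gain M x a (u_ M P x a) + t x]}.
  by apply: ae_imp rP _ => x /(_ (t x) (teps x)).
have Qdl : {ae marg P, forall x, [/\ Q x (dl x) `<< cond M P x,
    arm_prob (Q x (dl x)) = pi_ M P x &
    forall a, (arm_law (Q x (dl x)) a).-integrable setT (fun w => (score M a w)%:E) /\
      ('E_(arm_law (Q x (dl x)) a)[score M a] = (u_ M P x a + dl x a)%:E)%E]}.
  by apply: ae_imp2 rt QP _ => x [Dx _ _] /(_ _ Dx)[].
have glueE (E : set (borel X)) : measurable E -> forall m, glues M P (localized M P m
    (fun x => Q x (if x \in E then dl x else @zerov R A))) (fun=> True).
  move=> mE m; pose dE (x : borel X) : armvec R A := if x \in E then dl x else @zerov R A.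
  have mdE : measurable_fun setT dE.
    by apply: measurable_fun_ifT => //; exact: measurable_fun_mem.
  have [|_ h] := Qglue dE (univ_measurable_measurable mdE); last exact: h.
  by apply: ae_imp2 rt D0 _ => x [Dx _ _] D0x; rewrite /dE; case: ifP.
have pathm := path_mean scW str fFB mv LP t0
  (ae_imp rt (fun x h => let: And3 _ h1 h2 := h in conj h1 h2)) Q0
  (ae_imp Qdl (fun x h => let: And3 _ h1 h2 := h in conj h1 (fun a => (h2 a).2))) glueE.
have aff : {ae marg P, forall x, forall a, exists b : R, {ae Qarm M P x a, forall w,
    F (x, (a, w)) = arm_mean M f v P a x + b * dev M P a x w}}.
  by apply: ae_forall_fin => a; exact: arm_affine.
have rQ := ae_imp2 rt Qdl (fun x => @conj _ _).
have pF := ae_imp2 pathm (F_integrable str fFB mv LP) (fun x => @conj _ _).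
apply: ae_imp3 aff rQ pF _ => x /choice[b bE] [[_ d0 d1] [qP qp qs]] [[iQ EQ] iF].
exists b; split => //.
have q0 a : 0 < arm_prob (Q x (dl x)) a by rewrite qp; exact: (Defs.pi_gt0 str LP).
have mFa a : measurable_fun setT (fun w : borel Wt => F (x, (a, w))).
  by have := measurableT_comp (measurable_F_arm str fFB mv LP a) (pair1_measurable (x : borel X)).
have Qa a : (\int[arm_law (Q x (dl x)) a]_w (F (x, (a, w)))%:E =
    (arm_mean M f v P a x + b a * dl x a)%:E)%E.
  have [iscore Escore] := qs a.
  have icst := finite_measure_integrable_cst (arm_law (Q x (dl x)) a) (u_ M P x a) measurableT.
  have idev : (arm_law (Q x (dl x)) a).-integrable setT (EFin \o dev M P a x).
    exact: (integrableB measurableT iscore icst).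
  apply: (integral_affine idev (mFa a)).
    have := integralB measurableT iscore icst; move=> h; apply: (etrans h).
    rewrite integral_prob_cst.
    by move: Escore; rewrite unlock => ->; rewrite -EFinB addrAC subrr add0r.
  (* The exceptional set of the affine identity is null for the unperturbed arm, hence by domination
     for the perturbed one. *)
  have [N [mN N0 NF]] := bE a; exists N; split => //.
  have /null_content_dominatesP := arm_law_dominated qP (q0 a); exact.
have Pa a : (\int[Qarm M P x a]_w (F (x, (a, w)))%:E = (arm_mean M f v P a x)%:E)%E.
  by rewrite /arm_mean fineK//; apply: integrable_fin_num => //; exact: F_arm_integrable.
move: EQ; rewrite !integral_arm//; last exact: (Defs.pi_gt0 str LP).
under eq_bigr do rewrite Qa qp -EFinM.
under [in X in _ = X -> _]eq_bigr do rewrite Pa -EFinM.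
rewrite !sumEFin -EFinD => -[].
have -> : \sum_a pi_ M P x a * (arm_mean M f v P a x + b a * dl x a) =
    \sum_a pi_ M P x a * arm_mean M f v P a x + \sum_a pi_ M P x a * (b a * dl x a).
  by rewrite -big_split; apply: eq_bigr => a _; rewrite mulrDr.
move/addrI.
have -> : \sum_a pi_ M P x a * (b a * dl x a) =
    t x * \sum_(a in kappa M P x) pi_ M P x a * (b a / gp x a).
  rewrite [in RHS]big_mkcond mulr_sumr; apply: eq_bigr => a _; case: ifPn => ak.
    have := d1 a ak; rewrite !gainE mulrDr => h.
    have g0 := gp_neq0 x a.
    have -> : dl x a = t x / gp x a by apply: (mulfI g0); rewrite mulrCA divff// mulr1; lra.
    ring.
  by rewrite d0// !mulr0.
by move=> h; apply: (mulfI (lt0r_neq0 (t0 x))); rewrite h mulr1.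
Qed.

(** The conditional variance is a sum of nonnegative terms. The spread of the arm means and the
    inactive arms are dropped, and the quadratic form that is left is minimized under the constraint
    on the slopes. *)
Lemma variance_lower_bound :
  {ae marg P, forall x,
    (forall a, 0 < pi_ M P x a /\ (sigma2 M P x a < +oo)%E) /\
    (forall a, a \in kappa M P x -> (0 < sigma2 M P x a)%E)} ->
  {ae marg P, forall x,
    ((active_bound M gp P x)%:E <= 'V_(cond M P x)[fun w => F (x, w)])%E}.
Proof.
move=> sig; apply: ae_imp2 sig active_slopes _ => x [sfin spos] [b [bE bsum]].
have mFx : measurable_fun setT (fun w : W => F (x, w)).
  by have := measurableT_comp (measurable_truth str fFB mv LP) (pair1_measurable (x : borel X)).
rewrite varianceEint (second_moment_affine str LP _ mFx (fun a => (sfin a).2) bE).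
rewrite lee_fin.
have [c ck] := exists_argmax M x (u_ M P x).
have fs a : sigma2 M P x a \is a fin_num.
  by rewrite ge0_fin_numE ?(sfin a).2// sigma2E//; apply: integral_ge0 => w _; rewrite lee_fin sqr_ge0.
have s0 a : 0 <= fine (sigma2 M P x a).
  by apply/fine_ge0; rewrite sigma2E//; apply: integral_ge0 => w _; rewrite lee_fin sqr_ge0.
have pi0 a : 0 < pi_ M P x a := (sfin a).1.
apply: (@le_trans _ _ (\sum_(a in kappa M P x) pi_ M P x a * (b a ^+ 2 * fine (sigma2 M P x a)))).
  apply: weighted_cauchy_schwarz => //.
  - by apply/set0Pn; exists c.
  - by move=> a ak; rewrite fine_gt0// spos//= (sfin a).2.
rewrite big_mkcond; apply: ler_sum => a _; case: ifP => _.
  by rewrite ler_wpM2l// ?lerDr ?sqr_ge0// ltW.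
apply: mulr_ge0; first exact: ltW.
by rewrite addr_ge0 ?sqr_ge0// mulr_ge0 ?sqr_ge0.
Qed.

End slopes.

(** The slope of an affine gain is its value at 1 minus its value at 0. *)
Lemma measurable_gp a : measurable_fun setT (fun x : borel X => gp x a).
Proof.
have mg (t : R) : measurable_fun setT (fun x : borel X => gain M x a t).
  exact: (measurableT_comp (gain_measurable str a)
    (measurable_fun_pair (@measurable_id _ (borel X) setT) (@measurable_cst _ _ _ _ _ t))).
have -> : (fun x : borel X => gp x a) = (fun x => gain M x a 1 - gain M x a 0).
  by apply/funext => x; rewrite !gainE mulr1 mulr0; ring.
exact: measurable_funB.
Qed.

Lemma measurable_sigma2 a : measurable_fun setT (fun x : borel X => fine (sigma2 M P x a)).
Proof.
have md : measurable_fun setT (fun z : borel X * borel Wt => (dev M P a z.1 z.2 ^+ 2)%:E).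
  by apply/measurable_EFinP; apply: measurable_funX; exact: measurable_dev.
have mk := measurable_kint (measurable_Qarm str a LP) md.
apply: measurableT_comp => //.
by move: mk; congr measurable_fun; apply/funext => x; rewrite sigma2E.
Qed.

Lemma measurable_info_term a : measurable_fun setT
  (fun x : borel X => pi_ M P x a / (gp x a ^+ 2 * fine (sigma2 M P x a))).
Proof.
apply: measurable_funM; first exact: measurable_pi.
apply: measurable_funV; apply: measurable_funM; last exact: measurable_sigma2.
by apply: measurable_funX; exact: measurable_gp.
Qed.

Lemma measurable_active_info : measurable_fun setT (active_info M gp P : borel X -> R).
Proof.
rewrite /active_info; under eq_fun do rewrite big_mkcond.
apply: measurable_sum => a; apply: measurable_fun_ifT; [|exact: measurable_info_term|exact: measurable_cst].
apply: (@measurable_fun_bool _ _ _ _ true); rewrite setTI.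
exact: (measurable_kappaP str a LP).
Qed.

Lemma measurable_active_bound : measurable_fun setT (active_bound M gp P : borel X -> R).
Proof. exact: measurable_funV measurable_active_info. Qed.

Lemma active_bound_ge0 x : 0 <= active_bound M gp P x.
Proof.
rewrite invr_ge0; apply: sumr_ge0 => a _; apply: divr_ge0.
  exact/ltW/(Defs.pi_gt0 str LP).
rewrite mulr_ge0 ?sqr_ge0//; apply/fine_ge0; rewrite sigma2E//.
by apply: integral_ge0 => w _; rewrite lee_fin sqr_ge0.
Qed.

End lower_bound.

(** * The oracle *)

Section oracle.
Context (R : realType) (X Wt Waux : completePseudoMetricType R) (A : armType).
Variable M : model X Wt A.
Hypothesis str : max_arm_structure M.
Local Notation W := (discrete A * borel Wt)%type.
Local Notation Z := (borel X * W)%type.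
Local Notation Y :=
  (Z * (armvec R A * armvec R A) * discrete {set A} * borel Waux)%type.

Lemma ae_arm (q : probability W R) (Pr : W -> Prop) a : 0 < arm_prob q a ->
  {ae q, forall w, Pr w} -> {ae arm_law q a, forall w, Pr (a, w)}.
Proof.
move=> q0 [N [mN N0 NP]]; have mx : measurable (xsection N (a : discrete A)).
  exact: measurable_xsection.
exists (xsection N (a : discrete A)); split => //.
- have m0 : arm_mass q a (xsection N (a : discrete A)) = 0%E.
    apply/eqP; rewrite eq_le measure_ge0 andbT -N0; apply: le_measure; rewrite ?inE//.
      exact: measurable_armX.
    by move=> [b w] [/= -> /xsectionP].
  move: (arm_massE q a mx); rewrite m0 => /esym/eqP.
  by rewrite mule_eq0 eqe gt_eqF//= => /eqP.
- by move=> w /= Nw; apply/xsectionP; exact: NP.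
Qed.

Lemma variance_ae d (T : measurableType d) (Q : probability T R) (g h : T -> R) :
  measurable_fun setT g -> measurable_fun setT h -> {ae Q, forall y, g y = h y} ->
  ('V_Q[g] = 'V_Q[h])%E.
Proof.
move=> mg mh gh.
have eE : 'E_Q[g]%E = 'E_Q[h]%E.
  rewrite unlock; apply: ae_eq_integral => //; [exact/measurable_EFinP|exact/measurable_EFinP|].
  by apply: ae_imp gh _ => y -> _.
have mm (l : T -> R) (e : R) : measurable_fun setT l ->
    measurable_fun setT (fun y => ((l y - e) ^+ 2)%:E).
  move=> ml; apply/measurable_EFinP; apply: measurable_funX.
  by apply: measurable_funB => //; exact: measurable_cst.
rewrite !varianceEint eE; apply: ae_eq_integral => //; [exact: mm|exact: mm|].
by apply: ae_imp gh _ => y -> _.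
Qed.

(* Freezing the auxiliary argument is why [Vmin] does not depend on it. *)
Definition freeze (f : Y -> R) (w : borel X -> borel Waux) (y : Y) : R :=
  f (y.1, w y.1.1.1.1).

Lemma FB_freeze f w : FB M f -> measurable_fun setT (w : borel X -> borel Waux) ->
  FB M (freeze f w).
Proof.
move=> [mf fu] mw; split.
  have m1 := @measurable_fst _ _ (Z * (armvec R A * armvec R A) * discrete {set A})%type (borel Waux).
  have m2 := measurableT_comp (@measurable_fst _ _ (Z * (armvec R A * armvec R A))%type (discrete {set A})) m1.
  have m3 := measurableT_comp (@measurable_fst _ _ Z (armvec R A * armvec R A)%type) m2.
  have m4 := measurableT_comp (@measurable_fst _ _ (borel X) W) m3.
  exact: (measurableT_comp mf (measurable_fun_pair m1 (measurableT_comp mw m4))).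
by move=> P P' LP LP' v mv h; exact: (fu P P' LP LP' w mw h).
Qed.

Variable P : probability Z R.
Hypothesis LP : laws M P.
Variables (gp rho : X -> A -> R).
Hypothesis gainE : forall x a t, gain M x a t = gp x a * t + rho x a.
Hypothesis gp_neq0 : forall x a, gp x a != 0.
Hypothesis sig : {ae marg P, forall x,
    (forall a, 0 < pi_ M P x a /\ (sigma2 M P x a < +oo)%E) /\
    (forall a, a \in kappa M P x -> (0 < sigma2 M P x a)%E)}.

(** On active arms with the assumed positivity this is 1 / (g_a' sigma_a^2 J), where J is
    [active_info]: the equality case of [weighted_cauchy_schwarz]. *)
Definition oracle_slope x a : R :=
  if a \in kappa M P x then gp x a * lambda_star M gp P x a / pi_ M P x a else 0.

Lemma phi_starE x a w : phi_star M gp P (x, (a, w)) =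
  psiP M P x + oracle_slope x a * dev M P a x w.
Proof. by rewrite /phi_star /oracle_slope /=; case: ifP => _; rewrite ?mul0r. Qed.

(** Each active term equals its share of [active_info] divided by the square of [active_info]. The
    total information is positive because some arm is active. *)
Lemma oracle_variance x :
  (forall a, 0 < pi_ M P x a /\ (sigma2 M P x a < +oo)%E) ->
  (forall a, a \in kappa M P x -> (0 < sigma2 M P x a)%E) ->
  \sum_a pi_ M P x a * (oracle_slope x a ^+ 2 * fine (sigma2 M P x a)) = active_bound M gp P x.
Proof.
move=> sfin spos.
have pi0 a : 0 < pi_ M P x a := (sfin a).1.
have s0 a : a \in kappa M P x -> 0 < fine (sigma2 M P x a).
  by move=> ak; rewrite fine_gt0// spos//= (sfin a).2.
have J0 : 0 < active_info M gp P x.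
  have [c ck] := exists_argmax M x (u_ M P x).
  have t0 a : a \in kappa M P x -> 0 < pi_ M P x a / (gp x a ^+ 2 * fine (sigma2 M P x a)).
    by move=> ak; rewrite divr_gt0// mulr_gt0 ?s0// exprn_even_gt0//= gp_neq0.
  rewrite /active_info (bigD1 c)//= ltr_wpDr ?t0//.
  by apply: sumr_ge0 => a /andP[ak _]; exact/ltW/t0.
transitivity (\sum_(a in kappa M P x)
    (pi_ M P x a / (gp x a ^+ 2 * fine (sigma2 M P x a))) * (active_info M gp P x) ^- 2).
  rewrite [RHS]big_mkcond; apply: eq_bigr => a _; rewrite /oracle_slope /lambda_star.
  case: ifPn => ak; last by rewrite expr0n /= mul0r mulr0.
  rewrite ak; have pi1 := lt0r_neq0 (pi0 a); have s1 := lt0r_neq0 (s0 a ak); have g1 := gp_neq0 x a.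
  have J1 := lt0r_neq0 J0.
  move: pi1 s1 g1 J1; move: (pi_ _ _ _ _) (fine _) (gp x a) (active_info _ _ _ _) => p s g J.
  by move=> p1 s1 g1 J1; field; apply/and4P; split.
rewrite -mulr_suml -/(active_info M gp P x) /active_bound.
by field; rewrite gt_eqF.
Qed.

(** The coefficients depend on the observed arm; distinguishing cases by the code of the arm leaves
    functions of x and of the score for one fixed arm. *)
Lemma measurable_phi_star : measurable_fun setT (phi_star M gp P).
Proof.
have mfst := @measurable_fst _ _ (borel X) W.
have msnd := @measurable_snd _ _ (borel X) W.
have m21 := measurableT_comp (@measurable_fst _ _ (discrete A) (borel Wt)) msnd.
have m22 := measurableT_comp (@measurable_snd _ _ (discrete A) (borel Wt)) msnd.
have mpsi : measurable_fun setT (psiP M P : borel X -> R).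
  by apply/measurable_EFinP; exact: measurable_int (psi_integrable str LP).
have mslope a : measurable_fun setT (fun x : borel X => oracle_slope x a).
  have mk : measurable_fun setT (fun x : borel X => a \in kappa M P x).
    apply: (@measurable_fun_bool _ _ _ _ true); rewrite setTI.
    exact: (measurable_kappaP str a LP).
  have mpi := measurable_pi str a LP.
  apply: measurable_fun_ifT => //; apply: measurable_funM; last exact: measurable_funV.
  apply: measurable_funM; first exact: (measurable_gp str gainE a).
  apply: measurable_fun_ifT => //; apply: measurable_funM.
    exact: (measurable_info_term str LP gainE a).
  by apply: measurable_funV; exact: (measurable_active_info str LP gainE).
pose g (n : nat) (z : Z) : R := if unpickle n is Some a
  then psiP M P z.1 + oracle_slope z.1 a * dev M P a z.1 z.2.2 else 0.
have -> : phi_star M gp P = fun z => g (pickle (z.2.1 : A)) z.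
  by apply/funext => -[x [a y]]; rewrite phi_starE /g /= pickleK.
apply: measurable_fun_countable_cases => n.
  rewrite -[X in measurable X]setTI.
  exact: (measurableT_comp (@measurable_discrete A _ _ (fun a => pickle (a : A) : nat)) m21).
rewrite /g; case: unpickle => [a|]; last exact: measurable_cst.
apply: measurable_funD; first exact: (measurableT_comp mpsi mfst).
apply: measurable_funM; first exact: (measurableT_comp (mslope a) mfst).
exact: (measurableT_comp (measurable_dev str LP a) (measurable_fun_pair mfst m22)).
Qed.

Section realization.
Variables (f : Y -> R) (w : X -> Waux).
Hypothesis oracle : oracle_realization M gp P f w.
Local Notation F := (truth M f P w).

Let fFB : FB M f. Proof. by case: oracle. Qed.
Let mw : measurable_fun setT (w : borel X -> borel Waux). Proof. by case: oracle. Qed.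
Let mF : measurable_fun setT F. Proof. exact: (measurable_truth str fFB mw LP). Qed.

Let oracle_arm : {ae marg P, forall x, forall a, {ae Qarm M P x a, forall y,
  F (x, (a, y)) = psiP M P x + oracle_slope x a * dev M P a x y}}.
Proof.
have [_ _ Fphi _] := oracle.
have h := ae_disintegration (cond_measurable str LP) (cond_law str LP) Fphi.
apply: ae_imp h _ => x hx a.
apply: ae_imp (ae_arm (Defs.pi_gt0 str LP x a) hx) _ => y ->.
exact: phi_starE.
Qed.

Let oracle_second_moment : {ae marg P, forall x, forall e : R,
  (\int[cond M P x]_y ((F (x, y) - e) ^+ 2)%:E =
   (active_bound M gp P x + (psiP M P x - e) ^+ 2)%:E)%E}.
Proof.
apply: ae_imp2 sig oracle_arm _ => x [sfin spos] FE e.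
have mFx : measurable_fun setT (fun y : W => F (x, y)).
  by have := measurableT_comp mF (pair1_measurable (x : borel X)).
rewrite (second_moment_affine str LP _ mFx (fun a => (sfin a).2) FE); congr EFin.
under eq_bigr do rewrite mulrDr.
by rewrite big_split /= -mulr_suml sum_pi// mul1r oracle_variance// addrC.
Qed.

Let oracle_mean : {ae marg P, forall x, ('E_(cond M P x)[fun y => F (x, y)] = (psiP M P x)%:E)%E}.
Proof.
apply: ae_imp2 oracle_arm (F_integrable str fFB mw LP) _ => x FE iF.
rewrite unlock integral_arm//; last exact: (Defs.pi_gt0 str LP).
transitivity (\sum_a (pi_ M P x a * psiP M P x)%:E)%E.
  apply: eq_bigr => a _; rewrite EFinM; congr (_ * _)%E.
  have mFa : measurable_fun setT (fun y : borel Wt => F (x, (a, y))).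
    by have := measurableT_comp (measurable_F_arm str fFB mw LP a) (pair1_measurable (x : borel X)).
  rewrite (integral_affine (dev_integrable str LP a x) mFa (dev_mean str LP a x) (FE a)).
  by rewrite mulr0 addr0.
by rewrite sumEFin -mulr_suml sum_pi// mul1r.
Qed.

Lemma oracle_conditional_variance : {ae marg P, forall x,
  ('V_(cond M P x)[fun y => F (x, y)] = (active_bound M gp P x)%:E)%E}.
Proof.
apply: ae_imp2 oracle_second_moment oracle_mean _ => x h2 h1.
by rewrite varianceEint h1 h2 subrr expr0n addr0.
Qed.

(** The law of total variance: conditional second moments about the overall mean are integrated over
    x. Unbiasedness at [P] makes the mean of [F] that of [psiP], and all integrands are nonnegative,
    so the identity holds in the extended reals. *)
Lemma oracle_total_variance :
  (\int[marg P]_x (active_bound M gp P x)%:E + 'V_(marg P)[psiP M P] = 'V_P[F])%E.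
Proof.
have cP : compatible M P P by exact: self_compatible.
have [_ EF] := compatible_unbiased str fFB mw LP cP.
have eE : fine 'E_P[F]%E = fine 'E_(marg P)[psiP M P]%E by rewrite !unlock EF.
set e := fine 'E_P[F]%E in eE.
have mpsi : measurable_fun setT (psiP M P : borel X -> R).
  by apply/measurable_EFinP; exact: measurable_int (psi_integrable str LP).
have mb := measurable_active_bound str LP gainE.
have mpe : measurable_fun setT (fun x : borel X => ((psiP M P x - e) ^+ 2)%:E).
  apply/measurable_EFinP; apply: measurable_funX.
  by apply: measurable_funB => //; exact: measurable_cst.
have mFe : measurable_fun setT (fun z : Z => ((F z - e) ^+ 2)%:E).
  apply/measurable_EFinP; apply: measurable_funX.
  by apply: measurable_funB => //; exact: measurable_cst.
have mbE : measurable_fun setT (fun x : borel X => (active_bound M gp P x)%:E).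
  exact/measurable_EFinP.
rewrite !varianceEint -eE -/e -ge0_integralD//; first last.
- by move=> x _; rewrite lee_fin sqr_ge0.
- by move=> x _; rewrite lee_fin active_bound_ge0.
rewrite (ge0_integral_disintegration (cond_measurable str LP) (cond_law str LP) mFe); last first.
  by move=> z; rewrite lee_fin sqr_ge0.
apply: ae_eq_integral => //.
- exact: emeasurable_funD.
- exact: (measurable_kint (cond_measurable str LP) mFe).
- by apply: ae_imp oracle_second_moment _ => x h _; rewrite h EFinD.
Qed.

Lemma oracle_finite_variance : ('V_P[F] < +oo)%E.
Proof.
have [_ _ Fphi Vphi] := oracle; rewrite (variance_ae mF measurable_phi_star)//.
Qed.

End realization.
End oracle.

Theorem theorem5p7 (R : realType) (X Wt Waux : completePseudoMetricType R)
    (A : armType) (M : model X Wt A) :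
  polish X -> polish Wt -> polish Waux ->
  max_arm_structure M -> standing_conditions M -> perturbation_conditions M ->
  forall P : probability (borel X * (discrete A * borel Wt))%type R,
  laws M P ->
  forall gp rho : X -> A -> R,
  (forall x a t, gain M x a t = gp x a * t + rho x a) ->
  (forall x a, gp x a != 0) ->
  {ae marg P, forall x,
    (forall a, 0 < pi_ M P x a /\ (sigma2 M P x a < +oo)%E) /\
    (forall a, a \in kappa M P x -> (0 < sigma2 M P x a)%E)} ->
  (forall v : borel X -> borel Waux, measurable_fun setT v ->
     {ae marg P, forall x, ((active_bound M gp P x)%:E <= Vmin M P v x)%E}) /\
  (forall f w, @oracle_realization R X Wt A M Waux gp P f w ->
     (forall v : borel X -> borel Waux, measurable_fun setT v ->
        {ae marg P, forall x, Vmin M P v x = (active_bound M gp P x)%:E}) /\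
     (\int[marg P]_x (active_bound M gp P x)%:E + 'V_(marg P)[psiP M P] =
      'V_P[truth M f P w])%E).
Proof.
move=> _ [_ scW] _ str _ pert P LP gp rho gainE gp0 sig.
have lower (v : borel X -> borel Waux) : measurable_fun setT v ->
    {ae marg P, forall x, ((active_bound M gp P x)%:E <= Vmin M P v x)%E}.
  move=> mv; have [_ glb] := ess_inf_familyP (marg P) (cond_variances M P v).
  have [mixP [D [dirP lawP]]] := pert P LP.
  (* The essential infimum dominates every measurable almost sure lower bound of the family. *)
  apply: (glb (fun x => (active_bound M gp P x)%:E)); split.
    apply/measurable_EFinP; exact: (measurable_active_bound str LP gainE).
  move=> _ [f [fFB _ ->]].
  exact: (variance_lower_bound scW str LP gainE gp0 fFB mv mixP dirP lawP sig).
split=> // f w orc; split; last exact: (oracle_total_variance str LP gainE gp0 sig orc).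
move=> v mv; have [fFB mw _ _] := orc.
have [[_ Vle] _] := ess_inf_familyP (marg P) (cond_variances M P v).
have upper : {ae marg P, forall x,
    (Vmin M P v x <= 'V_(cond M P x)[fun y => truth M f P w (x, y)])%E}.
  apply: Vle; exists (freeze f w); split => //; first exact: FB_freeze.
  exact: (oracle_finite_variance str LP gainE orc).
apply: ae_imp3 (lower v mv) upper (oracle_conditional_variance str LP gp0 sig orc) _.
by move=> x h1 h2 h3; apply/le_anti; rewrite h1 andbT -h3.
Qed.
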